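(* There is an algorithm that, given an $n$-vertex graph $G$ and an sd-degeneracy sequence of $G$ of width $d$, solves All-Pairs Shortest Path on $G$ in time $O(dn^2\log n)$.
   Context: For $u,v\in V(G)$, $\mathrm{sd}_G(u,v)=|(N_G(u)\setminus\{v\})\triangle(N_G(v)\setminus\{u\})|$. An sd-degeneracy sequence of an $n$-vertex graph $G$ is a list $(u_1,v_1),\dots,(u_{n-1},v_{n-1})$ with $u_i\neq v_i$, $V(G)=\{u_1,\dots,u_{n-1},v_{n-1}\}$, and no $i<j$ with $u_i\in\{u_j,v_j\}$; its width is $\max_i\mathrm{sd}_{G-\{u_1,\dots,u_{i-1}\}}(u_i,v_i)$. All-Pairs Shortest Path asks for all pairwise distances in the unweighted graph $G$. *)

(* Defs.v *)
From mathcomp Require Import all_boot all_order.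
Set Implicit Arguments.
Unset Strict Implicit.
Unset Printing Implicit Defensive.

(** * Word RAM

    Programs are structured programs over finitely many registers and a memory
    addressed by words.  Words have [w] bits and are represented by naturals
    below [2 ^ w]; [Read] gives indirect read access and [Write] indirect write
    access.  Each operation on words, register access, memory access and test
    takes one unit of time. *)

Inductive expr : Type :=
| Const of nat
| Reg of nat
| Read of expr
| Add of expr & expr
| Sub of expr & expr
| Mul of expr & expr
| Div of expr & expr
| Ltb of expr & expr
| Eqb of expr & expr.

Inductive cmd : Type :=
| Skip
| Assign of nat & expr
| Write of expr & expr
| Seq of cmd & cmd
| If of expr & cmd & cmd
| While of expr & cmd.

Record state : Type := State { regs : nat -> nat; memory : nat -> nat }.

Definition update (f : nat -> nat) (a v : nat) : nat -> nat :=
  fun b => if b == a then v else f b.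

(* Arithmetic is modulo [2 ^ w]; division by zero yields zero. *)
Fixpoint eval (w : nat) (st : state) (a : expr) : nat :=
  match a with
  | Const k => k %% 2 ^ w
  | Reg r => regs st r
  | Read a1 => memory st (eval w st a1)
  | Add a1 a2 => (eval w st a1 + eval w st a2) %% 2 ^ w
  | Sub a1 a2 => (eval w st a1 + (2 ^ w - eval w st a2)) %% 2 ^ w
  | Mul a1 a2 => (eval w st a1 * eval w st a2) %% 2 ^ w
  | Div a1 a2 => eval w st a1 %/ eval w st a2
  | Ltb a1 a2 => (eval w st a1 < eval w st a2) %% 2 ^ w
  | Eqb a1 a2 => (eval w st a1 == eval w st a2) %% 2 ^ w
  end.

Fixpoint cost (a : expr) : nat :=
  match a with
  | Const _ | Reg _ => 1
  | Read a1 => (cost a1).+1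
  | Add a1 a2 | Sub a1 a2 | Mul a1 a2 | Div a1 a2 | Ltb a1 a2 | Eqb a1 a2 =>
      (cost a1 + cost a2).+1
  end.

(* [exec w c st t st']: with word size [w], the program [c] started in [st]
   halts in [st'] after exactly [t] units of time. *)
Inductive exec (w : nat) : cmd -> state -> nat -> state -> Prop :=
| ExecSkip st :
    exec w Skip st 1 st
| ExecAssign st r a :
    exec w (Assign r a) st (cost a).+1
      (State (update (regs st) r (eval w st a)) (memory st))
| ExecWrite st a b :
    exec w (Write a b) st (cost a + cost b).+1
      (State (regs st) (update (memory st) (eval w st a) (eval w st b)))
| ExecSeq c1 c2 st t1 st1 t2 st2 :
    exec w c1 st t1 st1 -> exec w c2 st1 t2 st2 ->
    exec w (Seq c1 c2) st (t1 + t2) st2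
| ExecIfTrue a c1 c2 st t st1 :
    eval w st a <> 0 -> exec w c1 st t st1 ->
    exec w (If a c1 c2) st (cost a + t).+1 st1
| ExecIfFalse a c1 c2 st t st1 :
    eval w st a = 0 -> exec w c2 st t st1 ->
    exec w (If a c1 c2) st (cost a + t).+1 st1
| ExecWhileTrue a c st t1 st1 t2 st2 :
    eval w st a <> 0 -> exec w c st t1 st1 -> exec w (While a c) st1 t2 st2 ->
    exec w (While a c) st (cost a + t1 + t2).+1 st2
| ExecWhileFalse a c st :
    eval w st a = 0 ->
    exec w (While a c) st (cost a).+1 st.

(* The input occupies the memory from address 0 on; everything else is 0. *)
Definition init_state (input : seq nat) : state :=
  State (fun=> 0) (nth 0 input).

(** * Symmetric difference and sd-degeneracy

    A graph on ['I_n] is a symmetric irreflexive relation [e]; its induced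
    subgraphs are given by their vertex sets. *)

Definition nbhd n (e : rel 'I_n) (A : {set 'I_n}) (u : 'I_n) : {set 'I_n} :=
  [set x in A | e u x].

Definition symdiff (T : finType) (A B : {set T}) : {set T} :=
  (A :\: B) :|: (B :\: A).

Definition sd n (e : rel 'I_n) (A : {set 'I_n}) (u v : 'I_n) : nat :=
  #|symdiff (nbhd e A u :\ v) (nbhd e A v :\ u)|.

(* The condition on the vertex set is stated for the last index of [s], so it
   is void for [n = 1], where the sequence is empty. *)
Definition sd_degeneracy_seq n (s : (n.-1).-tuple ('I_n * 'I_n)) : Prop :=
  let u i := (tnth s i).1 in
  let v i := (tnth s i).2 in
  [/\ forall i, u i <> v i,
      forall i : 'I_n.-1, i.+1 = n.-1 ->
        [set: 'I_n] = v i |: [set u j | j : 'I_n.-1]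
    & forall i j : 'I_n.-1, i < j -> u i <> u j /\ u i <> v j].

Definition sd_width n (e : rel 'I_n) (s : (n.-1).-tuple ('I_n * 'I_n)) : nat :=
  \max_(i < n.-1)
     sd e (~: [set (tnth s j).1 | j : 'I_n.-1 & j < i])
        (tnth s i).1 (tnth s i).2.

(** * All-Pairs Shortest Path *)

Definition is_distance n (e : rel 'I_n) (x y : 'I_n) (k : nat) : Prop :=
  (exists p, [/\ path e x p, last x p = y & size p = k]) /\
  (forall p, path e x p -> last x p = y -> k <= size p).

(* [n], the adjacency matrix in row-major order, then u_1, v_1, u_2, v_2, ... *)
Definition apsp_input n (e : rel 'I_n) (s : (n.-1).-tuple ('I_n * 'I_n)) :
    seq nat :=
  n :: [seq nat_of_bool (e x y) | x <- enum 'I_n, y <- enum 'I_n]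
    ++ flatten [seq [:: val p.1; val p.2] | p <- s].

(* The distance matrix in row-major order from address 0 on.  Finite distances
   are less than [n], so [n] stands for infinity. *)
Definition apsp_output n (e : rel 'I_n) (m : nat -> nat) : Prop :=
  forall x y : 'I_n,
    if connect e x y then is_distance e x y (m (x * n + y))
    else m (x * n + y) = n.

(* Binary logarithm, kept positive at [n = 1]. *)
Definition lg (n : nat) : nat := maxn 1 (trunc_log 2 n).

(* Main.v *)
(* Let u_1, v_1, u_2, v_2, ... be the sequence.  Inserting the u_i, last one
   first, right after v_i orders the vertices so that, when u_1, u_2, ... are
   contracted in turn into v_1, v_2, ..., all blocks are intervals.
   Contracting u_i changes the matrix of adjacencies between blocks only in at
   most 2 (d + 1) rectangles, products of two blocks.  So the ones of the
   reordered adjacency matrix split into O(dn) rectangles: take the maximal runs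
   of ones in the rows and merge equal runs of consecutive rows.  A run that
   ends at some row is charged to a corner of a rectangle that changed.

   The interval of rows, and that of columns, of each rectangle is the union of
   two intervals whose length is a power of two.  This gives a digraph of
   out-degree at most 3 with O(n log n + dn) nodes, in which a row node leads to
   a column node exactly when the two vertices are adjacent.  A breadth-first
   search in G from one source marks each node of this digraph once, and hence
   takes time O(dn log n). *)

(* A contraction of u_i into v_i changes adjacencies only towards v_i and the at most d vertices
   that distinguish the two. Symmetry doubles these products of intervals, and each has at most four
   corners: 8 (d + 1) corners per contraction. No corner is charged twice, since it is sought
   between the column before a run and its last column, and these windows are disjoint for the
   maximal runs of one row.

   Marking each node once per search is enough although several vertices lead to it: vertices are
   explored by increasing distance, so what an already marked node leads to has a label no larger
   than a second visit would assign.

   Words wrap around, so the program is written over unbounded naturals and its triples carry,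
   besides the postcondition and the time, a bound 100 n^2 on intermediate values. It does not
   involve d, so the number of rectangles is also bounded by n^2. Loop counts are fixed on entry; a
   bound on the number of steps turns the breadth-first search into such a loop. *)
Require Import Defs.
From mathcomp Require Import all_boot all_order zify.
Set Implicit Arguments.
Unset Strict Implicit.
Unset Printing Implicit Defensive.

(* [lia] is exponential in the number of boolean hypotheses, so those that are
   not about numbers are cleared first. *)
Ltac numeric T :=
  lazymatch T with
  | is_true (leq _ _) => idtac
  | is_true (andb (leq _ _) (leq _ _)) => idtac
  | is_true (negb (@eq_op _ ?x _)) =>
      let A := type of x in let A' := eval hnf in A in constr_eq A' nat
  | is_true (@eq_op _ ?x _) =>
      let A := type of x in let A' := eval hnf in A in constr_eq A' nat
  | @eq ?A _ _ => let A' := eval hnf in A in constr_eq A' nat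
  | ~ (@eq nat _ _) => idtac
  | ~ (is_true (leq _ _)) => idtac
  end.

Ltac clear_non_numeric :=
  repeat match goal with
  | H : ?T |- _ =>
      lazymatch type of T with Prop => idtac end;
      tryif numeric T then fail else clear H
  end.

Ltac arith := clear_non_numeric; lia.

(** * A language with arrays and for-loops, compiled to the word RAM *)

Inductive aexp : Type :=
| Num of nat
| Var of nat
| Get of nat & aexp
| Plus of aexp & aexp
| Minus of aexp & aexp
| Times of aexp & aexp
| Less of aexp & aexp
| Same of aexp & aexp.

Inductive acmd : Type :=
| Pass
| Upd of nat & aexp
| Put of nat & aexp & aexp
| Then of acmd & acmd
| Cond of aexp & acmd & acmd
| For of nat & nat & acmd.

Record astate : Type :=
  AState { var : nat -> nat; arr : nat -> nat -> nat }.

Definition set_var (m : astate) r v :=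
  AState (fun q => if q == r then v else var m q) (arr m).

Arguments update : simpl never.

Definition set_arr (m : astate) k i v :=
  AState (var m) (fun k' => if k' == k then update (arr m k) i v else arr m k').

Fixpoint aeval (m : astate) (a : aexp) : nat :=
  match a with
  | Num k => k
  | Var r => var m r
  | Get k a1 => arr m k (aeval m a1)
  | Plus a1 a2 => aeval m a1 + aeval m a2
  | Minus a1 a2 => aeval m a1 - aeval m a2
  | Times a1 a2 => aeval m a1 * aeval m a2
  | Less a1 a2 => aeval m a1 < aeval m a2
  | Same a1 a2 => aeval m a1 == aeval m a2
  end.

Definition next_iter (f : astate -> astate) r m :=
  let m' := f m in set_var m' r (var m' r).+1.

Fixpoint arun (c : acmd) (m : astate) : astate :=
  match c with
  | Pass => m
  | Upd r a => set_var m r (aeval m a)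
  | Put k a b => set_arr m k (aeval m a) (aeval m b)
  | Then c1 c2 => arun c2 (arun c1 m)
  | Cond a c1 c2 => if aeval m a == 0 then arun c2 m else arun c1 m
  | For r l c1 => iter (var m l) (next_iter (arun c1) r) (set_var m r 0)
  end.

Fixpoint var_mod (c : acmd) : seq nat :=
  match c with
  | Pass | Put _ _ _ => [::]
  | Upd r _ => [:: r]
  | Then c1 c2 | Cond _ c1 c2 => var_mod c1 ++ var_mod c2
  | For r _ c1 => r :: var_mod c1
  end.

Fixpoint arr_mod (c : acmd) : seq nat :=
  match c with
  | Pass | Upd _ _ => [::]
  | Put k _ _ => [:: k]
  | Then c1 c2 | Cond _ c1 c2 => arr_mod c1 ++ arr_mod c2
  | For _ _ c1 => arr_mod c1
  end.

(* Register 0 is reserved for the base address of the arrays, and 16 is the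
   number of interleaved arrays. *)
Fixpoint wf_exp (a : aexp) : bool :=
  match a with
  | Num _ => true
  | Var r => r != 0
  | Get k a1 => (k < 16) && wf_exp a1
  | Plus a1 a2 | Minus a1 a2 | Times a1 a2 | Less a1 a2 | Same a1 a2 =>
      wf_exp a1 && wf_exp a2
  end.

Fixpoint wf_cmd (c : acmd) : bool :=
  match c with
  | Pass => true
  | Upd r a => (r != 0) && wf_exp a
  | Put k a b => [&& k < 16, wf_exp a & wf_exp b]
  | Then c1 c2 => wf_cmd c1 && wf_cmd c2
  | Cond a c1 c2 => [&& wf_exp a, wf_cmd c1 & wf_cmd c2]
  | For r l c1 =>
      [&& r != 0, l != 0, l != r, r \notin var_mod c1, l \notin var_mod c1
        & wf_cmd c1]
  end.

(** Interleaving gives every array unbounded room without knowing its size in advance. Array 0 keeps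
    the plain addresses, because input and output are prescribed to start at 0. *)
Definition address k (a : expr) : expr :=
  if k == 0 then a else Add (Reg 0) (Add (Mul a (Const 16)) (Const k)).

Fixpoint compile_exp (a : aexp) : expr :=
  match a with
  | Num k => Const k
  | Var r => Reg r
  | Get k a1 => Read (address k (compile_exp a1))
  | Plus a1 a2 => Add (compile_exp a1) (compile_exp a2)
  | Minus a1 a2 => Defs.Sub (compile_exp a1) (compile_exp a2)
  | Times a1 a2 => Mul (compile_exp a1) (compile_exp a2)
  | Less a1 a2 => Ltb (compile_exp a1) (compile_exp a2)
  | Same a1 a2 => Eqb (compile_exp a1) (compile_exp a2)
  end.

Fixpoint compile (c : acmd) : cmd :=
  match c with
  | Pass => Skip
  | Upd r a => Assign r (compile_exp a)
  | Put k a b => Write (address k (compile_exp a)) (compile_exp b)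
  | Then c1 c2 => Seq (compile c1) (compile c2)
  | Cond a c1 c2 => If (compile_exp a) (compile c1) (compile c2)
  | For r l c1 =>
      Seq (Assign r (Const 0))
        (While (Ltb (Reg r) (Reg l))
           (Seq (compile c1) (Assign r (Add (Reg r) (Const 1)))))
  end.

Definition acost (a : aexp) := cost (compile_exp a).

(** The compiled test costs 3 and the increment 4; one more unit is the loop itself. The last,
    failing test accounts for the final 4. *)
Fixpoint for_time (body : astate -> nat) (f : astate -> astate) N m : nat :=
  if N is N'.+1 then (3 + (body m + 4) + for_time body f N' (f m)).+1 else 4.

Fixpoint atime (c : acmd) (m : astate) : nat :=
  match c with
  | Pass => 1
  | Upd r a => (acost a).+1
  | Put k a b => (cost (address k (compile_exp a)) + acost b).+1
  | Then c1 c2 => atime c1 m + atime c2 (arun c1 m)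
  | Cond a c1 c2 =>
      (acost a + if aeval m a == 0 then atime c2 m else atime c1 m).+1
  | For r l c1 =>
      2 + for_time (atime c1) (next_iter (arun c1) r) (var m l) (set_var m r 0)
  end.

Fixpoint for_all (body : astate -> Prop) (f : astate -> astate) N m : Prop :=
  if N is N'.+1 then body m /\ for_all body f N' (f m) else True.

(* Every intermediate value is at most [B], differences do not underflow, and
   array 0, the input, is only accessed below [base]. *)
Section Safety.
Variables base B : nat.

Fixpoint safe_exp (m : astate) (a : aexp) : Prop :=
  match a with
  | Num k => k <= B
  | Var r => True
  | Get k a1 =>
      [/\ safe_exp m a1, aeval m a1 <= B & (k == 0) ==> (aeval m a1 < base)]
  | Plus a1 a2 =>
      [/\ safe_exp m a1, safe_exp m a2 & aeval m a1 + aeval m a2 <= B]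
  | Minus a1 a2 =>
      [/\ safe_exp m a1, safe_exp m a2, aeval m a1 <= B & aeval m a2 <= aeval m a1]
  | Times a1 a2 =>
      [/\ safe_exp m a1, safe_exp m a2 & aeval m a1 * aeval m a2 <= B]
  | Less a1 a2 | Same a1 a2 => safe_exp m a1 /\ safe_exp m a2
  end.

Fixpoint safe (c : acmd) (m : astate) : Prop :=
  match c with
  | Pass => True
  | Upd r a => safe_exp m a
  | Put k a b =>
      [/\ safe_exp m a, safe_exp m b, aeval m a <= B
        & (k == 0) ==> (aeval m a < base)]
  | Then c1 c2 => safe c1 m /\ safe c2 (arun c1 m)
  | Cond a c1 c2 =>
      safe_exp m a /\ if aeval m a == 0 then safe c2 m else safe c1 m
  | For r l c1 =>
      var m l <= B /\
      for_all (safe c1) (next_iter (arun c1) r) (var m l) (set_var m r 0)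
  end.

End Safety.

(** * Correctness of the compilation *)

Section Simulation.
Variables w base B : nat.
(** The highest address computed is that of cell [B] in array 15, so neither addresses nor values up
    to [B] wrap around. *)
Hypothesis B_lt : base + B * 16 + 16 < 2 ^ w.

Definition represents (m : astate) (st : state) : Prop :=
  [/\ regs st 0 = base,
      forall r, r != 0 -> regs st r = var m r,
      forall i, i < base -> memory st i = arr m 0 i
    & forall k i, 0 < k < 16 -> memory st (base + (i * 16 + k)) = arr m k i].

Lemma eval_address m st k a : represents m st -> k < 16 ->
  eval w st a <= B ->
  eval w st (address k a) =
    if k == 0 then eval w st a else base + (eval w st a * 16 + k).
Proof.
move=> [R0 _ _ _] k16 le_aB; rewrite /address; case: eqP => //= _.
have h16 : 16 %% 2 ^ w = 16 by rewrite modn_small //; lia.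
have hk : k %% 2 ^ w = k by rewrite modn_small //; lia.
by rewrite R0 h16 hk !modn_small //; lia.
Qed.

Lemma memory_address m st k a : represents m st -> k < 16 ->
  eval w st a <= B -> (k == 0) ==> (eval w st a < base) ->
  memory st (eval w st (address k a)) = arr m k (eval w st a).
Proof.
move=> R k16 le_aB lt_base; rewrite (eval_address R) //.
case: R lt_base => _ _ R3 R4; case: eqP => [->|/eqP k0] /= lt_base.
  exact: R3.
by apply: R4; rewrite lt0n k0.
Qed.

Lemma eval_compile m st a : represents m st ->
  wf_exp a -> safe_exp base B m a -> eval w st (compile_exp a) = aeval m a.
Proof.
move=> R; have [_ Rv _ _] := R; have lt1 : 1 < 2 ^ w by lia.
elim: a => [k|r|k a IH|a1 IH1 a2 IH2|a1 IH1 a2 IH2|a1 IH1 a2 IH2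
  |a1 IH1 a2 IH2|a1 IH1 a2 IH2] /=.
- by move=> _ le_kB; rewrite modn_small //; lia.
- by move=> r0 _; rewrite Rv.
- move=> /andP[k16 wfa] [sa le_aB lt_base].
  by rewrite (memory_address R) // IH.
- by move=> /andP[wf1 wf2] [s1 s2 le]; rewrite IH1 // IH2 // modn_small //; lia.
- move=> /andP[wf1 wf2] [s1 s2 leB le]; rewrite IH1 // IH2 //.
  have -> : aeval m a1 + (2 ^ w - aeval m a2) = aeval m a1 - aeval m a2 + 2 ^ w by lia.
  by rewrite modnDr modn_small //; lia.
- by move=> /andP[wf1 wf2] [s1 s2 le]; rewrite IH1 // IH2 // modn_small //; lia.
- move=> /andP[wf1 wf2] [s1 s2]; rewrite IH1 // IH2 // modn_small //.
  exact: leq_ltn_trans (leq_b1 _) lt1.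
- move=> /andP[wf1 wf2] [s1 s2]; rewrite IH1 // IH2 // modn_small //.
  exact: leq_ltn_trans (leq_b1 _) lt1.
Qed.

Lemma represents_set_var m st r v : represents m st -> r != 0 ->
  represents (set_var m r v) (State (update (regs st) r v) (memory st)).
Proof.
move=> [R0 Rv Ri Ra] r0; split=> //=.
  by rewrite /update eq_sym (negbTE r0).
by move=> q q0; rewrite /update; case: eqP => // _; rewrite Rv.
Qed.

Lemma represents_set_arr m st k i v : represents m st -> k < 16 ->
  (k == 0) ==> (i < base) ->
  represents (set_arr m k i v)
    (State (regs st)
       (update (memory st) (if k == 0 then i else base + (i * 16 + k)) v)).
Proof.
move=> [R0 Rv Ri Ra] k16 lt_base; split=> //=.
  move=> i' lt'; rewrite /update; case: (k =P 0) lt_base => [->|/eqP k0] /= lt_base.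
    by rewrite /=; case: (i' =P i) => // _; rewrite Ri.
  rewrite (negbTE (_ : 0 != k)); last by rewrite eq_sym.
  by rewrite ifF ?Ri //; apply/eqP; lia.
move=> k' i' /andP[k'0 k'16]; rewrite /update.
case: (k =P 0) lt_base => [->|/eqP k0] /= lt_base.
  rewrite (negbTE (_ : k' != 0)) -?lt0n // ifF ?Ra ?k'0 //.
  by apply/eqP; lia.
have [->|ne] := eqVneq k' k.
  have [->|ne] := eqVneq i' i; first by rewrite eqxx.
  by rewrite ifF ?Ra ?lt0n ?k0 //; apply/eqP; lia.
rewrite ifF ?Ra ?k'0 //; apply/eqP => E.
by apply/(negP ne)/eqP; lia.
Qed.

(** Induction on the number [N] of rounds still to come. As the body changes neither the counter nor
    the limit, the test on machine words succeeds exactly [N] times. *)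
Lemma for_compile r l c body m st N :
  r != 0 -> l != 0 -> l != r -> var m r + N = var m l -> var m l <= B ->
  (forall m1 st1, represents m1 st1 -> safe base B c m1 ->
     exists2 st', exec w body st1 (atime c m1) st'
                & represents (arun c m1) st') ->
  (forall m1, var (arun c m1) r = var m1 r) ->
  (forall m1, var (arun c m1) l = var m1 l) ->
  represents m st ->
  for_all (safe base B c) (next_iter (arun c) r) N m ->
  exists2 st',
    exec w (While (Ltb (Reg r) (Reg l))
              (Seq body (Assign r (Add (Reg r) (Const 1)))))
         st (for_time (atime c) (next_iter (arun c) r) N m) st'
  & represents (iter N (next_iter (arun c) r) m) st'.
Proof.
move=> r0 l0 lr + + Hb Fr Fl; have lt1 : 1 < 2 ^ w by lia.
elim: N m st => [|N IH] m st eN le_lB R /= S.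
  exists st => //; apply: ExecWhileFalse => /=.
  have [_ Rv _ _] := R; rewrite !Rv // -eN addn0 ltnn /=.
  by rewrite mod0n.
have [s1 s2] := S; have [st1 X1 R1] := Hb _ _ R s1.
pose st2 := State (update (regs st1) r (eval w st1 (Add (Reg r) (Const 1))))
  (memory st1).
have R2 : represents (next_iter (arun c) r m) st2.
  rewrite /next_iter /st2.
  suff -> : eval w st1 (Add (Reg r) (Const 1)) = (var (arun c m) r).+1.
    exact: represents_set_var.
  rewrite /=; have [_ Rv _ _] := R1; rewrite Rv // Fr.
  by rewrite [1 %% _]modn_small // modn_small ?addn1 //; lia.
have [st' X' R'] := IH (next_iter (arun c) r m) st2
  ltac:(by rewrite /= /update eqxx (negbTE lr) Fr Fl -eN; lia)
  ltac:(by rewrite /= /update (negbTE lr) Fl) R2 s2.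
exists st'; last by rewrite -iterSr in R'.
have -> : (3 + (atime c m + 4) +
    for_time (atime c) (next_iter (arun c) r) N (next_iter (arun c) r m)).+1 =
  (cost (Ltb (Reg r) (Reg l)) + (atime c m + (cost (Add (Reg r) (Const 1))).+1) +
   for_time (atime c) (next_iter (arun c) r) N (next_iter (arun c) r m)).+1 by [].
apply: ExecWhileTrue X'.
  have [_ Rv _ _] := R; rewrite /= !Rv // modn_small //; last exact: leq_ltn_trans (leq_b1 _) lt1.
  by have -> : var m r < var m l by lia.
by apply: ExecSeq X1 _; apply: ExecAssign.
Qed.

Lemma var_mod_arun c m r : r \notin var_mod c -> var (arun c m) r = var m r.
Proof.
elim: c m => [|q a|k a b|c1 IH1 c2 IH2|a c1 IH1 c2 IH2|q l c IH] m //=.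
- by rewrite inE /update => /negbTE ->.
- by rewrite mem_cat negb_or => /andP[n1 n2]; rewrite IH2 // IH1.
- rewrite mem_cat negb_or => /andP[n1 n2].
  by case: ifP => _; [rewrite IH2 | rewrite IH1].
- rewrite inE negb_or => /andP[/negbTE rq n2].
  have e0 : var (set_var m q 0) r = var m r by rewrite /= /update rq.
  by elim: (var m l) => //= N IHN; rewrite /update rq IH.
Qed.

Lemma arr_mod_arun c m k : k \notin arr_mod c -> arr (arun c m) k = arr m k.
Proof.
elim: c m => [|q a|k' a b|c1 IH1 c2 IH2|a c1 IH1 c2 IH2|q l c IH] m //=.
- by rewrite inE => /negbTE ->.
- by rewrite mem_cat negb_or => /andP[n1 n2]; rewrite IH2 // IH1.
- rewrite mem_cat negb_or => /andP[n1 n2].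
  by case: ifP => _; [rewrite IH2 | rewrite IH1].
- move=> n1; elim: (var m l) => //= N IHN; by rewrite IH.
Qed.

Theorem compile_correct c m st : wf_cmd c -> represents m st ->
  safe base B c m ->
  exists2 st', exec w (compile c) st (atime c m) st' & represents (arun c m) st'.
Proof.
have lt1 : 1 < 2 ^ w by lia.
elim: c m st => [|q a|k' a b|c1 IH1 c2 IH2|a c1 IH1 c2 IH2|q l c IH] m st /=.
- by exists st => //; apply: ExecSkip.
- move=> /andP[q0 wa] R s; eexists; first exact: ExecAssign.
  by rewrite (eval_compile R) //; apply: represents_set_var.
- move=> /and3P[k16 wa wb] R [sa sb leB lt_base]; eexists.
    exact: ExecWrite.
  rewrite (eval_address R) // (eval_compile R) // (eval_compile R) //.
  exact: represents_set_arr.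
- move=> /andP[w1 w2] R [s1 s2].
  have [st1 X1 R1] := IH1 _ _ w1 R s1; have [st2 X2 R2] := IH2 _ _ w2 R1 s2.
  by exists st2 => //; apply: ExecSeq X1 X2.
- move=> /and3P[wa w1 w2] R [sa].
  case: eqP => e0 s.
    have [st2 X2 R2] := IH2 _ _ w2 R s; exists st2 => //.
    by apply: ExecIfFalse X2; rewrite (eval_compile R).
  have [st2 X2 R2] := IH1 _ _ w1 R s; exists st2 => //.
  by apply: ExecIfTrue X2; rewrite (eval_compile R).
- move=> /and5P[q0 l0 lq nq /andP[nl wc]] R [leB s].
  pose st1 := State (update (regs st) q (eval w st (Const 0))) (memory st).
  have R1 : represents (set_var m q 0) st1.
    by rewrite /st1 /= mod0n; apply: represents_set_var.
  have el : var (set_var m q 0) l = var m l by rewrite /= /update (negbTE lq).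
  have [st2 X2 R2] := @for_compile q l c (compile c) (set_var m q 0) st1 (var m l)
    q0 l0 lq ltac:(by rewrite el /= /update eqxx) ltac:(by rewrite el)
    (fun m1 st1 => IH m1 st1 wc) (fun m1 => var_mod_arun m1 nq)
    (fun m1 => var_mod_arun m1 nl) R1 s.
  exists st2 => //; apply: ExecSeq X2.
  exact: (@ExecAssign w st q (Const 0)).
Qed.

End Simulation.

(** * Triples with running time *)

Definition frame (c : acmd) (m0 m : astate) : Prop :=
  (forall r, r \notin var_mod c -> var m r = var m0 r) /\
  (forall k, k \notin arr_mod c -> arr m k = arr m0 k).

Lemma frame_arun c m : frame c m (arun c m).
Proof. by split=> x ?; [apply: var_mod_arun | apply: arr_mod_arun]. Qed.

Section Triples.
Variables base B : nat.

(** Instead of a precondition there is a concrete start state [m], so that what is known about it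
    consists of ordinary hypotheses. *)
Definition triple c m (Q : astate -> Prop) T :=
  [/\ safe base B c m, Q (arun c m) & atime c m <= T].

Lemma triple_weaken c m (Q Q' : astate -> Prop) T T' :
  triple c m Q T -> (forall m', frame c m m' -> Q m' -> Q' m') -> T <= T' ->
  triple c m Q' T'.
Proof.
move=> [s q t] QQ' le; split=> //; last exact: leq_trans t le.
exact: QQ' (frame_arun _ _) q.
Qed.

Lemma triple_then c1 c2 m (Q1 Q : astate -> Prop) T1 T2 :
  triple c1 m Q1 T1 ->
  (forall m1, frame c1 m m1 -> Q1 m1 -> triple c2 m1 Q T2) ->
  triple (Then c1 c2) m Q (T1 + T2).
Proof.
move=> [s1 q1 t1] /(_ _ (frame_arun c1 m) q1) [s2 q2 t2]; split=> //=.
exact: leq_add.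
Qed.

(** Initialisation and the failing test cost 2 + 4, each round 3 + 4 + 1 on top of its body. The
    invariant is restored only after the increment of the counter, hence [Q i.+1] speaks of
    [set_var m2 r i.+1]. *)
Lemma triple_for r l c m (Q : nat -> astate -> Prop) N T :
  wf_cmd (For r l c) -> var m l = N -> N <= B -> Q 0 (set_var m r 0) ->
  (forall i m1, i < N -> frame (For r l c) m m1 -> var m1 r = i -> Q i m1 ->
     triple c m1 (fun m2 => Q i.+1 (set_var m2 r i.+1)) T) ->
  triple (For r l c) m (Q N) (6 + N * (T + 8)).
Proof.
move=> /= /and5P[r0 l0 lr nr /andP[nl wc]] eN leB Q0 body.
have fr0 : frame (For r l c) m (set_var m r 0).
  by split=> //= q; rewrite inE negb_or /update => /andP[/negbTE ->].
suff H K i m1 : i + K = N -> frame (For r l c) m m1 -> var m1 r = i -> Q i m1 ->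
    [/\ for_all (safe base B c) (next_iter (arun c) r) K m1,
        Q N (iter K (next_iter (arun c) r) m1)
      & for_time (atime c) (next_iter (arun c) r) K m1 <= 4 + K * (T + 8)].
  have [] := H N 0 (set_var m r 0) erefl fr0 _ Q0; first by rewrite /= /update eqxx.
  by move=> s q t; split=> /=; rewrite eN //; lia.
elim: K i m1 => [|K IH] i m1 eK fr1 e1 Q1 /=.
  by split=> //; rewrite -eK addn0.
have lt_iN : i < N by lia.
have [s q t] := body i m1 lt_iN fr1 e1 Q1.
have er : var (arun c m1) r = i by rewrite var_mod_arun.
have := IH i.+1 (next_iter (arun c) r m1).
rewrite {2 3}/next_iter er addSnnS eK => /(_ erefl); case.
- split=> /= [q'|k] nq.
    move: (nq); rewrite inE negb_or /update => /andP[/negbTE -> nq'].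
    rewrite var_mod_arun //; exact: fr1.1.
  by rewrite arr_mod_arun //; apply: fr1.2.
- by rewrite /= /update eqxx.
- exact: q.
- move=> s' q' t'; split=> //; first by rewrite -iterSr iterS in q' *.
  by lia.
Qed.

(** Weakest preconditions of loop-free code; the value [False] at loops makes the dummy 0 in
    [max_time] sound. *)
Fixpoint vc (c : acmd) (Q : astate -> Prop) (m : astate) : Prop :=
  match c with
  | Pass => Q m
  | Upd r a => safe_exp base B m a /\ Q (set_var m r (aeval m a))
  | Put k a b =>
      [/\ safe_exp base B m a, safe_exp base B m b, aeval m a <= B
        & (k == 0) ==> (aeval m a < base)] /\
      Q (set_arr m k (aeval m a) (aeval m b))
  | Then c1 c2 => vc c1 (vc c2 Q) m
  | Cond a c1 c2 =>
      [/\ safe_exp base B m a, aeval m a <> 0 -> vc c1 Q m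
        & aeval m a = 0 -> vc c2 Q m]
  | For _ _ _ => False
  end.

Fixpoint max_time (c : acmd) : nat :=
  match c with
  | Pass => 1
  | Upd r a => (acost a).+1
  | Put k a b => (cost (address k (compile_exp a)) + acost b).+1
  | Then c1 c2 => max_time c1 + max_time c2
  | Cond a c1 c2 => (acost a + maxn (max_time c1) (max_time c2)).+1
  | For _ _ _ => 0
  end.

Lemma vc_triple c (Q : astate -> Prop) m : vc c Q m -> triple c m Q (max_time c).
Proof.
elim: c Q m => [|q a|k' a b|c1 IH1 c2 IH2|a c1 IH1 c2 IH2|q l c IH] Q m //=.
- by move=> [s q0]; split.
- by move=> [s q']; split.
- move/IH1 => [s1 q1 t1]; have [s2 q2 t2] := IH2 _ _ q1.
  by split=> //=; apply: leq_add.
- move=> [s h1 h2]; rewrite /triple /=; case: eqP => e0.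
    have [s2 q2 t2] := IH2 _ _ (h2 e0); split=> //; lia.
  have [s2 q2 t2] := IH1 _ _ (h1 e0); split=> //; lia.
Qed.

Lemma triple_cond a c1 c2 m (Q : astate -> Prop) T1 T2 :
  safe_exp base B m a ->
  (aeval m a <> 0 -> triple c1 m Q T1) -> (aeval m a = 0 -> triple c2 m Q T2) ->
  triple (Cond a c1 c2) m Q (acost a + maxn T1 T2).+1.
Proof.
move=> s h1 h2; rewrite /triple /=; case: eqP => e0.
  have [s2 q2 t2] := h2 e0; split=> //; lia.
have [s2 q2 t2] := h1 e0; split=> //; lia.
Qed.

(** Assigns a chosen form [x] of the value, so that terms do not pile up along a chain of
    assignments. *)
Lemma vc_upd r a x c (Q : astate -> Prop) m : safe_exp base B m a ->
  aeval m a = x -> vc c Q (set_var m r x) -> vc (Then (Upd r a) c) Q m.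
Proof. by move=> s <-. Qed.

End Triples.

(** * Contraction order, runs and corners *)

Section InsertAfter.
Variable T : eqType.

Fixpoint insert_after (u v : T) (s : seq T) : seq T :=
  if s is x :: s' then
    if x == v then x :: u :: s' else x :: insert_after u v s'
  else [::].

Lemma mem_insert_after u v s x :
  v \in s -> (x \in insert_after u v s) = (x == u) || (x \in s).
Proof.
elim: s => //= y s IH; rewrite in_cons; have [->|ne] := eqVneq y v.
  by rewrite !inE; case: (x == v); case: (x == u).
rewrite /= => /IH; rewrite !inE => ->.
by case: (x == y); case: (x == u).
Qed.

Lemma size_insert_after u v s :
  v \in s -> size (insert_after u v s) = (size s).+1.
Proof.
elim: s => //= y s IH; rewrite in_cons; have [->|ne] := eqVneq y v => //.
by rewrite /= => /IH ->.
Qed.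

Lemma insert_after_uniq u v s :
  v \in s -> u \notin s -> uniq s -> uniq (insert_after u v s).
Proof.
elim: s => //= y s IH; rewrite in_cons [u \in _]in_cons negb_or.
have [->|ne] := eqVneq y v.
  by move=> _ /andP[uv us] /andP[vs s_uniq] /=; rewrite in_cons eq_sym negb_or uv vs us.
rewrite /= => vs /andP[uy us] /andP[ys s_uniq].
by rewrite mem_insert_after // negb_or eq_sym uy ys IH.
Qed.

(** Identifying [u] with [v] is monotone on indices: those up to [v] stay, all later ones drop by
    one, and [u], right behind [v], lands on [v]. *)
Lemma index_insert_after u v s y :
  v \in s -> u \notin s -> y \in insert_after u v s ->
  let k := index y (insert_after u v s) in
  index (if y == u then v else y) s = if k <= index v s then k else k.-1.
Proof.
elim: s => //= x s IH; rewrite in_cons [u \in _]in_cons negb_or.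
have [->|ne] := eqVneq x v.
  move=> _ /andP[uv us] _ /=; have [->|yu] := eqVneq y u.
    by rewrite !eqxx eq_sym (negbTE uv).
  by rewrite eq_sym; case: eqP => // _; rewrite eq_sym (negbTE yu) /=.
rewrite /= => vs /andP[ux us]; rewrite in_cons.
have [->|yx] := eqVneq y x.
  by move=> _; rewrite [x == u]eq_sym (negbTE ux) eqxx.
move=> /= /(IH vs us) /=; have [->|yu] := eqVneq y u => /= IH'.
  by rewrite (negbTE ne) ltnS; move: IH'; case: ifP; lia.
by rewrite eq_sym (negbTE yx) ltnS; move: IH'; case: ifP; lia.
Qed.

End InsertAfter.

Definition convex (P : pred nat) :=
  forall p q r, p <= q <= r -> P p -> P r -> P q.

(** A gap is named by the position before it. Positions run from 1 to [n], so 0 and [n] are the two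
    border gaps. *)
Definition gaps n (P : pred nat) := [seq a <- iota 0 n.+1 | P a != P a.+1].

(** A convex set is entered at most once and left at most once; of three changes, two would be of
    the same kind. *)
Lemma size_gaps n P : convex P -> size (gaps n P) <= 2.
Proof.
move=> cP; have down a b : a < b -> P a -> P a.+1 = false -> P b = false.
  by move=> ab Pa; apply: contraFF => Pb; apply: cP Pa Pb; lia.
have : sorted ltn (gaps n P) by rewrite sorted_filter ?iota_ltn_sorted //; apply: ltn_trans.
have : all (fun a => P a != P a.+1) (gaps n P) by apply: filter_all.
case: (gaps n P) => [|a [|b [|c s]]] //= /and4P[Pa Pb Pc _] /and3P[ab bc _].
case Ea: (P a) Pa => Pa.
  have Pa1 : P a.+1 = false by case: (P a.+1) Pa.
  move: Pb; rewrite (down a b) // (down a b.+1) //; lia.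
have Pa1 : P a.+1 by case: (P a.+1) Pa.
case Eb: (P b) Pb => Pb.
  have Pb1 : P b.+1 = false by case: (P b.+1) Pb.
  move: Pc; rewrite (down b c) // (down b c.+1) //; lia.
have Pb1 : P b.+1 by case: (P b.+1) Pb.
by move: Eb; rewrite (cP a.+1 b b.+1) //; lia.
Qed.

Lemma discrete_ivt (P : pred nat) a b :
  a <= b -> P a != P b -> exists2 k, a <= k < b & P k != P k.+1.
Proof.
move=> /subnK <-; elim: (b - a) => [|d IH]; first by rewrite eqxx.
have [/eqP e|ne] := boolP (P a == P (d + a)).
  by move=> ne; exists (d + a); [lia | rewrite -e -addSn].
by move=> _; have [k ? ?] := IH ne; exists k => //; lia.
Qed.

(** The sequence over plain numbers. The vertex that survives all contractions is the separate datum
    [root], which makes sense also for an empty sequence. *)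
Record contraction_seq (n root : nat) (u v : nat -> nat) : Prop := ContractionSeq {
  contraction_root : root < n;
  contraction_u : forall i, i < n.-1 -> u i < n;
  contraction_v : forall i, i < n.-1 -> v i < n;
  contraction_uv : forall i, i < n.-1 -> u i <> v i;
  contraction_u_root : forall i, i < n.-1 -> u i <> root;
  contraction_u_neq : forall i j, i < j -> j < n.-1 -> u i <> u j;
  contraction_u_v : forall i j, i < j -> j < n.-1 -> u i <> v j;
  contraction_cover :
    forall x, x < n -> x = root \/ exists2 i, i < n.-1 & x = u i }.

Section Contraction.
Variables (n root : nat) (u v : nat -> nat).
Hypothesis CS : contraction_seq n root u v.

Let root_lt := contraction_root CS.
Let u_lt := contraction_u CS.
Let v_lt := contraction_v CS.
Let uv_neq := contraction_uv CS.
Let u_root := contraction_u_root CS.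
Let u_neq := contraction_u_neq CS.
Let u_v_neq := contraction_u_v CS.
Let u_cover := contraction_cover CS.

Lemma contraction_gt0 : 0 < n. Proof. exact: leq_ltn_trans (leq0n _) root_lt. Qed.

Let n_gt0 := contraction_gt0.

Fixpoint rev_order k : seq nat :=
  if k is k'.+1 then
    insert_after (u (n.-1 - k)) (v (n.-1 - k)) (rev_order k')
  else [:: root].

(* The vertices left after [j] contractions. *)
Definition order j := rev_order (n.-1 - j).

Lemma orderS j : j < n.-1 -> order j = insert_after (u j) (v j) (order j.+1).
Proof.
move=> jm; rewrite /order; have -> : n.-1 - j = (n.-1 - j.+1).+1 by lia.
have e : n.-1 - (n.-1 - j.+1).+1 = j by lia.
by rewrite /= e.
Qed.

Lemma order_last : order n.-1 = [:: root].
Proof. by rewrite /order subnn. Qed.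

Lemma order_ind (P : nat -> Prop) :
  P n.-1 -> (forall j, j < n.-1 -> P j.+1 -> P j) -> forall j, j <= n.-1 -> P j.
Proof.
move=> P0 PS j /subKn <-; elim: (n.-1 - j) (leq_subr j n.-1) => [|k IH] lek.
  by rewrite subn0.
apply: PS; first by lia.
have -> : (n.-1 - k.+1).+1 = n.-1 - k by lia.
by apply: IH; lia.
Qed.

Lemma order_spec j : j <= n.-1 ->
  [/\ forall x, (x \in order j) <-> x = root \/ exists2 i, j <= i < n.-1 & x = u i,
      uniq (order j) & size (order j) = n - j].
Proof.
move: j; apply: order_ind => [|j jm [memS uniqS sizeS]].
  rewrite order_last; split=> // [x|]; last by rewrite /=; lia.
  by rewrite inE; split=> [/eqP|[->|[i ? _]]]; [left | | lia].
(* [v j] is the root or some [u i]; [i < j] contradicts degeneracy and [i = j] contradicts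
   [u j <> v j]. *)
have vin : v j \in order j.+1.
  apply/memS; have [->|[i im e]] := u_cover (v_lt jm); first by left.
  right; exists i => //; suff : j <> i /\ ~ i < j by lia.
  split; first by move=> e'; move: e; rewrite -e' => /esym; apply: uv_neq.
  by move=> lt; move/esym: e; apply: u_v_neq.
have unin : u j \notin order j.+1.
  apply/negP => /memS [/(u_root jm)|[i /andP[ji im]]] //.
  exact: u_neq.
rewrite (orderS jm); split; last by rewrite size_insert_after // sizeS; lia.
  move=> x; rewrite mem_insert_after //; split.
    case/orP => [/eqP ->|/memS [->|[i im ->]]]; last by right; exists i => //; lia.
      by right; exists j => //; lia.
    by left.
  case=> [->|[i im ->]]; first by apply/orP; right; apply/memS; left.
  have [->|ne] := eqVneq i j; first by rewrite eqxx.
  by apply/orP; right; apply/memS; right; exists i => //; lia.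
by apply: insert_after_uniq.
Qed.

Lemma u_notin j : j < n.-1 -> u j \notin order j.+1.
Proof.
move=> jm; have [mem _ _] := order_spec jm.
apply/negP => /mem [/(u_root jm)|[i /andP[ji im]]] //; exact: u_neq.
Qed.

Lemma v_in j : j < n.-1 -> v j \in order j.+1.
Proof.
move=> jm; have [mem _ _] := order_spec jm.
apply/mem; have [->|[i im e]] := u_cover (v_lt jm); first by left.
right; exists i => //; suff : j <> i /\ ~ i < j by lia.
split; first by move=> e'; move: e; rewrite -e' => /esym; apply: uv_neq.
by move=> lt; move/esym: e; apply: u_v_neq.
Qed.

Definition contract j x := if x == u j then v j else x.

Fixpoint rep j x := if j is j'.+1 then contract j' (rep j' x) else x.

Lemma rep_in j x : j <= n.-1 -> x \in order 0 -> rep j x \in order j.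
Proof.
elim: j => //= j IH jm x0; have := IH (ltnW jm) x0.
rewrite (orderS jm) mem_insert_after ?v_in // /contract.
by case: eqP => [_ _|_ /= ->//]; apply: v_in.
Qed.

(** Because of [.-1], position 0 aliases position 1, and positions beyond [n] give the default 0;
    [pos_ok] excludes both. *)
Definition vert p := nth 0 (order 0) p.-1.

Definition pos_ok p := 0 < p <= n.

Lemma order0_uniq : uniq (order 0).
Proof. by case: (order_spec (leq0n _)). Qed.

Lemma size_order0 : size (order 0) = n.
Proof. by case: (order_spec (leq0n _)) => _ _ ->; rewrite subn0. Qed.

Lemma mem_order0 x : (x \in order 0) = (x < n).
Proof.
have [mem _ _] := order_spec (leq0n n.-1); apply/idP/idP => [/mem [->//|[i /andP[_ im] ->]]|xn].
  exact: u_lt.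
by apply/mem; have [->|[i im ->]] := u_cover xn; [left | right; exists i].
Qed.

Lemma vert_in p : pos_ok p -> vert p \in order 0.
Proof. by move=> /andP[p0 pn]; rewrite /vert mem_nth // size_order0; lia. Qed.

Lemma vert_lt p : pos_ok p -> vert p < n.
Proof. by move=> pok; rewrite -mem_order0 vert_in. Qed.

(** By [index_insert_after] every contraction weakly preserves the order of positions. This is what
    makes the blocks intervals. *)
Lemma rep_index_mono j p q : j <= n.-1 -> 0 < p -> p <= q -> q <= n ->
  index (rep j (vert p)) (order j) <= index (rep j (vert q)) (order j).
Proof.
move=> jm p0 pq qn; have pok : pos_ok p by rewrite /pos_ok; lia.
have qok : pos_ok q by rewrite /pos_ok; lia.
elim: j jm => [|j IH] jm /=.
  by rewrite /vert !index_uniq ?order0_uniq ?size_order0 //; lia.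
have := IH (ltnW jm).
have := rep_in (ltnW jm) (vert_in pok); have := rep_in (ltnW jm) (vert_in qok).
rewrite (orderS jm) => hp hq; rewrite /contract.
have := index_insert_after (v_in jm) (u_notin jm) hp.
have := index_insert_after (v_in jm) (u_notin jm) hq.
by move=> /= -> ->; do 2 case: ifP => //; lia.
Qed.

Definition block j x p := pos_ok p && (rep j (vert p) == x).

Lemma block_convex j x : j <= n.-1 -> convex (block j x).
Proof.
move=> jm p q r pqr /andP[pok /eqP ep] /andP[rok /eqP er].
have qok : pos_ok q by move: pok rok; rewrite /pos_ok; lia.
rewrite /block qok /=; have hq := rep_in jm (vert_in qok).
have hp := rep_in jm (vert_in pok).
rewrite -ep; apply/eqP.
suff e : index (rep j (vert q)) (order j) = index (rep j (vert p)) (order j).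
  by rewrite -[LHS](nth_index 0 hq) e nth_index.
move: pok rok; rewrite /pos_ok => pok rok.
have := @rep_index_mono j p q jm ltac:(lia) ltac:(lia) ltac:(lia).
have := @rep_index_mono j q r jm ltac:(lia) ltac:(lia) ltac:(lia).
by rewrite ep er; lia.
Qed.

Lemma rep_last p : pos_ok p -> rep n.-1 (vert p) = root.
Proof.
by move/vert_in/(rep_in (leqnn _)); rewrite order_last inE => /eqP.
Qed.

Lemma rep_eq_le i j x y : i <= j -> rep i x = rep i y -> rep j x = rep j y.
Proof. by move/subnK <-; elim: (j - i) => //= k IH /IH ->. Qed.

(** * Corners of the rectangles changed by contractions *)

Variable g : rel nat.
Hypothesis g_sym : symmetric g.
Hypothesis g_irr : irreflexive g.

Definition adj a c := [&& pos_ok a, pos_ok c & g (vert a) (vert c)].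

Definition adj_at j a c := g (rep j (vert a)) (rep j (vert c)).

Definition sd_list j :=
  [seq y <- order j | [&& y != u j, y != v j & g (u j) y != g (v j) y]].

(** [v j] joins [sd_list j] because the adjacency of [u j] and [v j] is replaced by that of [v j]
    with itself, which is absent. Both orders of each pair occur since the matrix is symmetric. *)
Definition corners_at j :=
  flatten [seq
     [seq (a, c) | a <- gaps n (block j (u j)), c <- gaps n (block j y)] ++
     [seq (a, c) | a <- gaps n (block j y), c <- gaps n (block j (u j))]
     | y <- v j :: sd_list j].

Definition corners := flatten [seq corners_at j | j <- iota 0 n.-1].

Lemma size_corners d : (forall j, j < n.-1 -> size (sd_list j) <= d) ->
  size corners <= 8 * d.+1 * n.-1.
Proof.
move=> led.
have bound (T : Type) (ss : seq (seq T)) K :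
    (forall s, List.In s ss -> size s <= K) -> size (flatten ss) <= K * size ss.
  elim: ss => //= s ss IH h; rewrite size_cat mulnS leq_add ?h //; first by left.
  by apply: IH => s' hs'; apply: h; right.
have InP (T : Type) (f : nat -> T) (s : seq nat) y :
    List.In y (map f s) -> exists2 x, x \in s & y = f x.
  elim: s => //= x s IH [<-|/IH[z zs ->]]; first by exists x; rewrite ?mem_head.
  by exists z => //; rewrite in_cons zs orbT.
apply: leq_trans (bound _ _ (8 * d.+1) _) _; last by rewrite size_map size_iota.
move=> s0 s0in; have [j + ->] := InP _ _ _ _ s0in; rewrite mem_iota add0n => /andP[_ jm].
have jm' := ltnW jm.
apply: (@leq_trans (8 * size (v j :: sd_list j))); last by rewrite leq_mul2l /= ltnS led.
rewrite /corners_at -(size_map (fun y =>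
     [seq (a, c) | a <- gaps n (block j (u j)), c <- gaps n (block j y)] ++
     [seq (a, c) | a <- gaps n (block j y), c <- gaps n (block j (u j))])).
apply: bound => s1 s1in; have [y _ ->] := InP _ _ _ _ s1in; rewrite size_cat !size_allpairs.
have := size_gaps n (@block_convex j (u j) jm').
have := size_gaps n (@block_convex j y jm').
by move: (size _) (size _) => x y0; nia.
Qed.

(** [contract] moves only [u j], so one of the two is [u j]; not both, since then there is an edge
    neither before nor after. *)
Lemma flip_cases j x y : j < n.-1 -> x \in order j -> y \in order j ->
  g x y != g (contract j x) (contract j y) ->
  x = u j /\ y \in v j :: sd_list j \/ y = u j /\ x \in v j :: sd_list j.
Proof.
move=> jm; rewrite /contract; have [->|xu] := eqVneq x (u j).
  have [->|yu] := eqVneq y (u j); first by rewrite !g_irr.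
  move=> _ yo ne; left; split=> //; rewrite in_cons.
  by have [//|yv] := eqVneq y (v j); rewrite /= mem_filter yu yv ne yo.
have [->|yu] := eqVneq y (u j); last by rewrite eqxx.
rewrite ![g x _]g_sym => xo _ ne; right; split=> //; rewrite in_cons.
by have [//|xv] := eqVneq x (v j); rewrite /= mem_filter xu xv ne xo.
Qed.

Lemma corners_mem j a c x y : j < n.-1 ->
  x = u j /\ y \in v j :: sd_list j \/ y = u j /\ x \in v j :: sd_list j ->
  a \in gaps n (block j x) -> c \in gaps n (block j y) -> (a, c) \in corners.
Proof.
move=> jm h ha hc; apply/flattenP; exists (corners_at j).
  by apply: map_f; rewrite mem_iota.
case: h => -[ex hy]; apply/flattenP; eexists.
- by apply: map_f; exact: hy.
- by rewrite mem_cat -ex; apply/orP; left; apply: allpairs_f.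
- by apply: map_f; exact: hy.
- by rewrite mem_cat -ex; apply/orP; right; apply: allpairs_f.
Qed.

Lemma adj_row a c : adj a c -> [/\ pos_ok a, pos_ok c & g (vert a) (vert c)].
Proof. by move/and3P. Qed.

(* While the rows [a] and [a.+1] lie in different blocks, every rectangle that
   is flipped on one of them has a side along the gap between them.  If no
   corner lies on this gap near the run [l, r], such a rectangle contains all
   of [l.-1, r.+1] or none of it, so that either row [a] is constant there or
   the two rows agree there. *)
Lemma run_corner a l r : 0 < l <= r -> r <= n -> pos_ok a ->
  (forall c, l <= c <= r -> adj a c) -> ~~ adj a l.-1 -> ~~ adj a r.+1 ->
  (exists2 c, l.-1 <= c <= r.+1 & adj a c != adj a.+1 c) ->
  exists2 k, l.-1 <= k <= r & (a, k) \in corners.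
Proof.
move=> lr rn aok ones lend rend [c0 c0in c0ne].
have [/hasP[k kin kc]|/hasPn noc] :=
    boolP (has (fun k => (a, k) \in corners) (iota l.-1 (r - l).+2)).
  by exists k => //; move: kin; rewrite mem_iota; arith.
pose near c := (l.-1 <= c <= r.+1) && pos_ok c.
(* A row [a.+1] outside the matrix counts as apart forever. *)
pose apart j := ~~ (pos_ok a.+1 && (rep j (vert a) == rep j (vert a.+1))).
pose row x := (x == a) || ((x == a.+1) && pos_ok x).
have rowok x : row x -> pos_ok x by rewrite /row => /orP[/eqP->|/andP[]].
have apart_le i j : i <= j -> apart j -> apart i.
  move=> ij; rewrite /apart; apply: contra => /andP[-> /eqP e] /=.
  by rewrite (rep_eq_le ij e).
(* Otherwise a gap between two columns of the window bounds the block of [c]; with the gap [a]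
   between the rows it is a corner of the flipped rectangle, against [noc]. *)
have one_block j x c : j < n.-1 -> apart j -> row x -> near c ->
    adj_at j x c != adj_at j.+1 x c ->
    forall c', near c' -> rep j (vert c') = rep j (vert c).
  move=> jm ap rx /andP[cin cok] flip c' /andP[c'in c'ok].
  have fl := flip_cases jm (rep_in (ltnW jm) (vert_in (rowok _ rx)))
               (rep_in (ltnW jm) (vert_in cok)) flip.
  have agap : a \in gaps n (block j (rep j (vert x))).
    rewrite mem_filter mem_iota; apply/andP; split; last by move: aok; rewrite /pos_ok; arith.
    case/orP: rx => [/eqP->|/andP[/eqP-> a1ok]]; rewrite /block ?eqxx aok /=.
      by move: ap; rewrite /apart; case: (pos_ok a.+1) => //=; rewrite eq_sym => /negbTE->.
    by move: ap; rewrite /apart a1ok /= => /negbTE->.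
  apply/eqP; apply/negPn/negP => ne.
  have bne : block j (rep j (vert c)) c != block j (rep j (vert c)) c'.
    by rewrite /block cok c'ok eqxx /= (negbTE ne).
  suff [k kin kgap] : exists2 k, l.-1 <= k <= r & k \in gaps n (block j (rep j (vert c))).
    have kin' : k \in iota l.-1 (r - l).+2 by rewrite mem_iota; arith.
    by have := noc k kin'; rewrite (corners_mem jm fl agap kgap).
  have [le|/ltnW le] := leqP c c'.
    have [k kin kne] := discrete_ivt le bne; exists k; first by arith.
    by rewrite mem_filter kne mem_iota; move: c'ok; rewrite /pos_ok; arith.
  rewrite eq_sym in bne; have [k kin kne] := discrete_ivt le bne; exists k; first by arith.
  by rewrite mem_filter kne mem_iota; move: cok; rewrite /pos_ok; arith.
have adj0 x c : row x -> near c -> adj x c = adj_at 0 x c.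
  by move=> /rowok xok /andP[_ cok]; rewrite /adj xok cok.
(* A constant row [a] would consist of ones on the window, which then must reach both borders; so
   the whole row is ones, including the missing loop at [a]. *)
have not_const : ~ (forall c c', near c -> near c' -> adj_at 0 a c = adj_at 0 a c').
  move=> cst; have ra : row a by rewrite /row eqxx.
  have nl : near l by rewrite /near /pos_ok; arith.
  have al : adj a l by apply: ones; arith.
  have all1 c : near c -> adj a c by move=> nc; rewrite adj0 // (cst c l nc nl) -adj0.
  have l1 : l = 1.
    have [//|nl1] := eqVneq l 1.
    by case/negP: lend; apply: all1; rewrite /near /pos_ok; arith.
  have rn' : r = n.
    have [//|nr] := eqVneq r n.
    by case/negP: rend; apply: all1; rewrite /near /pos_ok; arith.
  have /adj_row[_ _] : adj a a.
    by apply: ones; move: aok; rewrite /pos_ok; arith.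
  by rewrite g_irr.
exfalso.
(* At a flip the whole window lies in one block, so row [a] is constant there at time [j]. This
   persists back in time: a step either leaves the entries of row [a] alone or again finds the whole
   window in one block. So row [a] would be constant at time 0. *)
have no_flip j x c : j < n.-1 -> apart j -> row x -> near c ->
    adj_at j x c = adj_at j.+1 x c.
  move=> jm ap rx nc; apply/eqP; apply/negPn/negP => flip; apply: not_const.
  have ob := one_block j x c jm ap rx nc flip.
  have cj c1 c2 : near c1 -> near c2 -> adj_at j a c1 = adj_at j a c2.
    by move=> n1 n2; rewrite /adj_at (ob _ n1) (ob _ n2).
  have : forall i, i <= j -> forall c1 c2, near c1 -> near c2 ->
      adj_at (j - i) a c1 = adj_at (j - i) a c2.
    elim=> [|i IH] ij c1 c2 n1 n2; first by rewrite subn0; apply: cj.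
    have := IH (ltnW ij) c1 c2 n1 n2.
    have -> : j - i = (j - i.+1).+1 by arith.
    move: (j - i.+1) (leq_subr i.+1 j) => k kj IHk.
    have km : k < n.-1 by apply: leq_ltn_trans jm.
    have ra : row a by rewrite /row eqxx.
    have apk := apart_le _ _ kj ap.
    have [e1|f1] := eqVneq (adj_at k a c1) (adj_at k.+1 a c1); last first.
      by rewrite /adj_at (one_block k a c1 km apk ra n1 f1 c2 n2).
    have [e2|f2] := eqVneq (adj_at k a c2) (adj_at k.+1 a c2); last first.
      by rewrite /adj_at (one_block k a c2 km apk ra n2 f2 c1 n1).
    by rewrite e1 e2.
  by move=> /(_ j (leqnn _)); rewrite subnn.
have stays J x c : J <= n.-1 -> (forall j, j < J -> apart j) -> row x -> near c ->
    adj_at 0 x c = adj_at J x c.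
  elim: J => // J IH Jm apJ rx nc; rewrite IH //; last by move=> j jJ; apply: apJ; arith.
    by apply: no_flip => //; apply: apJ.
  exact: ltnW.
have ra : row a by rewrite /row eqxx.
(* Without a next row, no flip occurs up to the end, where only one vertex without a loop is left,
   although row [a] has a one at [l]. *)
have [a1ok|a1bad] := boolP (pos_ok a.+1); last first.
  have nl : near l by rewrite /near /pos_ok; arith.
  have : adj a l by apply: ones; arith.
  rewrite adj0 // (stays n.-1) //; last by move=> j _; rewrite /apart (negbTE a1bad).
  by rewrite /adj_at !rep_last ?g_irr //; case/andP: nl.
have exJ : exists J, ~~ apart J.
  by exists n.-1; rewrite /apart negbK a1ok !rep_last ?eqxx.
(* [J] is the time at which the rows merge: nothing has flipped before and they agree at that
   moment, so they agree at [c0] from the start. *)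
case: (ex_minnP exJ) => J; rewrite /apart negbK => /andP[_ /eqP eJ] minJ.
have Jm : J <= n.-1 by apply: minJ; rewrite /apart negbK a1ok !rep_last ?eqxx.
have apJ j : j < J -> apart j.
  by move=> jJ; have [//|/minJ] := boolP (apart j); arith.
have ra1 : row a.+1 by rewrite /row eqxx a1ok orbT.
case/negP: c0ne; apply/eqP.
have [c0ok|c0bad] := boolP (pos_ok c0); last by rewrite /adj (negbTE c0bad) !andbF.
have nc0 : near c0 by rewrite /near c0in.
by rewrite !adj0 // !(stays J) // /adj_at eJ.
Qed.

(** * Maximal runs of ones *)

Definition run_end a c :=
  if adj a c then c + find (fun x => ~~ adj a x) (iota c.+1 n) else 0.

Lemma adj_pos a c : adj a c -> 0 < c <= n.
Proof. by case/adj_row. Qed.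

Lemma run_endP a c : adj a c ->
  [/\ c <= run_end a c <= n, forall x, c <= x <= run_end a c -> adj a x
    & ~~ adj a (run_end a c).+1].
Proof.
move=> ac; have cn := adj_pos ac; rewrite /run_end ac.
set P := fun x => _; set k := find _ _.
have hasP : has P (iota c.+1 n).
  apply/hasP; exists (c + n); first by rewrite mem_iota; arith.
  by apply/negP => /adj_pos; arith.
have kn : k < n by rewrite -[n in _ < n](size_iota c.+1) -has_find.
have endk : ~~ adj a (c + k).+1 by have := nth_find 0 hasP; rewrite nth_iota.
have ones x : c <= x <= c + k -> adj a x.
  move=> xin; have [->//|ne] := eqVneq x c.
  have lt : x - c.+1 < k by arith.
  have := before_find 0 lt; rewrite nth_iota; last by arith.
  have -> : c.+1 + (x - c.+1) = x by arith.
  by move/negbFE.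
split=> //; have /adj_pos := ones (c + k) ltac:(arith); arith.
Qed.

Lemma run_end_uniq a c r : c <= r -> (forall x, c <= x <= r -> adj a x) ->
  ~~ adj a r.+1 -> run_end a c = r.
Proof.
move=> cr ones rend; have ac : adj a c by apply: ones; arith.
have [h1 h2 h3] := run_endP ac.
have [lt|lt|//] := ltngtP (run_end a c) r.
  by case/negP: h3; apply: ones; arith.
by case/negP: rend; apply: h2; arith.
Qed.

Lemma run_end_eq0 a c : (run_end a c == 0) = ~~ adj a c.
Proof.
have [ac|nac] := boolP (adj a c); last by rewrite /run_end (negbTE nac).
by have [h _ _] := run_endP ac; have := adj_pos ac; arith.
Qed.

(** The recurrence by which the program fills its table from right to left; 0 is free to mean that
    there is no run, as columns count from 1. *)
Lemma run_end_rec a c :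
  run_end a c = if adj a c then if run_end a c.+1 == 0 then c else run_end a c.+1
                else 0.
Proof.
case: ifP => [ac|/negbT nac]; last by apply/eqP; rewrite run_end_eq0.
rewrite run_end_eq0; case: ifP => [nac1|/negbFE ac1].
  by apply: run_end_uniq => // x xc; have -> : x = c by arith.
have [h1 h2 h3] := run_endP ac1; apply: run_end_uniq => //; first by arith.
by move=> x xin; have [->//|ne] := eqVneq x c; apply: h2; arith.
Qed.

Lemma run_end_le a c : run_end a c <= n.
Proof.
have [ac|nac] := boolP (adj a c); last by rewrite /run_end (negbTE nac).
by have [] := run_endP ac; arith.
Qed.

(* The last column of the maximal run of row [a] that starts at column [c], and
   0 if there is none. *)
Definition run a c := run_end a c * (run_end a c.-1 == 0).

Lemma runP a c r : 0 < r -> run a c = r <->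
  [/\ c <= r <= n, forall x, c <= x <= r -> adj a x, ~~ adj a c.-1 & ~~ adj a r.+1].
Proof.
move=> r0; rewrite /run run_end_eq0; split=> [|[cr ones e1 e2]]; last first.
  by rewrite e1 muln1; apply: run_end_uniq => //; arith.
case: (boolP (adj a c.-1)) => [_|e1]; rewrite ?muln0 ?muln1 => er; first by arith.
have ac : adj a c by apply/negPn; rewrite -run_end_eq0; arith.
by have [h1 h2 h3] := run_endP ac; rewrite -er.
Qed.

(** At row [a] a rectangle of equal consecutive runs closes: the next row has no run with the same
    first and last column. *)
Definition emits a c := (run a c != 0) && (run a.+1 c != run a c).

(** If rows [a] and [a.+1] agreed from the column before the run to the column behind it, the next
    row would have the same maximal run and nothing would be emitted. *)
Lemma emits_corner a c : emits a c ->
  exists2 k, c.-1 <= k <= run a c & (a, k) \in corners.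
Proof.
case/andP=> r0 ne; set r := run a c in r0 ne *.
have rgt : 0 < r by arith.
have [h1 h2 h3 h4] := (@runP a c r rgt).1 erefl.
have /adj_row[aok /andP[c0 _] _] : adj a c by apply: h2; arith.
apply: run_corner => //; try arith.
have [/hasP[x xin xne]|/hasPn same] :=
    boolP (has (fun x => adj a x != adj a.+1 x) (iota c.-1 (r - c).+3)).
  by exists x => //; move: xin; rewrite mem_iota; arith.
have {}same x : c.-1 <= x <= r.+1 -> adj a.+1 x = adj a x.
  by move=> xin; apply/esym/eqP; rewrite -[_ == _]negbK same // mem_iota; arith.
case/eqP: ne; apply/runP; first by [].
split=> //; [move=> x xin | |]; rewrite same //; try arith.
exact: h2.
Qed.

Definition num_emits := \sum_(1 <= a < n.+1) \sum_(1 <= c < n.+1) emits a c.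

(** The map to corners is made explicit by a search for the least suitable column. It is injective:
    two runs of row [a] charged to the same column [k], with [c < c'], would give
    [c'.-1 <= k <= run a c], so that the zero before the second run lies inside the first. *)
Lemma num_emits_le : num_emits <= size corners.
Proof.
pose E := [seq p <- [seq (a, c) | a <- iota 1 n, c <- iota 1 n] | emits p.1 p.2].
have -> : num_emits = size E.
  rewrite /num_emits size_filter -sum1_count [RHS]big_mkcond [RHS]big_allpairs /=.
  rewrite /index_iota subn1 /=; apply: eq_bigr => a _; apply: eq_bigr => c _ /=.
  by case: (emits a c).
have [f fP] : exists f : nat * nat -> nat * nat, forall a c, emits a c ->
    exists k, [/\ f (a, c) = (a, k), c.-1 <= k <= run a c & (a, k) \in corners].
  exists (fun p => (p.1, p.2.-1 + find (fun k => (p.1, k) \in corners)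
                           (iota p.2.-1 (run p.1 p.2 - p.2.-1).+1))) => a c.
  move=> /emits_corner[k kin kc]; rewrite [(_, _).1]/= [(_, _).2]/=.
  set s := iota _ _; set P : pred nat := fun k => (a, k) \in corners.
  have hs : has P s by apply/hasP; exists k => //; rewrite mem_iota; arith.
  exists (c.-1 + find P s); split=> //.
    by have := hs; rewrite has_find size_iota; arith.
  have := nth_find 0 hs; rewrite nth_iota //.
  by move: hs; rewrite has_find size_iota.
have memE p : p \in E -> 0 < p.2 /\ emits p.1 p.2.
  rewrite mem_filter => /andP[+ /allpairsP[[a c] /= [_ + ep]]].
  by rewrite {p}ep mem_iota => /= em /andP[].
rewrite -(size_map f); apply: uniq_leq_size; last first.
  move=> _ /mapP[[a c] /memE[_ em] ->].
  by have [k [-> _ ?]] := fP a c em.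
rewrite map_inj_in_uniq; last first.
  move=> [a c] [a' c'] /memE[/= c0 em] /memE[/= c'0 em'].
  have [k [-> kin _]] := fP a c em; have [k' [-> k'in _]] := fP a' c' em'.
  case=> ea ek; rewrite -{}ea in em' k'in *; rewrite -{}ek {k'} in k'in.
  congr (_, _).
  case/andP: em => r0 _; case/andP: em' => r0' _.
  have rgt : 0 < run a c by arith.
  have rgt' : 0 < run a c' by arith.
  have [h1 h2 h3 h4] := (@runP a c _ rgt).1 erefl.
  have [h1' h2' h3' h4'] := (@runP a c' _ rgt').1 erefl.
  have [lt|lt|//] := ltngtP c c'.
    by case/negP: h3'; apply: h2; arith.
  by case/negP: h3; apply: h2'; arith.
by rewrite filter_uniq // allpairs_uniq ?iota_uniq // => -[? ?] [? ?].
Qed.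

Lemma num_emits_bound d : (forall j, j < n.-1 -> size (sd_list j) <= d) ->
  num_emits <= 8 * d.+1 * n.-1.
Proof. by move/size_corners; apply: leq_trans num_emits_le. Qed.

End Contraction.

(** * Breadth-first search on the auxiliary digraph *)

Section Reach.
Variables s0 s1 s2 : nat -> nat.

(** The digraph is given by three total successor functions; where it is searched, a missing
    successor is the node 0, which leads only to itself. *)
Inductive reach : nat -> nat -> Prop :=
| reach_refl x : reach x x
| reach_s0 x y : reach (s0 x) y -> reach x y
| reach_s1 x y : reach (s1 x) y -> reach x y
| reach_s2 x y : reach (s2 x) y -> reach x y.

Lemma reach_trans x y z : reach x y -> reach y z -> reach x z.
Proof.
by elim=> [//|||] {}x {}y _ IH /IH; [apply: reach_s0|apply: reach_s1|apply: reach_s2].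
Qed.

Lemma reach_closed (P : nat -> Prop) :
  (forall x, P x -> [/\ P (s0 x), P (s1 x) & P (s2 x)]) ->
  forall x y, reach x y -> P x -> P y.
Proof.
by move=> cl x y; elim=> [//|||] {}x {}y _ IH /cl[p0 p1 p2]; apply: IH.
Qed.

End Reach.

Record bfs_state := BfsState {
  label : nat -> nat; queue : seq nat; head : nat; stack : seq nat;
  marked : seq nat; current : nat }.

Section Bfs.
(** Nodes 1 to [n] are the single columns, at which vertices are discovered; node [H + a] is the
    single row [a], from which a vertex is explored; [NN] is the largest node. *)
Variables (n H NN s : nat) (s0 s1 s2 : nat -> nat) (adj : rel nat).
Hypothesis s_pos : 0 < s <= n.
Hypothesis n_le_H : n <= H.
Hypothesis H_le : H + n <= NN.
Hypothesis succ_le : forall x, x <= NN -> [/\ s0 x <= NN, s1 x <= NN & s2 x <= NN].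
Hypothesis succ0 : [/\ s0 0 = 0, s1 0 = 0 & s2 0 = 0].
Hypothesis reachP : forall a b, 0 < a <= n -> 0 < b <= n ->
  reach s0 s1 s2 (H + a) b <-> adj a b.
Hypothesis adj_pos : forall a b, adj a b -> 0 < b <= n.

Definition push x b :=
  if x \in 0 :: marked b then b else
  BfsState (label b) (queue b) (head b) (x :: stack b) (x :: marked b) (current b).

Definition discover h b :=
  if (h <= n) && (label b h == 0) then
    BfsState (update (label b) h (current b).+1) (rcons (queue b) h) (head b)
      (stack b) (marked b) (current b)
  else b.

Definition pop t b :=
  BfsState (label b) (queue b) (head b) t (marked b) (current b).

Definition dequeue b :=
  BfsState (label b) (queue b) (head b).+1 (stack b) (marked b)
    (label b (nth 0 (queue b) (head b))).

(** A step takes one node off the stack or, if the stack is empty, one vertex off the queue, hence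
    costs constant time. After the end it is idle, so that a loop of fixed length can iterate it. *)
Definition bfs_step b :=
  match stack b with
  | h :: t => push (s2 h) (push (s1 h) (push (s0 h) (discover h (pop t b))))
  | [::] =>
      if head b < size (queue b) then
        push (H + nth 0 (queue b) (head b)) (dequeue b)
      else b
  end.

Definition bfs_init :=
  BfsState (update (fun=> 0) s 1) [:: s] 0 [::] [::] 0.

(* Labels are distances plus one; 0 means undiscovered.  The vertices
   [nth 0 (queue b) k] with [k.+1 < head b] are completely explored, the stack
   holds the marked nodes whose successors are still to be marked. *)
Record bfs_inv (b : bfs_state) : Prop := BfsInv {
  queue_uniq : uniq (queue b);
  queue_pos : forall q, q \in queue b -> 0 < q <= n;
  queue_label : forall q, (q \in queue b) = (label b q != 0);
  queue_mono : forall i j, i <= j -> j < size (queue b) ->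
    label b (nth 0 (queue b) i) <= label b (nth 0 (queue b) j);
  label_le : forall q, label b q <= (current b).+1;
  label_ge : forall k, head b <= k < size (queue b) ->
    current b <= label b (nth 0 (queue b) k);
  head_le : head b <= size (queue b);
  current_eq : 0 < head b -> current b = label b (nth 0 (queue b) (head b).-1);
  label_path : forall q, q \in queue b ->
    exists p, [/\ path adj s p, last s p = q & label b q = (size p).+1];
  explored : forall k, k.+1 < head b -> forall c, adj (nth 0 (queue b) k) c ->
    c \in queue b /\ label b c <= (label b (nth 0 (queue b) k)).+1;
  head_marked : forall k, k < head b -> H + nth 0 (queue b) k \in marked b;
  marked_succ : forall x, x \in marked b -> x \notin stack b ->
    [/\ s0 x \in 0 :: marked b, s1 x \in 0 :: marked b & s2 x \in 0 :: marked b];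
  marked_label : forall x, x \in marked b -> x \notin stack b -> x <= n ->
    label b x != 0;
  stack_marked : {subset stack b <= marked b};
  marked_uniq : uniq (marked b);
  marked_pos : forall x, x \in marked b -> 0 < x <= NN;
  stack_head : stack b != [::] -> 0 < head b;
  stack_reach : forall x, x \in stack b ->
    reach s0 s1 s2 (H + nth 0 (queue b) (head b).-1) x;
  source_label : label b s = 1 }.

Lemma bfs_init_inv : bfs_inv bfs_init.
Proof.
split=> //=; rewrite ?inE //; try by move=> *; arith.
- by move=> q; rewrite inE => /eqP ->.
- by move=> q; rewrite inE /update; case: (q == s).
- by move=> [|i] [|j].
- by move=> q; rewrite /update; case: (q == s).
- move=> q; rewrite inE => /eqP ->; exists [::]; split=> //=.
  by rewrite /update eqxx.
- by rewrite /update eqxx.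
Qed.

Definition pushes xs b := foldl (fun b x => push x b) b xs.

Lemma pushes_spec xs b : exists l,
  [/\ pushes xs b = BfsState (label b) (queue b) (head b) (l ++ stack b)
                      (l ++ marked b) (current b),
      {subset l <= xs}, uniq (marked b) -> uniq (l ++ marked b), 0 \notin l
    & forall x, x \in xs -> x \in 0 :: l ++ marked b].
Proof.
elim: xs b => [|x xs IH] b /=; first by exists [::]; split=> //; case: b.
rewrite {1}/push; case: ifP => [xin|/negbT xnin].
  have [l [-> lxs ul l0 xsl]] := IH b; exists l; split=> // y.
    by move=> /lxs; rewrite in_cons orbC => ->.
  rewrite in_cons => /orP[/eqP->|/xsl//].
  by move: xin; rewrite !in_cons mem_cat => /orP[->//|->]; rewrite !orbT.
have [l [-> lxs ul l0 xsl]] := IH (BfsState (label b) (queue b) (head b)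
  (x :: stack b) (x :: marked b) (current b)).
move: xnin; rewrite in_cons negb_or => /andP[x0 xm].
exists (l ++ [:: x]); rewrite -!catA /=; split=> //.
- move=> y; rewrite mem_cat inE => /orP[/lxs|/eqP->]; last exact: mem_head.
  by rewrite in_cons orbC => ->.
- by move=> um; apply: ul; rewrite /= xm.
- by rewrite mem_cat inE negb_or l0 eq_sym.
- move=> y; rewrite in_cons => /orP[/eqP->|/xsl//].
  by rewrite in_cons mem_cat mem_head !orbT.
Qed.

Lemma nth_rcons_lt (q : seq nat) x k : k < size q -> nth 0 (rcons q x) k = nth 0 q k.
Proof. by move=> kq; rewrite nth_rcons kq. Qed.

(** With an empty stack the marked nodes are closed under successors. Hence all neighbours of the
    vertex dequeued before are marked and have a label, at most [(current b).+1] because no label is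
    larger. For this reason the marks of earlier vertices may be kept. *)
Lemma bfs_step_queue b : bfs_inv b -> stack b = [::] ->
  head b < size (queue b) -> bfs_inv (bfs_step b).
Proof.
move=> I stk0 hlt; rewrite /bfs_step stk0 hlt.
set a := nth 0 (queue b) (head b).
have aq : a \in queue b by rewrite mem_nth.
have apos := queue_pos I aq.
have [l [e lxs ul l0 xsl]] := pushes_spec [:: H + a] (dequeue b).
have -> : push (H + a) (dequeue b) = pushes [:: H + a] (dequeue b) by [].
rewrite {}e /dequeue /= stk0 cats0 -/a.
have cur_le : current b <= label b a by apply: (label_ge I); rewrite leqnn hlt.
have closed x y : reach s0 s1 s2 x y -> x \in 0 :: marked b -> y \in 0 :: marked b.
  apply: (@reach_closed s0 s1 s2 (fun x => x \in 0 :: marked b)) => {}x.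
  rewrite in_cons => /orP[/eqP->|xm]; first by case: succ0 => -> -> ->; rewrite mem_head.
  by apply: (marked_succ I) => //; rewrite stk0.
have l_small x : x \in l -> x = H + a by move/lxs; rewrite inE => /eqP.
split=> //=.
- exact: queue_uniq I.
- exact: queue_pos I.
- exact: queue_label I.
- exact: queue_mono I.
- by move=> q; apply: leq_trans (label_le I q) _.
- by move=> k /andP[k1 k2]; apply: (queue_mono I) => //; apply: ltnW.
- exact: label_path I.
- move=> k k1 c ac; have [lt|] := ltnP k.+1 (head b); first exact: (explored I).
  move=> ge; have ek : k = (head b).-1 by move: k1 ge; clear; arith.
  have h0 : 0 < head b by move: k1 ge; clear; arith.
  have kpos := queue_pos I (mem_nth 0 (leq_trans (_ : k < head b) (head_le I))).
  have {}kpos : 0 < nth 0 (queue b) k <= n by apply: kpos; rewrite ek prednK.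
  have cpos := adj_pos ac.
  have cm : c \in 0 :: marked b.
    apply: closed ((reachP kpos cpos).2 ac) _.
    by rewrite in_cons orbC (head_marked I) // ek prednK.
  have {}cm : c \in marked b.
    by move: cm; rewrite in_cons; case: eqP => // c0; move: cpos; rewrite c0.
  split; last by rewrite [label b (nth _ _ _)](_ : _ = current b) ?(label_le I) // ek -(current_eq I).
  rewrite (queue_label I); apply: (marked_label I) => //; first by rewrite stk0.
  by case/andP: cpos.
- move=> k; rewrite ltnS leq_eqVlt => /orP[/eqP->|kh].
    have := xsl _ (mem_head _ _); rewrite in_cons => /orP[|//].
    by rewrite addn_eq0 => /andP[_ /eqP a0]; move: apos; rewrite a0.
  by rewrite mem_cat (head_marked I) // orbT.
- move=> x; rewrite mem_cat => /orP[->//|xm] xl.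
  have [|h1 h2 h3] := marked_succ I xm; first by rewrite stk0.
  by move: h1 h2 h3; rewrite !in_cons !mem_cat => /orP[->|->] /orP[->|->] /orP[->|->];
    rewrite ?orbT.
- move=> x; rewrite mem_cat => /orP[->//|xm] xl xn.
  by apply: (marked_label I xm) => //; rewrite stk0.
- by move=> x xl; rewrite mem_cat xl.
- exact: ul (marked_uniq I).
- move=> x; rewrite mem_cat => /orP[/l_small->|/(marked_pos I)//].
  by move: apos H_le; clear; arith.
- by move=> x /l_small ->; apply: reach_refl.
- exact: source_label I.
Qed.

(** A newly discovered [h] is reachable from the row of the current vertex, hence adjacent to it,
    which extends the path by one edge; its label is the largest possible, so the labels stay sorted
    along the queue. *)
Lemma bfs_step_stack b h t : bfs_inv b -> stack b = h :: t ->
  bfs_inv (bfs_step b).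
Proof.
move=> I stkE; rewrite /bfs_step stkE.
have hm : h \in marked b by apply: (stack_marked I); rewrite stkE mem_head.
have hpos := marked_pos I hm.
have qh0 : 0 < head b by apply: (stack_head I); rewrite stkE.
have hlt : (head b).-1 < size (queue b) by rewrite prednK //; apply: head_le I.
set a := nth 0 (queue b) (head b).-1.
have aq : a \in queue b by rewrite mem_nth.
have apos := queue_pos I aq.
have ra x : x \in h :: t -> reach s0 s1 s2 (H + a) x.
  by move=> xin; apply: (stack_reach I); rewrite stkE.
have curE : current b = label b a by rewrite (current_eq I).
set b1 := discover h (pop t b).
have -> : push (s2 h) (push (s1 h) (push (s0 h) b1)) = pushes [:: s0 h; s1 h; s2 h] b1 by [].
have [l [e lxs ul l0 xsl]] := pushes_spec [:: s0 h; s1 h; s2 h] b1.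
have [b1h b1s b1m b1c] : [/\ head b1 = head b, stack b1 = t, marked b1 = marked b
    & current b1 = current b] by rewrite /b1 /discover; case: ifP.
move: e ul xsl; rewrite b1h b1s b1m b1c => -> ul xsl.
have rl x : x \in l -> reach s0 s1 s2 (H + a) x.
  move/lxs; rewrite !inE => /or3P[] /eqP ->; apply: reach_trans (ra h (mem_head _ _)) _.
  - exact: reach_s0 (reach_refl _ _ _ _).
  - exact: reach_s1 (reach_refl _ _ _ _).
  - exact: reach_s2 (reach_refl _ _ _ _).
have lpos x : x \in l -> 0 < x <= NN.
  move=> xl; have x0 : 0 < x by rewrite lt0n; apply: contraNneq l0 => <-.
  rewrite x0; have /andP[_ /succ_le[h0 h1 h2]] := hpos.
  by move/lxs: xl; rewrite !inE => /or3P[] /eqP ->.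
have hyp : [/\ uniq (queue b1), forall q, q \in queue b1 -> 0 < q <= n,
    forall q, (q \in queue b1) = (label b1 q != 0),
    forall i j, i <= j -> j < size (queue b1) ->
      label b1 (nth 0 (queue b1) i) <= label b1 (nth 0 (queue b1) j)
  & forall q, label b1 q <= (current b).+1] /\
  [/\ forall k, k < size (queue b) -> nth 0 (queue b1) k = nth 0 (queue b) k,
    forall q, q \in queue b -> q \in queue b1 /\ label b1 q = label b q,
    forall q, q \in queue b1 ->
      exists p, [/\ path adj s p, last s p = q & label b1 q = (size p).+1],
    h <= n -> label b1 h != 0
  & size (queue b) <= size (queue b1) /\
    forall k, size (queue b) <= k < size (queue b1) ->
      label b1 (nth 0 (queue b1) k) = (current b).+1].
  rewrite /b1 /discover /=; case: ifP => [/andP[hn /eqP lh0]|cond]; last first.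
    split; first by split; [exact: queue_uniq I | exact: queue_pos I
      | exact: queue_label I | exact: queue_mono I | exact: label_le I].
    split=> //=; first exact: label_path I.
      by move=> hn; move: cond; rewrite hn /= => ->.
    by split=> // k; clear; arith.
  have hq : h \notin queue b by rewrite (queue_label I) lh0.
  have old q : q \in queue b -> update (label b) h (current b).+1 q = label b q.
    by move=> qq; rewrite /update; case: eqP => // eq; move: hq; rewrite -eq qq.
  have old_nth k : k < size (queue b) ->
      update (label b) h (current b).+1 (nth 0 (queue b) k) = label b (nth 0 (queue b) k).
    by move=> kq; apply: old; rewrite mem_nth.
  have new_h : update (label b) h (current b).+1 h = (current b).+1 by rewrite /update eqxx.
  split=> /=; split.
  - by rewrite rcons_uniq hq (queue_uniq I).
  - move=> q; rewrite mem_rcons in_cons => /orP[/eqP->|/(queue_pos I)//].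
    by rewrite hn; case/andP: hpos => ->.
  - move=> q; rewrite mem_rcons in_cons /update; case: eqP => //= _.
    by rewrite (queue_label I).
  - move=> i j ij; rewrite size_rcons ltnS leq_eqVlt => /orP[/eqP ej|jq].
      have -> : nth 0 (rcons (queue b) h) j = h by rewrite nth_rcons ej ltnn eqxx.
      rewrite new_h; have [eij|ne] := eqVneq i j.
        by rewrite eij nth_rcons ej ltnn eqxx new_h.
      have iq : i < size (queue b) by move: ij ne ej; clear; arith.
      by rewrite nth_rcons_lt // old_nth // (label_le I).
    have iq : i < size (queue b) := leq_ltn_trans ij jq.
    by rewrite !nth_rcons_lt // !old_nth // (queue_mono I).
  - by move=> q; rewrite /update; case: eqP => // _; apply: label_le I q.
  - by move=> k kq; rewrite nth_rcons_lt.
  - by move=> q qq; rewrite mem_rcons in_cons qq orbT old.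
  - move=> q; rewrite mem_rcons in_cons => /orP[/eqP->|qq]; last first.
      by rewrite old //; apply: label_path I q qq.
    have [p [pp pl ps]] := label_path I aq; exists (rcons p h).
    rewrite rcons_path pp pl last_rcons size_rcons new_h curE ps; split=> //=.
    have hpos' : 0 < h <= n by rewrite hn; case/andP: hpos => ->.
    by apply/(reachP apos hpos'); apply: ra; rewrite mem_head.
  - by move=> _; rewrite new_h.
  - rewrite size_rcons; split=> // k /andP[k1 k2].
    have -> : k = size (queue b) by move: k1 k2; clear; arith.
    by rewrite nth_rcons ltnn eqxx new_h.
move=> {lxs}; case: hyp => -[q1 q2 q3 q4 q5] [n1 n2 n3 n4 [n5 n6]].
have hle := head_le I.
split=> //=.
- move=> k /andP[k1 k2]; have [kq|kq] := ltnP k (size (queue b)).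
    rewrite n1 //; have [_ ->] := n2 _ (mem_nth 0 kq).
    by apply: (label_ge I); rewrite k1.
  by rewrite n6 // kq.
- exact: leq_trans hle n5.
- by move=> _; rewrite n1 //; have [_ ->] := n2 _ aq.
- move=> k kh c; have kq : k < size (queue b) by move: kh hle; clear; arith.
  rewrite n1 // => ac; have [cq cl] := explored I kh ac.
  have [_ ->] := n2 _ (mem_nth 0 kq); by have [cq1 ->] := n2 _ cq.
- move=> k kh; rewrite n1 ?mem_cat; last exact: leq_trans kh hle.
  by rewrite (head_marked I) // orbT.
- move=> x; rewrite !mem_cat negb_or => xm /andP[xl xt]; move: xm; rewrite (negbTE xl) /= => xm.
  have [->|xh] := eqVneq x h.
    by split; apply: xsl; rewrite !inE eqxx ?orbT.
  have [|h1 h2 h3] := marked_succ I xm; first by rewrite stkE in_cons negb_or xh.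
  by move: h1 h2 h3; rewrite !in_cons !mem_cat => /orP[->|->] /orP[->|->] /orP[->|->];
    rewrite ?orbT.
- move=> x; rewrite !mem_cat negb_or => xm /andP[xl xt] xn; move: xm; rewrite (negbTE xl) /= => xm.
  have [eh|xh] := eqVneq x h; first by rewrite eh n4 // -eh.
  have /n2[+ _] : x \in queue b.
    by rewrite (queue_label I) (marked_label I) // stkE in_cons negb_or xh.
  by rewrite q3.
- move=> x; rewrite !mem_cat => /orP[->//|xt].
  by rewrite (stack_marked I) ?orbT // stkE in_cons xt orbT.
- exact: ul (marked_uniq I).
- by move=> x; rewrite mem_cat => /orP[/lpos|/(marked_pos I)].
- move=> x; rewrite n1 // mem_cat => /orP[/rl//|xt].
  by apply: ra; rewrite in_cons xt orbT.
- have /n2[_ ->] : s \in queue b by rewrite (queue_label I) (source_label I).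
  exact: source_label I.
Qed.

Definition bfs_done b := (stack b == [::]) && (head b == size (queue b)).

(** Every step before the end pops a node or dequeues a vertex, and a push adds to the stack and to
    the marks alike; so the steps taken equal the vertices dequeued plus the marked nodes no longer
    on the stack. This caps them at [NN + n]. *)
Definition bfs_count it b :=
  bfs_done b \/ it + size (stack b) = size (marked b) + head b.

Lemma bfs_step_inv it b : bfs_inv b -> bfs_count it b ->
  bfs_inv (bfs_step b) /\ bfs_count it.+1 (bfs_step b).
Proof.
move=> I cnt; case E: (stack b) => [|h t].
  have [hlt|hge] := ltnP (head b) (size (queue b)); last first.
    have -> : bfs_step b = b by rewrite /bfs_step E ltnNge hge.
    by split=> //; left; rewrite /bfs_done E eqxx eqn_leq hge (head_le I).
  split; first exact: bfs_step_queue.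
  right; rewrite /bfs_step E hlt.
  have [l [e _ _ _ _]] := pushes_spec [:: H + nth 0 (queue b) (head b)] (dequeue b).
  rewrite /pushes /= in e; rewrite e /= E !size_cat /=.
  case: cnt; first by rewrite /bfs_done E /=; move: hlt; clear; arith.
  by rewrite E /=; clear; arith.
split; first exact: bfs_step_stack I E.
right; rewrite /bfs_step E.
have [l [e _ _ _ _]] := pushes_spec [:: s0 h; s1 h; s2 h] (discover h (pop t b)).
rewrite /pushes /= in e; rewrite e /= !size_cat /=.
have [-> -> ->] : [/\ stack (discover h (pop t b)) = t,
  marked (discover h (pop t b)) = marked b
  & head (discover h (pop t b)) = head b] by rewrite /discover; case: ifP.
case: cnt; first by rewrite /bfs_done E.
by rewrite E /=; clear; arith.
Qed.

Lemma bfs_queue_size b : bfs_inv b -> size (queue b) <= n.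
Proof.
move=> I; rewrite -[n](size_iota 1); apply: uniq_leq_size (queue_uniq I) _.
by move=> q /(queue_pos I); rewrite mem_iota; clear; arith.
Qed.

Lemma bfs_marked_size b : bfs_inv b -> size (marked b) <= NN.
Proof.
move=> I; rewrite -[NN](size_iota 1); apply: uniq_leq_size (marked_uniq I) _.
by move=> q /(marked_pos I); rewrite mem_iota; clear; arith.
Qed.

Lemma bfs_end b : bfs_inv b -> bfs_count (NN + n) b -> bfs_done b.
Proof.
move=> I [//|e]; have := bfs_queue_size I; have := bfs_marked_size I.
have hq := head_le I; move=> mn qn; have /size0nil stk0 : size (stack b) = 0 by arith.
by apply/andP; split; apply/eqP => //; rewrite stk0 /= in e; arith.
Qed.

Lemma bfs_sound b q : bfs_inv b -> label b q != 0 ->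
  exists p, [/\ path adj s p, last s p = q & label b q = (size p).+1].
Proof. by move=> I; rewrite -(queue_label I); apply: label_path I q. Qed.

(** At the end every vertex of the queue is explored, so along a path the label grows by at most one
    per edge. *)
Lemma bfs_complete b p : bfs_inv b -> bfs_done b -> path adj s p ->
  label b (last s p) != 0 /\ label b (last s p) <= (size p).+1.
Proof.
move=> I /andP[/eqP stk0 /eqP hd].
have closed x y : reach s0 s1 s2 x y -> x \in 0 :: marked b -> y \in 0 :: marked b.
  apply: (@reach_closed s0 s1 s2 (fun x => x \in 0 :: marked b)) => {}x.
  rewrite in_cons => /orP[/eqP->|xm]; first by case: succ0 => -> -> ->; rewrite mem_head.
  by apply: (marked_succ I) => //; rewrite stk0.
have expl a c : a \in queue b -> adj a c -> c \in queue b /\ label b c <= (label b a).+1.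
  move=> aq ac; have kq : index a (queue b) < size (queue b) by rewrite index_mem.
  rewrite -[a](nth_index 0 aq) in ac *; move: (index a (queue b)) kq ac => {aq} k kq ac.
  have [lt|ge] := ltnP k.+1 (head b); first exact: explored I _ lt _ ac.
  have ek : k = (head b).-1 by move: kq ge hd; clear; arith.
  have h0 : 0 < head b by rewrite hd; move: kq; clear; arith.
  have kpos := queue_pos I (mem_nth 0 kq).
  have cpos := adj_pos ac.
  have cm : c \in 0 :: marked b.
    apply: closed ((reachP kpos cpos).2 ac) _.
    by rewrite in_cons orbC (head_marked I) // hd.
  have {}cm : c \in marked b.
    by move: cm; rewrite in_cons; case: eqP => // c0; move: cpos; rewrite c0.
  split; last by rewrite ek -(current_eq I) // (label_le I).
  rewrite (queue_label I); apply: (marked_label I) => //; first by rewrite stk0.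
  by case/andP: cpos.
elim/last_ind: p => [|p c IH] /=; first by rewrite (source_label I).
rewrite rcons_path last_rcons size_rcons => /andP[/IH[l0 ll] ac].
have [|cq cl] := expl _ _ _ ac; first by rewrite (queue_label I).
by rewrite -(queue_label I) cq; split=> //; apply: leq_trans cl _.
Qed.

End Bfs.

(** * Interval tables and rectangle cells *)

Lemma node_inj n j i j' i' : 0 < i <= n -> 0 < i' <= n ->
  j * n + i = j' * n + i' -> j = j' /\ i = i'.
Proof.
move=> hi hi' e; have [lt|lt|ej] := ltngtP j j'; nia.
Qed.

Section Tables.
Variables (n L H : nat) (adj : rel nat).
Hypothesis n_gt0 : 0 < n.
Hypothesis HE : H = L.+1 * n.

(* Node [j * n + i] stands for the columns [i, i + 2 ^ j) and leads to its two
   halves; node [H + j * n + i] stands for the rows [i, i + 2 ^ j) and leads to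
   the two intervals of length [2 ^ j.+1] of which it is a half.  The nodes
   after [2 * H] are the cells of lists, one list for each row interval; a cell
   leads to two column intervals and to the next cell. *)
Record tables (s0 s1 : nat -> nat) : Prop := Tables {
  tab_col : forall j i, j < L -> 0 < i <= n ->
    s0 (j.+1 * n + i) = j * n + i /\
    s1 (j.+1 * n + i) = if i + 2 ^ j <= n then j * n + i + 2 ^ j else 0;
  tab_leaf : forall i, i <= n -> s0 i = 0 /\ s1 i = 0;
  tab_row : forall j i, j < L -> 0 < i <= n ->
    s0 (H + j * n + i) = H + j.+1 * n + i /\
    s1 (H + j * n + i) = if 2 ^ j < i then H + j.+1 * n + i - 2 ^ j else 0;
  tab_top : forall i, 0 < i <= n ->
    s0 (H + L * n + i) = 0 /\ s1 (H + L * n + i) = 0 }.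

(** The interval may extend beyond column [n]; the part outside is ignored. *)
Definition complete_cols a x := exists j i,
  [/\ j <= L, 0 < i <= n, x = j * n + i
    & forall b, i <= b < i + 2 ^ j -> b <= n -> adj a b].

(** [lo] and [hi] exist only in the proof: they assign to a cell the interval of rows to whose list
    it belongs, which the cell itself does not record. *)
Record cells (cl : nat) (s0 s1 s2 lo hi : nat -> nat) : Prop := Cells {
  cell_base : 2 * H <= cl;
  cell_col : forall x, x <= H -> s2 x = 0;
  cell_row : forall j i, j <= L -> 0 < i <= n ->
    s2 (H + j * n + i) = 0 \/
    [/\ 2 * H < s2 (H + j * n + i) <= cl, lo (s2 (H + j * n + i)) = i
      & hi (s2 (H + j * n + i)) = i + 2 ^ j];
  cell_le : forall x, 2 * H < x <= cl -> s0 x <= H /\ s1 x <= H;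
  cell_sound : forall x a, 2 * H < x <= cl -> lo x <= a < hi x ->
    complete_cols a (s0 x) /\ complete_cols a (s1 x);
  cell_next : forall x, 2 * H < x <= cl -> s2 x = 0 \/
    [/\ 2 * H < s2 x <= cl, lo (s2 x) = lo x & hi (s2 x) = hi x] }.

Definition graph_ok cl s0 s1 s2 :=
  tables s0 s1 /\ exists lo hi, cells cl s0 s1 s2 lo hi.

Lemma node_le j i : j <= L -> i <= n -> j * n + i <= H.
Proof. rewrite HE => *; nia. Qed.

Lemma n_le_H : n <= H. Proof. by rewrite HE; nia. Qed.

Lemma nodeP x : 0 < x <= H -> exists j i, [/\ j <= L, 0 < i <= n & x = j * n + i].
Proof.
move=> hx; exists (x.-1 %/ n), (x.-1 %% n).+1.
have := divn_eq x.-1 n; have := ltn_pmod x.-1 n_gt0.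
move: (x.-1 %/ n) (x.-1 %% n) => q r rn e; split; try lia.
by rewrite HE in hx; nia.
Qed.

Lemma up_reach s0 s1 s2 j i a : tables s0 s1 -> j <= L -> 0 < i ->
  i <= a < i + 2 ^ j -> a <= n -> reach s0 s1 s2 (H + a) (H + j * n + i).
Proof.
move=> tab; elim: j i => [|j IH] i jL i0.
  rewrite expn0 mul0n addn0 => ia an; have -> : i = a by lia.
  exact: reach_refl.
rewrite expnS => ia an; have [lt|ge] := ltnP a (i + 2 ^ j).
  apply: reach_trans (IH i (ltnW jL) i0 _ an) _; first by lia.
  have hi : 0 < i <= n by lia.
  have [e0 _] := tab_row tab jL hi.
  by rewrite -e0; apply: reach_s0 (reach_refl _ _ _ _).
apply: reach_trans (IH (i + 2 ^ j) (ltnW jL) _ _ an) _; [lia | lia |].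
have hi : 0 < i + 2 ^ j <= n by lia.
have [_ e1] := tab_row tab jL hi.
apply: reach_s1; rewrite e1 ifT; last by lia.
have -> : H + j.+1 * n + (i + 2 ^ j) - 2 ^ j = H + j.+1 * n + i by lia.
exact: reach_refl.
Qed.

Lemma down_reach s0 s1 s2 j i b : tables s0 s1 -> j <= L -> 0 < i ->
  i <= b < i + 2 ^ j -> b <= n -> reach s0 s1 s2 (j * n + i) b.
Proof.
move=> tab; elim: j i => [|j IH] i jL i0.
  rewrite expn0 mul0n add0n => ib bn; have -> : i = b by lia.
  exact: reach_refl.
rewrite expnS => ib bn; have hi : 0 < i <= n by lia.
have [e0 e1] := tab_col tab jL hi; have [lt|ge] := ltnP b (i + 2 ^ j).
  by apply: reach_s0; rewrite e0; apply: IH => //; [exact: ltnW | lia].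
apply: reach_s1; rewrite e1 ifT -?addnA; last by lia.
by apply: IH => //; [exact: ltnW | lia | lia].
Qed.

(** Following edges from row [a] preserves [P]: the node is 0, a column interval full of ones in row
    [a], a row interval that contains [a], or a cell of such an interval. A single column satisfies
    it only in the second way. *)
Lemma graph_sound cl s0 s1 s2 a b : graph_ok cl s0 s1 s2 ->
  0 < a <= n -> 0 < b <= n -> reach s0 s1 s2 (H + a) b -> adj a b.
Proof.
move=> [tab [lo [hi C]]] ha hb.
have [l00 l01] := tab_leaf tab (leq0n n).
have base := cell_base C.
pose P x := [\/ x = 0, complete_cols a x,
  exists j i, [/\ j <= L, 0 < i <= n, x = H + j * n + i & i <= a < i + 2 ^ j]
  | 2 * H < x <= cl /\ lo x <= a < hi x].
have P0 : P 0 by constructor 1.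
have close x : P x -> [/\ P (s0 x), P (s1 x) & P (s2 x)].
  case=> [->|[j [i [jL hi_ -> cc]]]|[j [i [jL hi_ -> ia]]]|[hx ax]].
  - by rewrite l00 l01 (cell_col C).
  - rewrite (cell_col C (node_le jL _)); last by lia.
    case: j jL cc => [|j] jL cc.
      by rewrite mul0n add0n; have [-> ->] := tab_leaf tab (proj2 (andP hi_)).
    have [-> ->] := tab_col tab jL hi_; rewrite expnS in cc; split=> //.
      constructor 2; exists j, i; split=> //; first exact: ltnW.
      by move=> c hc; apply: cc; lia.
    case: ifP => // le; constructor 2; exists j, (i + 2 ^ j); split.
    + exact: ltnW.
    + by lia.
    + by rewrite addnA.
    + by move=> c hc; apply: cc; lia.
  - split.
    + have [jlt|jge] := ltnP j L; last first.
        have -> : j = L by lia.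
        by have [-> _] := tab_top tab hi_.
      have [-> _] := tab_row tab jlt hi_; constructor 3; exists j.+1, i; split=> //.
      by rewrite expnS; lia.
    + have [jlt|jge] := ltnP j L; last first.
        have -> : j = L by lia.
        by have [_ ->] := tab_top tab hi_.
      have [_ ->] := tab_row tab jlt hi_; case: ifP => // lt.
      constructor 3; exists j.+1, (i - 2 ^ j); rewrite expnS; split=> //; lia.
    + have [->//|[h1 h2 h3]] := cell_row C jL hi_.
      by constructor 4; rewrite h2 h3.
  - have [c0 c1] := cell_sound C hx ax; split; [by constructor 2 | by constructor 2 |].
    by have [->//|[h1 h2 h3]] := cell_next C hx; constructor 4; rewrite h2 h3.
move=> r; have := reach_closed close r; case.
- constructor 3; exists 0, a; rewrite mul0n addn0 expn0; split=> //; lia.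
- by lia.
- case=> j [i [jL hi_ e cc]]; case: j jL e cc => [|j] jL e cc; last by nia.
  by rewrite e mul0n add0n; apply: cc; rewrite ?expn0; lia.
- by case=> j [i [_ hi_ e _]]; have := n_le_H; arith.
- by have := n_le_H; arith.
Qed.

Lemma graph_succ_le cl s0 s1 s2 x : graph_ok cl s0 s1 s2 -> x <= cl ->
  [/\ s0 x <= cl, s1 x <= cl & s2 x <= cl].
Proof.
move=> [tab [lo [hi C]]] xcl; have base := cell_base C.
have [le|gt] := leqP x H.
  rewrite (cell_col C le); have [->|x0] := posnP x.
    by have [-> ->] := tab_leaf tab (leq0n n).
  have [|j [i [jL hi_ ->]]] := @nodeP x; first by lia.
  case: j jL => [|j] jL.
    by rewrite mul0n add0n; have [-> ->] := tab_leaf tab (proj2 (andP hi_)).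
  have [-> ->] := tab_col tab jL hi_.
  have l1 := @node_le j.+1 n jL (leqnn _).
  by split=> //; [|case: ifP => // h]; rewrite mulSn in l1; lia.
have [le2|gt2] := leqP x (2 * H).
  have [|j [i [jL hi_ ex]]] := @nodeP (x - H); first by lia.
  have {ex} -> : x = H + j * n + i by lia.
  have s2le : s2 (H + j * n + i) <= cl.
    by have [->//|[]] := cell_row C jL hi_; lia.
  have [jlt|jge] := ltnP j L.
    have [-> ->] := tab_row tab jlt hi_.
    have l1 := @node_le j.+1 i jlt (proj2 (andP hi_)).
    by split=> //; [|case: ifP => // h]; lia.
  have ej : j = L by lia.
  by rewrite ej in s2le *; have [-> ->] := tab_top tab hi_.
have hx : 2 * H < x <= cl by lia.
have [h0 h1] := cell_le C hx; split; try lia.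
by have [->//|[]] := cell_next C hx; lia.
Qed.

(** The cell becomes the head of the list at [U]. The only edge between old nodes that disappears,
    from [U] to its old list, survives as a path through the new cell, so reachability is kept;
    [y <= cl] is asked since the fields of the new cell are overwritten. *)
Lemma push_cell cl s0 s1 s2 j i D1 D2 : graph_ok cl s0 s1 s2 ->
  j <= L -> 0 < i <= n -> D1 <= H -> D2 <= H ->
  (forall a, i <= a < i + 2 ^ j -> complete_cols a D1 /\ complete_cols a D2) ->
  let x := cl.+1 in let U := H + j * n + i in
  let s0' := update s0 x D1 in let s1' := update s1 x D2 in
  let s2' := update (update s2 x (s2 U)) U x in
  [/\ graph_ok x s0' s1' s2',
      forall y z, y <= cl -> reach s0 s1 s2 y z -> reach s0' s1' s2' y z
    & forall a j' k b, j' <= L -> 0 < k ->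
        D1 = j' * n + k \/ D2 = j' * n + k -> i <= a < i + 2 ^ j -> a <= n ->
        k <= b < k + 2 ^ j' -> b <= n -> reach s0' s1' s2' (H + a) b].
Proof.
move=> G jL hi_ D1H D2H sound /=; set x := cl.+1; set U := H + j * n + i.
have [tab [lo [hi C]]] := G; have base := cell_base C.
have UH : H < U <= 2 * H.
  by rewrite /U; have := @node_le j i jL (proj2 (andP hi_)); lia.
have xU : x != U by lia.
have tab' : tables (update s0 x D1) (update s1 x D2).
  have far y : y <= 2 * H -> update s0 x D1 y = s0 y /\ update s1 x D2 y = s1 y.
    move=> yH; have /negbTE e : y != x by lia.
    by rewrite /update e.
  have nH := n_le_H.
  split.
  - move=> j' i' jL' hi'; have [|-> ->] := far (j'.+1 * n + i').
      by have := @node_le j'.+1 i' jL' (proj2 (andP hi')); lia.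
    exact: tab_col.
  - by move=> i' hi'; have [|-> ->] := far i'; [lia | apply: tab_leaf tab _ hi'].
  - move=> j' i' jL' hi'; have [|-> ->] := far (H + j' * n + i').
      by have := @node_le j' i' (ltnW jL') (proj2 (andP hi')); lia.
    exact: tab_row.
  - move=> i' hi'; have [|-> ->] := far (H + L * n + i').
      by have := @node_le L i' (leqnn _) (proj2 (andP hi')); lia.
    exact: tab_top.
have s2x : update (update s2 x (s2 U)) U x x = s2 U.
  by rewrite /update (negbTE xU) eqxx.
have s2U : update (update s2 x (s2 U)) U x U = x by rewrite /update eqxx.
have s2o y : y != x -> y != U -> update (update s2 x (s2 U)) U x y = s2 y.
  by move=> /negbTE yx /negbTE yU; rewrite /update yU yx.
have sx : update s0 x D1 x = D1 /\ update s1 x D2 x = D2 by rewrite /update eqxx.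
have so y : y != x -> update s0 x D1 y = s0 y /\ update s1 x D2 y = s1 y.
  by rewrite /update => /negbTE ->.
split.
- split=> //; exists (update lo x i), (update hi x (i + 2 ^ j)).
  have lox : update lo x i x = i /\ update hi x (i + 2 ^ j) x = i + 2 ^ j.
    by rewrite /update eqxx.
  have loo y : y != x -> update lo x i y = lo y /\ update hi x (i + 2 ^ j) y = hi y.
    by rewrite /update => /negbTE ->.
  split.
  + by lia.
  + by move=> y yH; rewrite s2o ?(cell_col C) //; lia.
  + move=> j' i' jL' hi'; have [e|ne] := eqVneq (H + j' * n + i') U.
      rewrite e s2U; right; have [-> ->] := lox; split; first by lia.
        by have [] := @node_inj n j' i' j i hi' hi_; rewrite /U in e; lia.
      by have [-> ->] := @node_inj n j' i' j i hi' hi_ ltac:(rewrite /U in e; lia).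
    have le := @node_le j' i' jL' (proj2 (andP hi')).
    rewrite s2o //; last by lia.
    have [->|[h1 h2 h3]] := cell_row C jL' hi'; first by left.
    right; have [|-> ->] := loo (s2 (H + j' * n + i')); first by lia.
    by split=> //; lia.
  + move=> y hy; have [->|ne] := eqVneq y x; first by have [-> ->] := sx.
    by have [-> ->] := so _ ne; apply: (cell_le C); lia.
  + move=> y a hy; have [->|ne] := eqVneq y x.
      by have [-> ->] := sx; have [-> ->] := lox; apply: sound.
    have [-> ->] := so _ ne; have [-> ->] := loo _ ne; apply: (cell_sound C); lia.
  + move=> y hy; have [->|ne] := eqVneq y x.
      rewrite s2x; have [-> ->] := lox.
      have [->|[h1 h2 h3]] := cell_row C jL hi_; first by left.
      rewrite -/U in h1 h2 h3; right; have [|-> ->] := loo (s2 U); first by lia.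
      by rewrite h2 h3; split=> //; lia.
    rewrite s2o //; last by lia.
    have [-> ->] := loo _ ne.
    have [|->|[h1 h2 h3]] := @cell_next _ _ _ _ _ _ C y; [by lia | by left | right].
    have [|-> ->] := loo (s2 y); first by lia.
    by split=> //; lia.
- move=> y z ycl r; elim: r ycl => [y'|y' z' _ IH|y' z' _ IH|y' z' _ IH] ycl.
  + exact: reach_refl.
  + have [h0 _ _] := graph_succ_le G ycl.
    by apply: reach_s0; have [|-> _] := so y'; [lia | apply: IH].
  + have [_ h1 _] := graph_succ_le G ycl.
    by apply: reach_s1; have [|_ ->] := so y'; [lia | apply: IH].
  + have [_ _ h2] := graph_succ_le G ycl.
    apply: reach_s2; have [eU|ne] := eqVneq y' U; first rewrite eU in IH h2 *.
      by rewrite s2U; apply: reach_s2; rewrite s2x; apply: IH.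
    by rewrite s2o //; [apply: IH | lia].
- move=> a j' k b jL' k0 hD ha an hb bn.
  have i0 : 0 < i by lia.
  apply: reach_trans (up_reach _ tab' jL i0 ha an) _; rewrite -/U.
  apply: reach_s2; rewrite s2U; have [e0 e1] := sx.
  have D := @down_reach _ _ (update (update s2 x (s2 U)) U x) j' k b tab' jL' k0 hb bn.
  by case: hD => hD; rewrite -hD in D; [apply: reach_s0; rewrite e0 | apply: reach_s1; rewrite e1].
Qed.

End Tables.

(** * The program: vertex order and runs *)

Declare Scope aexp_scope.
Delimit Scope aexp_scope with aexp.
Bind Scope aexp_scope with aexp.
Arguments Get _%_nat _%_aexp.
Arguments Put _%_nat _%_aexp _%_aexp.
Notation "a + b" := (Plus a b) : aexp_scope.
Notation "a - b" := (Minus a b) : aexp_scope.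
Notation "a * b" := (Times a b) : aexp_scope.
Notation "a < b" := (Less a b) : aexp_scope.
Notation "a == b" := (Same a b) : aexp_scope.

Declare Scope acmd_scope.
Delimit Scope acmd_scope with acmd.
Bind Scope acmd_scope with acmd.
Notation "c1 ;; c2" := (Then c1 c2) (at level 90, right associativity) : acmd_scope.
Notation "r <- a" := (Upd r a%aexp) (at level 80) : acmd_scope.
Notation "'If' a 'do' c1 'else' c2" := (Cond a%aexp c1 c2) (at level 85) : acmd_scope.
Local Open Scope acmd_scope.

Coercion Num : nat >-> aexp.

(* Positions, rows, columns and sources count from 1.  Array 0 holds the input
   and finally the output, 1 the order as a linked list, 2 the order itself,
   3 the ends of the runs, 4 the first row of the current run at each column,
   5 to 7 the successors of the nodes, 8 the largest power of two below each
   length and 9 the offset of its level, 10 the marks, 11 the stack, 12 the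
   queue and 13 the labels.  Row [a] of 3 and 13 starts at [a * (n + 2)], which
   leaves a border of zeros. *)
Notation rN := 1 (only parsing).
Notation N_ := (Var 1) (only parsing).
Notation rW := 2 (only parsing).
Notation W_ := (Var 2) (only parsing).
Notation rM := 3 (only parsing).
Notation rI := 4 (only parsing).
Notation I_ := (Var 4) (only parsing).
Notation rJ := 5 (only parsing).
Notation J_ := (Var 5) (only parsing).
Notation rX := 6 (only parsing).
Notation X_ := (Var 6) (only parsing).
Notation rU := 7 (only parsing).
Notation U_ := (Var 7) (only parsing).
Notation rV := 8 (only parsing).
Notation V_ := (Var 8) (only parsing).
Notation rA := 9 (only parsing).
Notation A_ := (Var 9) (only parsing).
Notation rK := 10 (only parsing).
Notation K_ := (Var 10) (only parsing).

Definition prologue : acmd :=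
  rN <- Get 0 0 ;; rW <- N_ + 2 ;; rM <- N_ - 1.

(** Pairs are read from the last to the first: counting from 0, round [I_] uses pair [n - 2 - I_],
    stored from address [1 + n * n + 2 * (n - 2 - I_)] on. *)
Definition link_body : acmd :=
  rX <- N_ * N_ + 2 * (N_ - I_) - 3 ;;
  rU <- Get 0 X_ ;; rV <- Get 0 (X_ + 1) ;;
  Put 1 U_ (Get 1 V_) ;; Put 1 V_ U_.

Definition link_order : acmd := For rI rM link_body.

Definition walk_body : acmd := Put 2 (I_ + 1) X_ ;; rX <- Get 1 X_.

Definition walk_order : acmd :=
  rX <- Get 0 (N_ * N_ + 2 * N_ - 2) ;; For rI rN walk_body.

Definition runs_body : acmd :=
  rA <- I_ + 1 ;; rK <- N_ - J_ ;; rX <- A_ * W_ + K_ ;;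
  If Get 0 (1 + Get 2 A_ * N_ + Get 2 K_) do
    (If Get 3 (X_ + 1) do Put 3 X_ (Get 3 (X_ + 1)) else Put 3 X_ K_)
  else Pass.

Definition find_runs : acmd := For rI rN (For rJ rN runs_body).

(** [f] is the successor map of a linked list. Its value at the last entry is left arbitrary, so no
    end marker is required. *)
Lemma path_insert_after (f : nat -> nat) u v x s :
  path (fun a b => f a == b) x s -> uniq (x :: s) -> u \notin x :: s ->
  v \in x :: s ->
  sorted (fun a b => update (update f u (f v)) v u a == b)
         (insert_after u v (x :: s)).
Proof.
set f' := update _ v u; have uv_fE y : y != u -> y != v -> f' y = f y.
  by move=> /negbTE yu /negbTE yv; rewrite /f' /update yv yu.
have same y s' : path (fun a b => f a == b) y s' -> u \notin y :: s' ->
    v \notin y :: s' -> path (fun a b => f' a == b) y s'.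
  elim: s' y => //= z s' IH y /andP[fyz pz].
  rewrite !in_cons !negb_or -!(eq_sym y) => /and3P[yu zu us] /and3P[yv zv vs].
  by rewrite uv_fE // fyz IH // ?in_cons ?negb_or ?zu ?zv.
have fv : f' v = u by rewrite /f' /update eqxx.
elim: s x => [|y s IH] x /=.
  move=> _ _; rewrite !inE => ux /eqP evx; rewrite -evx eqxx /= fv eqxx.
  by [].
case/andP=> fxy pys /andP[xys ys_uniq].
rewrite [u \in _]in_cons negb_or => /andP[ux uys].
rewrite in_cons; have [evx _|nvx] := eqVneq v x.
  rewrite -evx ?eqxx /= fv ?eqxx /=.
  have -> : f' u = f v by rewrite /f' /update eqxx evx (negbTE ux).
  by rewrite evx fxy /=; apply: same => //; rewrite evx.
move=> /= vys.
have := IH y pys ys_uniq uys vys.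
have fxy' : f' x == y by rewrite uv_fE // eq_sym.
by rewrite /=; case: ifP => _ /= ->; rewrite fxy'.
Qed.

Lemma entry_inj n a c a' c' : c < n + 2 -> c' < n + 2 ->
  a * (n + 2) + c = a' * (n + 2) + c' -> a = a' /\ c = c'.
Proof. by move=> hc hc' e; have [lt|lt|ej] := ltngtP a a'; nia. Qed.

Lemma entry_bound n a c : 0 < n -> a <= n.+1 -> c <= n + 2 ->
  a * (n + 2) + c <= 10 * (n * n).
Proof. by move=> *; nia. Qed.

Ltac split_vc :=
  repeat match goal with
  | |- _ /\ _ => split
  | |- [/\ _, _ & _] => split
  | |- [/\ _, _, _ & _] => split
  end; rewrite ?implybT //=; try lia.

Section Phases.
Variables (n root : nat) (u v : nat -> nat) (g : rel nat) (base B : nat).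
Hypothesis CS : contraction_seq n root u v.
Hypothesis baseE : base = 2 * (n * n) + 2.
Hypothesis BE : B = 100 * (n * n).

Let n_gt0 : 0 < n := contraction_gt0 CS.

Record input_ok (inp : nat -> nat) : Prop := InputOk {
  input_n : inp 0 = n;
  input_adj : forall x y, x < n -> y < n -> inp (1 + x * n + y) = g x y;
  input_u : forall i, i < n.-1 -> inp (1 + n * n + 2 * i) = u i;
  input_v : forall i, i < n.-1 -> inp (2 + n * n + 2 * i) = v i;
  input_root : inp (n * n + 2 * n - 2) = root }.

Definition sizes m := [/\ var m 1 = n, var m 2 = n + 2 & var m 3 = n.-1].

Lemma n_le_nn : n <= n * n /\ 2 * n <= n * n + 1.
Proof. by split; nia. Qed.

Lemma sizes_frame c m m1 : [&& 1 \notin var_mod c, 2 \notin var_mod c & 3 \notin var_mod c] ->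
  frame c m m1 -> sizes m -> sizes m1.
Proof. by case/and3P=> h1 h2 h3 [fr _] [s1 s2 s3]; split; rewrite fr. Qed.

Lemma prologue_triple m : input_ok (arr m 0) ->
  triple base B prologue m sizes (max_time prologue).
Proof.
move=> inp; apply: vc_triple; have [nn nn2] := n_le_nn.
by rewrite /= (input_n inp) /sizes /=; repeat split; lia.
Qed.

Lemma rev_order_spec k : k <= n.-1 ->
  [/\ uniq (rev_order n root u v k), size (rev_order n root u v k) = k.+1
    & exists s, rev_order n root u v k = root :: s].
Proof.
move=> km; have e : rev_order n root u v k = order n root u v (n.-1 - k).
  by rewrite /order subKn.
have [_ un sz] := order_spec CS (leq_subr k n.-1).
rewrite {1 2}e un sz; split=> //; first by lia.
elim: k {km e un sz} => [|k [s es]]; first by exists [::].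
by rewrite /= es /=; case: ifP => _; eexists.
Qed.

Lemma link_triple m : input_ok (arr m 0) -> sizes m ->
  triple base B link_order m
    (fun m' => sorted (fun x y => arr m' 1 x == y) (order n root u v 0))
    (6 + n.-1 * (max_time link_body + 8)).
Proof.
move=> inp [hN hW hM].
have -> : order n root u v 0 = rev_order n root u v n.-1 by rewrite /order subn0.
have [nn nn2] := n_le_nn.
apply: (@triple_for base B 4 3 link_body m (fun i m' =>
  sorted (fun x y => arr m' 1 x == y) (rev_order n root u v i))) => //; first by lia.
move=> i m1 im fr hi Q; apply: vc_triple.
have {}hN : var m1 1 = n by rewrite fr.1.
have ha : arr m1 0 = arr m 0 by rewrite fr.2.
set j := n.-1 - i.+1; have jm : j < n.-1 by rewrite /j; lia.
have ej : n * n + 2 * (n - i) - 3 = 1 + n * n + 2 * j by rewrite /j; lia.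
have hu := contraction_u CS jm; have hv := contraction_v CS jm.
rewrite /= hN hi ej ha (input_u inp) //.
have -> : 1 + n * n + 2 * j + 1 = 2 + n * n + 2 * j by lia.
rewrite (input_v inp) //; split_vc.
have [un sz [s es]] := @rev_order_spec i ltac:(lia).
rewrite -[X in sorted _ X]/(insert_after (u j) (v j) (rev_order n root u v i)).
rewrite es; rewrite es in Q un; apply: path_insert_after => //; rewrite -es.
  have := u_notin CS jm; rewrite /order.
  by have -> : n.-1 - j.+1 = i by rewrite /j; lia.
have := v_in CS jm; rewrite /order.
by have -> : n.-1 - j.+1 = i by rewrite /j; lia.
Qed.

Lemma walk_triple m : input_ok (arr m 0) -> sizes m ->
  sorted (fun x y => arr m 1 x == y) (order n root u v 0) ->
  triple base B walk_order m
    (fun m' => forall p, 0 < p <= n -> arr m' 2 p = vert n root u v p)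
    (max_time (rX <- Get 0 (N_ * N_ + 2 * N_ - 2)) +
     (6 + n * (max_time walk_body + 8))).
Proof.
move=> inp [hN hW hM] srt; have [nn nn2] := n_le_nn.
apply: (@triple_then _ _ _ _ _ (fun m1 => var m1 6 = root)).
  apply: vc_triple; rewrite /= hN (input_root inp); split_vc.
move=> m0 fr0 hX.
have hN0 : var m0 1 = n by rewrite fr0.1.
have {}srt : sorted (fun x y => arr m0 1 x == y) (order n root u v 0) by rewrite fr0.2.
have szL := size_order0 CS.
apply: triple_weaken (leqnn _).
  apply: (@triple_for base B 4 1 walk_body m0 (fun i m' =>
    (forall p, 0 < p <= i -> arr m' 2 p = vert n root u v p) /\
    (i < n -> var m' 6 = nth 0 (order n root u v 0) i))) => //; first by lia.
    split=> [p|_] /=; first by lia.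
    rewrite hX /order subn0.
    by have [_ _ [s ->]] := rev_order_spec (leqnn _).
  move=> i m1 im fr hi [Q1 Q2]; apply: vc_triple.
  have hX1 := Q2 im.
  have nthlt k : k < n -> nth 0 (order n root u v 0) k < n.
    by move=> kn; rewrite -(mem_order0 CS) mem_nth // szL.
  have := nthlt _ im; rewrite -hX1 => hlt.
  rewrite /= hi; split_vc.
    move=> p hp; rewrite /update; case: eqP => [->|ne]; last by apply: Q1; lia.
    by rewrite hX1 /vert addn1.
  move=> i1n; rewrite hX1; apply/eqP; move/sortedP: srt => /(_ 0 i).
  by rewrite szL i1n (fr.2 1) // => ->.
by move=> m' _ [].
Qed.

Lemma run_end_out a c : ~~ pos_ok n a || ~~ pos_ok n c -> run_end n root u v g a c = 0.
Proof.
rewrite /run_end /adj -negb_and; case: (pos_ok n a) => //=.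
by case: (pos_ok n c).
Qed.

Definition order_ok (m : astate) :=
  forall p, 0 < p <= n -> arr m 2 p = vert n root u v p.

Definition runs_ok (m : astate) := forall a c, a <= n.+1 -> c <= n.+1 ->
  arr m 3 (a * (n + 2) + c) = run_end n root u v g a c.

Lemma runs_triple m : input_ok (arr m 0) -> sizes m -> order_ok m ->
  (forall i, arr m 3 i = 0) ->
  triple base B find_runs m runs_ok
    (6 + n * (6 + n * (max_time runs_body + 8) + 8)).
Proof.
move=> inp sz ord zero; have [nn nn2] := n_le_nn; have [hN hW hM] := sz.
apply: triple_weaken (leqnn _).
  apply: (@triple_for base B 4 1 (For rJ rN runs_body) m (fun i m' =>
    forall a c, a <= n.+1 -> c <= n.+1 -> arr m' 3 (a * (n + 2) + c) =
      if a <= i then run_end n root u v g a c else 0)) => //; first by lia.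
    move=> a c an cn /=; rewrite zero; case: leqP => // a0.
    by rewrite run_end_out // /pos_ok; lia.
  move=> i m1 im fr hi Q.
  have {hN hW}[hN hW] : var m1 1 = n /\ var m1 2 = n + 2 by rewrite !fr.1.
  have ha : arr m1 0 = arr m 0 by rewrite fr.2.
  have {}ord : order_ok m1 by rewrite /order_ok fr.2.
  apply: triple_weaken (leqnn _).
    apply: (@triple_for base B 5 1 runs_body m1 (fun j m' =>
      forall a c, a <= n.+1 -> c <= n.+1 -> arr m' 3 (a * (n + 2) + c) =
        if (a <= i) || ((a == i.+1) && (n - j < c)) then run_end n root u v g a c
        else 0)) => //; first by lia.
      move=> a c an cn /=; rewrite Q //; case: (leqP a i) => //= ai.
      case: ifP => // h; rewrite run_end_out // /pos_ok; lia.
    move=> j m2 jn fr2 hj Q2; apply: vc_triple.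
    have {hN hW hi}[hN hW hi] : [/\ var m2 1 = n, var m2 2 = n + 2 & var m2 4 = i] by rewrite !fr2.1.
    have {}ha : arr m2 0 = arr m 0 by rewrite fr2.2.
    have {}ord : order_ok m2 by rewrite /order_ok fr2.2.
    have aok : 0 < i + 1 <= n by lia.
    have cok : 0 < n - j <= n by lia.
    have va := vert_lt CS aok; have vc_ := vert_lt CS cok.
    have cb := @entry_bound n (i + 1) (n - j) n_gt0 ltac:(lia) ltac:(lia).
    have inpE : arr m2 0 (1 + vert n root u v (i + 1) * n + vert n root u v (n - j)) =
        adj n root u v g (i + 1) (n - j).
      by rewrite ha (input_adj inp) // /adj /pos_ok aok cok.
    have bnd : vert n root u v (i + 1) * n + vert n root u v (n - j) < n * n by nia.
    have nxt : arr m2 3 ((i + 1) * (n + 2) + (n - j) + 1) = run_end n root u v g (i + 1) (n - j).+1.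
      have -> : (i + 1) * (n + 2) + (n - j) + 1 = (i + 1) * (n + 2) + (n - j).+1 by lia.
      by rewrite Q2 ?ifT //; lia.
    have old a c : a <= n.+1 -> c <= n.+1 ->
        a * (n + 2) + c <> (i + 1) * (n + 2) + (n - j) ->
        arr m2 3 (a * (n + 2) + c) =
        if (a <= i) || (a == i.+1) && (n - j.+1 < c) then run_end n root u v g a c
        else 0.
      move=> an cn ne; rewrite Q2 //; case: (leqP a i) => //= _.
      case: eqP => //= ea; rewrite -addn1 in ea; rewrite ea in ne.
      by have -> : (n - j.+1 < c) = (n - j < c) by lia.
    rewrite /= hi hN hW hj (ord _ aok) (ord _ cok) inpE nxt.
    have key x : x = run_end n root u v g (i + 1) (n - j) ->
        forall a c, a <= n.+1 -> c <= n.+1 ->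
        update (arr m2 3) ((i + 1) * (n + 2) + (n - j)) x (a * (n + 2) + c) =
        if (a <= i) || (a == i.+1) && (n - j.+1 < c) then run_end n root u v g a c
        else 0.
      move=> -> a c an cn; rewrite /update; case: eqP => [e|/old]; last by move=> ->.
      have [-> ->] := @entry_inj n a c (i + 1) (n - j) ltac:(lia) ltac:(lia) e.
      by rewrite ifT //; lia.
    split_vc.
    - move=> ad; split_vc.
      + move=> nz; split_vc; apply: key.
        by rewrite [RHS]run_end_rec // ifT; [case: eqP | case: adj ad].
      + move=> nz; split_vc.
        apply: key; rewrite [RHS]run_end_rec // nz ifT //; by case: adj ad.
    (* Nothing is written for a zero of the matrix; the entry is still 0 from the start. *)
    - move=> nad a c an cn.
      have nul : 0 = run_end n root u v g (i + 1) (n - j).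
        by rewrite /run_end; case: adj nad.
      have old0 : arr m2 3 ((i + 1) * (n + 2) + (n - j)) = 0.
        by rewrite Q2 ?ifF //; lia.
      by have := key 0 nul a c an cn; rewrite /update; case: eqP => [->|]; rewrite ?old0.
  move=> m2 fr2 Q2 a c an cn /=; rewrite Q2 // subnn.
  have -> : (a <= i.+1) = (a <= i) || (a == i.+1) by lia.
  case: (leqP a i) => //= ai; case: eqP => //= ea; case: (posnP c) => // ->.
  by rewrite run_end_out // /pos_ok /=; lia.
move=> m' fr' Q a c an cn; rewrite Q //; case: leqP => // na.
by rewrite run_end_out // /pos_ok; lia.
Qed.

End Phases.

(** * The program: interval tables *)

Notation rP := 11 (only parsing).
Notation P_ := (Var 11) (only parsing).
Notation rO := 12 (only parsing).
Notation O_ := (Var 12) (only parsing).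
Notation rL := 13 (only parsing).
Notation L_ := (Var 13) (only parsing).
Notation rH := 14 (only parsing).
Notation H_ := (Var 14) (only parsing).

(** When stored, [P_] is the largest power of two not exceeding [X_] and [O_] is [n] times its
    exponent; repeated doubling finds all logarithms in linear time. *)
Definition logs_body : acmd :=
  rX <- I_ + 1 ;;
  (If X_ == P_ + P_ do (rP <- P_ + P_ ;; rO <- O_ + N_ ;; rL <- L_ + 1) else Pass) ;;
  Put 8 X_ P_ ;; Put 9 X_ O_.

Definition logs_init : acmd := rP <- 1 ;; rO <- 0 ;; rL <- 0.

Definition find_logs : acmd :=
  logs_init ;; For rI rN logs_body ;; rH <- O_ + N_.

(** Multiplication by the value 0 or 1 of a test selects between a node and the missing successor
    0. *)
Definition tables_body : acmd :=
  rX <- O_ + (I_ + 1) ;;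
  Put 5 (X_ + N_) X_ ;;
  Put 6 (X_ + N_) ((I_ + 1 + P_ < N_ + 1) * (X_ + P_)) ;;
  Put 5 (H_ + X_) (H_ + X_ + N_) ;;
  Put 6 (H_ + X_) ((P_ < I_ + 1) * (H_ + X_ + N_ - P_)).

Definition tables_init : acmd := rP <- 1 ;; rO <- 0.

Definition tables_next : acmd := rP <- P_ + P_ ;; rO <- O_ + N_.

Definition fill_tables : acmd :=
  tables_init ;; For rJ rL (For rI rN tables_body ;; tables_next).

Lemma log_lt n L : 2 ^ L <= n < 2 ^ L.+1 -> L < n.
Proof. by move=> /andP[h _]; apply: leq_trans (ltn_expl L (isT : 1 < 2)) h. Qed.

Lemma mul_log_le n L : 2 ^ L <= n < 2 ^ L.+1 -> L.+1 * n <= n * n.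
Proof. by move/log_lt => h; rewrite leq_mul2r h orbT. Qed.

Lemma exp_log_le n L j : 2 ^ L <= n < 2 ^ L.+1 -> j <= L -> 2 ^ j <= n.
Proof. by move=> /andP[h _] jL; apply: leq_trans h; rewrite leq_exp2l. Qed.

Section Phases.
Variables (n base B : nat).
Hypothesis n_gt0 : 0 < n.
Hypothesis baseE : base = 2 * (n * n) + 2.
Hypothesis BE : B = 100 * (n * n).

Let nn : n <= n * n. Proof. by nia. Qed.

Definition logs_ok l m := forall len, 0 < len <= n -> exists j,
  [/\ j <= l, 2 ^ j <= len < 2 ^ j.+1, arr m 8 len = 2 ^ j & arr m 9 len = j * n].

Lemma logs_triple m : var m 1 = n ->
  triple base B find_logs m
    (fun m' => exists l, [/\ var m' 13 = l, var m' 14 = l.+1 * n,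
       2 ^ l <= n < 2 ^ l.+1 & logs_ok l m'])
    (max_time logs_init + (6 + n * (max_time logs_body + 8) + max_time (rH <- O_ + N_))).
Proof.
move=> hN.
apply: (@triple_then _ _ _ _ _ (fun m1 => [/\ var m1 11 = 1, var m1 12 = 0 & var m1 13 = 0])).
  by apply: vc_triple; rewrite /=; split_vc.
move=> m0 fr0 [hP hO hL]; have {}hN : var m0 1 = n by rewrite fr0.1.
(* [maxn 1 i] covers the start [i = 0], where [P_] is already 1. *)
pose Q i m' := exists l, [/\ [/\ var m' 11 = 2 ^ l, var m' 12 = l * n & var m' 13 = l],
  2 ^ l <= maxn 1 i, i < 2 ^ l.+1 & forall len, 0 < len <= i -> exists j,
  [/\ j <= l, 2 ^ j <= len < 2 ^ j.+1, arr m' 8 len = 2 ^ j & arr m' 9 len = j * n]].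
apply: (@triple_then _ _ _ _ _ (Q n)).
  apply: triple_for => //; first by lia.
    by exists 0; split=> // len; lia.
  move=> i m1 im fr hi [l [[hP1 hO1 hL1] lle ilt Qi]]; apply: vc_triple.
  have {}hN : var m1 1 = n by rewrite fr.1.
  have ln : l < n.
    apply: leq_trans (ltn_expl l (isT : 1 < 2)) _; lia.
  have lnn : l * n + n <= n * n by nia.
  rewrite expnS in ilt.
  have keep l' : l <= l' -> 2 ^ l' <= i + 1 < 2 ^ l'.+1 ->
      forall len, 0 < len <= i.+1 -> exists j,
      [/\ j <= l', 2 ^ j <= len < 2 ^ j.+1,
         update (arr m1 8) (i + 1) (2 ^ l') len = 2 ^ j
       & update (arr m1 9) (i + 1) (l' * n) len = j * n].
    move=> ll' hl' len hlen; rewrite /update.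
    case: eqP => [->|ne]; first by exists l'.
    have [j [h1 h2 h3 h4]] := Qi len ltac:(lia).
    by exists j; split=> //; apply: leq_trans ll'.
  rewrite /= hi hP1 hO1 hL1 hN; split_vc.
    move=> /eqP; rewrite eqb0 negbK => /eqP e; split_vc.
    have e2 : 2 ^ l + 2 ^ l = 2 ^ l.+1 by rewrite expnS; lia.
    have e3 : l * n + n = l.+1 * n by rewrite mulSn addnC.
    exists l.+1; rewrite /= e2 e3 addn1; rewrite expnS in e2.
    have := expnS 2 l.+1; have := expnS 2 l => e4 e5.
    split=> //; try lia.
    by rewrite addn1 in keep *; apply: keep; lia.
  move=> /eqP; rewrite eqb0 => /eqP ne; split_vc.
  exists l; rewrite /= expnS; split=> //; try lia.
  by apply: keep; rewrite ?expnS; lia.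
move=> m1 fr [l [[hP1 hO1 hL1] lle ilt Qi]]; apply: vc_triple.
have ln : l < n.
  apply: leq_trans (ltn_expl l (isT : 1 < 2)) _; lia.
have lnn : l * n + n <= n * n by nia.
have {}hN : var m1 1 = n by rewrite fr.1.
rewrite /= hO1 hN; split_vc.
by exists l; split=> //; rewrite ?mulSn; lia.
Qed.

Variables (L H : nat).
Hypothesis HE : H = L.+1 * n.
Hypothesis L_log : 2 ^ L <= n < 2 ^ L.+1.

Lemma tables_triple m : var m 1 = n -> var m 13 = L -> var m 14 = H ->
  (forall x, arr m 5 x = 0) -> (forall x, arr m 6 x = 0) ->
  triple base B fill_tables m (fun m' => tables n L H (arr m' 5) (arr m' 6))
    (max_time tables_init +
      (6 + L * (6 + n * (max_time tables_body + 8) + max_time tables_next + 8))).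
Proof.
move=> hN hL hH z5 z6.
apply: (@triple_then _ _ _ _ _ (fun m1 => var m1 11 = 1 /\ var m1 12 = 0)).
  by apply: vc_triple; rewrite /=; split_vc.
move=> m0 fr0 [hP hO].
have {hN hL hH}[hN hL hH] : [/\ var m0 1 = n, var m0 13 = L & var m0 14 = H] by rewrite !fr0.1.
have {}z5 x : arr m0 5 x = 0 by rewrite fr0.2.
have {}z6 x : arr m0 6 x = 0 by rewrite fr0.2.
pose Q (P : nat -> nat -> bool) m' :=
  [/\ forall j i, j < L -> 0 < i <= n -> P j i ->
        (arr m' 5 (j.+1 * n + i) = j * n + i /\
        arr m' 6 (j.+1 * n + i) = if i + 2 ^ j <= n then j * n + i + 2 ^ j else 0) /\
        (arr m' 5 (H + j * n + i) = H + j.+1 * n + i /\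
         arr m' 6 (H + j * n + i) = if 2 ^ j < i then H + j.+1 * n + i - 2 ^ j else 0),
      forall i, i <= n -> arr m' 5 i = 0 /\ arr m' 6 i = 0
    & forall i, 0 < i <= n -> arr m' 5 (H + L * n + i) = 0 /\ arr m' 6 (H + L * n + i) = 0].
have LN := log_lt L_log; have HN := mul_log_le L_log; rewrite -HE in HN.
apply: triple_weaken (leqnn _).
  apply: (@triple_for base B 5 13 _ m0 (fun j m' =>
    [/\ Q (fun j' _ => j' < j) m', var m' 11 = 2 ^ j & var m' 12 = j * n])) => //; first by lia.
    by split=> //; split=> //= *; rewrite ?z5 ?z6.
  move=> j m1 jL fr hj [Q1 hP1 hO1].
  have {hN hL hH}[hN hL hH] : [/\ var m1 1 = n, var m1 13 = L & var m1 14 = H] by rewrite !fr.1.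
  have pn := exp_log_le L_log (ltnW jL).
  have jn : j.+1 * n + n <= H by rewrite HE; nia.
  have jn' : j * n + n = j.+1 * n by rewrite mulSn addnC.
  apply: (@triple_then _ _ _ _ _ (Q (fun j' _ => j' < j.+1))).
    apply: triple_weaken (leqnn _).
      apply: (@triple_for base B 4 1 tables_body m1 (fun i m' =>
        Q (fun j' i' => (j' < j) || (j' == j) && (i' <= i)) m')) => //; first by lia.
        case: Q1 => q1 q2 q3; split=> //= j' i' jL' hi'.
        by case: ltnP => //= [/q1 h _|_]; [apply: h | lia].
      move=> i m2 im fr2 hi [q1 q2 q3]; apply: vc_triple.
      have {hN hL hH hP1 hO1}[hN [hL hH hP1 hO1]] : var m2 1 = n /\
        [/\ var m2 13 = L, var m2 14 = H, var m2 11 = 2 ^ j & var m2 12 = j * n] by rewrite !fr2.1.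
      rewrite /= hi hN hH hP1 hO1.
      have -> : j * n + (i + 1) + n = j.+1 * n + (i + 1) by lia.
      have -> : H + (j * n + (i + 1)) + n = H + j.+1 * n + (i + 1) by lia.
      have -> : H + (j * n + (i + 1)) = H + j * n + (i + 1) by lia.
      have ci := ltn0Sn i; rewrite -(addn1 i) in ci.
      split_vc.
      split=> /=.
      - move=> j' i' jL' hi' hji.
        have [[-> ->]|ne] : (j' = j /\ i' = i + 1) \/ ~ (j' = j /\ i' = i + 1) by lia.
          rewrite /update eqxx.
          have -> : (j.+1 * n + (i + 1) == H + j * n + (i + 1)) = false by lia.
          rewrite eqxx; split; split=> //.
            have -> : (i + 1 + 2 ^ j < n + 1) = (i + 1 + 2 ^ j <= n) by lia.
            by case: (_ <= n); rewrite ?mul1n ?mul0n.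
          by case: (2 ^ j < _); rewrite ?mul1n ?mul0n.
        have jn1 : j'.+1 * n + n <= H by rewrite HE; nia.
        have ne1 : (j'.+1 * n + i' == j.+1 * n + (i + 1)) = false.
          apply/eqP => e; have [] := @node_inj n j'.+1 i' j.+1 (i + 1); lia.
        have ne2 : (H + j' * n + i' == H + j * n + (i + 1)) = false.
          apply/eqP => e; have [] := @node_inj n j' i' j (i + 1); lia.
        have ne3 : (j'.+1 * n + i' == H + j * n + (i + 1)) = false by lia.
        have ne4 : (H + j' * n + i' == j.+1 * n + (i + 1)) = false by lia.
        by rewrite /update ne1 ne2 ne3 ne4; apply: q1 => //; lia.
      - move=> i' hi'; have nj : n <= j.+1 * n by lia.
        have ne1 : (i' == j.+1 * n + (i + 1)) = false by lia.
        have ne2 : (i' == H + j * n + (i + 1)) = false by lia.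
        by rewrite /update ne1 ne2; apply: q2.
      - move=> i' hi'.
        have ne1 : (H + L * n + i' == j.+1 * n + (i + 1)) = false by lia.
        have ne2 : (H + L * n + i' == H + j * n + (i + 1)) = false.
          apply/eqP => e; have [] := @node_inj n L i' j (i + 1); lia.
        by rewrite /update ne1 ne2; apply: q3.
    move=> m2 _ [q1 q2 q3]; split=> // j' i' jL' hi' hj'; apply: q1 => //; lia.
  move=> m2 fr2 Q2; apply: vc_triple.
  have {hN hL hH hP1 hO1}[hN hP1 hO1] : [/\ var m2 1 = n, var m2 11 = 2 ^ j & var m2 12 = j * n].
    by rewrite !fr2.1.
  rewrite /= hN hP1 hO1; split_vc.
  by rewrite expnS; lia.
move=> m1 fr [[q1 q2 q3] _ _]; split=> //.
- by move=> j i jL hi; have [] := q1 j i jL hi jL.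
- by move=> j i jL hi; have [] := q1 j i jL hi jL.
Qed.

End Phases.

(** * The program: rectangles *)

Notation rC := 15 (only parsing).
Notation C_ := (Var 15) (only parsing).
Notation rE := 16 (only parsing).
Notation E_ := (Var 16) (only parsing).
Notation rG := 17 (only parsing).
Notation G_ := (Var 17) (only parsing).
Notation rF := 18 (only parsing).
Notation F_ := (Var 18) (only parsing).
Notation rT := 19 (only parsing).
Notation T_ := (Var 19) (only parsing).
Notation rD := 20 (only parsing).
Notation D_ := (Var 20) (only parsing).
Notation rQ := 21 (only parsing).
Notation Q_ := (Var 21) (only parsing).

(** The largest power of two not exceeding a length is more than half of it, so the first and the
    last interval of that size cover all rows, and likewise all columns. Each of the two row nodes
    gets one cell for both column intervals, hence two cells per rectangle. If the row nodes
    coincide, the list there just gets two equal cells. *)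
Lemma push_rectangle n L H adj cl s0 s1 s2 t a c e jr jc :
  0 < n -> H = L.+1 * n -> graph_ok n L H adj cl s0 s1 s2 ->
  0 < t <= a -> a <= n -> 0 < c <= e -> e <= n -> jr <= L -> jc <= L ->
  2 ^ jr <= a + 1 - t < 2 ^ jr.+1 -> 2 ^ jc <= e + 1 - c < 2 ^ jc.+1 ->
  (forall x y, t <= x <= a -> c <= y <= e -> adj x y) ->
  let U := H + jr * n + t in let V := H + jr * n + a + 1 - 2 ^ jr in
  let D1 := jc * n + c in let D2 := jc * n + e + 1 - 2 ^ jc in
  let s0' := update (update s0 cl.+1 D1) cl.+2 D1 in
  let s1' := update (update s1 cl.+1 D2) cl.+2 D2 in
  let s2' := update (update s2 cl.+1 (s2 U)) U cl.+1 in
  let s2'' := update (update s2' cl.+2 (s2' V)) V cl.+2 in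
  [/\ graph_ok n L H adj cl.+2 s0' s1' s2'',
      forall y z, y <= cl -> reach s0 s1 s2 y z -> reach s0' s1' s2'' y z
    & forall x y, t <= x <= a -> c <= y <= e -> reach s0' s1' s2'' (H + x) y].
Proof.
move=> n0 HE G ht han hc hen hjr hjc lr lc adjs U V D1 D2 s0' s1' s2' s2''.
have pr : 0 < 2 ^ jr by rewrite expn_gt0.
have pc : 0 < 2 ^ jc by rewrite expn_gt0.
rewrite expnS in lr; rewrite expnS in lc.
have VE : V = H + jr * n + (a + 1 - 2 ^ jr) by rewrite /V; lia.
have D2E : D2 = jc * n + (e + 1 - 2 ^ jc) by rewrite /D2; lia.
have D1H : D1 <= H by apply: (node_le n0 HE) => //; lia.
have D2H : D2 <= H by rewrite D2E; apply: (node_le n0 HE) => //; lia.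
have cols x : t <= x <= a -> complete_cols n L adj x D1 /\ complete_cols n L adj x D2.
  move=> hx; split.
    by exists jc, c; split=> //; [lia | move=> b hb bn; apply: adjs => //; lia].
  exists jc, (e + 1 - 2 ^ jc); split=> //; first by lia.
  by move=> b hb bn; apply: adjs => //; lia.
have h1 : 0 < t <= n by lia.
have h2 : 0 < a + 1 - 2 ^ jr <= n by lia.
have [|G1 mono1 new1] := push_cell n0 HE G hjr h1 D1H D2H.
  by move=> x hx; apply: cols; lia.
have [|G2 mono2 new2] := push_cell n0 HE G1 hjr h2 D1H D2H.
  by move=> x hx; apply: cols; lia.
rewrite -VE -/U in G1 mono1 new1 G2 mono2 new2.
have base : 2 * H <= cl by case: G => _ [lo [hi C]]; apply: cell_base C.
have nH := n_le_H n0 HE.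
split=> //.
  by move=> y z ycl r; apply: mono2; [lia | apply: mono1].
move=> x y hx hy.
have [k [hk hyk hD]] : exists k, [/\ 0 < k, k <= y < k + 2 ^ jc
    & D1 = jc * n + k \/ D2 = jc * n + k].
  have [lt|ge] := ltnP y (c + 2 ^ jc); first by exists c; split; [lia | lia | left].
  by exists (e + 1 - 2 ^ jc); split; [lia | lia | right].
have [lt|ge] := ltnP x (t + 2 ^ jr).
  apply: mono2; first by lia.
  by apply: (new1 x jc k y hjc hk hD) => //; lia.
by apply: (new2 x jc k y hjc hk hD) => //; lia.
Qed.

Definition run_exp (a : aexp) : aexp :=
  (Get 3 (a * W_ + K_) * (Get 3 (a * W_ + J_) == 0))%aexp.

Definition scan_body : acmd :=
  rA <- I_ + 1 ;; rK <- J_ + 1 ;;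
  rE <- run_exp A_ ;; rG <- run_exp I_ ;; rF <- run_exp (Plus A_ 1) ;;
  If E_ == G_ do Pass else Put 4 K_ A_.

Definition add_cell (r : nat) : acmd :=
  rC <- C_ + 1 ;; Put 5 C_ D_ ;; Put 6 C_ Q_ ;; Put 7 C_ (Get 7 (Var r)) ;;
  Put 7 (Var r) C_.

Definition emit_prep : acmd :=
  rT <- Get 4 K_ ;;
  rX <- A_ + 1 - T_ ;; rO <- H_ + Get 9 X_ ;;
  rU <- O_ + T_ ;; rV <- O_ + A_ + 1 - Get 8 X_ ;;
  rX <- E_ + 1 - K_ ;; rO <- Get 9 X_ ;;
  rD <- O_ + K_ ;; rQ <- O_ + E_ + 1 - Get 8 X_.

Definition emit_body : acmd := emit_prep ;; add_cell rU ;; add_cell rV.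

Definition rect_body : acmd :=
  scan_body ;;
  If E_ == 0 do Pass else (If E_ == F_ do Pass else emit_body).

Definition find_rects : acmd :=
  rC <- H_ + H_ ;; For rI rN (For rJ rN rect_body).

Section Phases.
Variables (n root : nat) (u v : nat -> nat) (g : rel nat) (base B L H : nat).
Hypothesis CS : contraction_seq n root u v.
Hypothesis baseE : base = 2 * (n * n) + 2.
Hypothesis BE : B = 100 * (n * n).
Hypothesis HE : H = L.+1 * n.
Hypothesis L_log : 2 ^ L <= n < 2 ^ L.+1.

Let n_gt0 : 0 < n := contraction_gt0 CS.
Let nn : n <= n * n. Proof. by nia. Qed.
Let HN : H <= n * n. Proof. by rewrite HE mul_log_le. Qed.

Local Notation adj := (adj n root u v g).
Local Notation run := (run n root u v g).
Local Notation run_end := (run_end n root u v g).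
Local Notation emits := (emits n root u v g).

Lemma run_le a c : run a c <= n.
Proof.
rewrite /run; have := run_end_le CS g a c.
by case: (_ == _); rewrite ?muln1 ?muln0.
Qed.

Lemma run_out a c : ~~ pos_ok n a -> run a c = 0.
Proof. by move=> h; rewrite /run (run_end_out _ _ _ _) ?h. Qed.

Lemma scan_triple m i j : i < n -> j < n -> sizes n m -> var m 4 = i -> var m 5 = j ->
  runs_ok n root u v g m ->
  triple base B scan_body m (fun m' =>
    [/\ var m' 9 = i.+1, var m' 10 = j.+1, var m' 16 = run i.+1 j.+1,
        var m' 18 = run i.+2 j.+1
      & arr m' 4 = if run i.+1 j.+1 == run i j.+1 then arr m 4
                   else update (arr m 4) j.+1 i.+1])
    (max_time scan_body).
Proof.
move=> im jm [hN hW hM] hi hj R; apply: vc_triple.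
rewrite /= hi hj hW !addn1.
have rE a : a <= n.+1 ->
  arr m 3 (a * (n + 2) + j.+1) * (arr m 3 (a * (n + 2) + j) == 0) = run a j.+1.
  by move=> an; rewrite !R //; lia.
have le3 a x : a <= n.+1 -> x <= n + 2 -> a * (n + 2) + x <= B /\ a * (n + 2) <= B.
  by move=> an xn; have := entry_bound n_gt0 an xn; lia.
have r0 := run_le i j.+1; have r1 := run_le i.+1 j.+1; have r2 := run_le i.+2 j.+1.
have [l0 l0'] := le3 i j.+1 ltac:(lia) ltac:(lia).
have [l1 l1'] := le3 i.+1 j.+1 ltac:(lia) ltac:(lia).
have [l2 l2'] := le3 i.+2 j.+1 ltac:(lia) ltac:(lia).
rewrite !rE; try lia.
split_vc.
- by move=> /eqP; rewrite eqb0 negbK => ->.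
- by move=> /eqP; rewrite eqb0 => /negbTE ->; split_vc.
Qed.

(** [t] is the first row of the stretch of equal runs at column [c] that ends in row [r]. The value
    0 is allowed because array 4 starts with zeros and row 0 carries no runs. *)
Definition top_ok t c r := [/\ t <= r, forall z, t <= z <= r -> run z c = run r c
  & t = 0 \/ run t.-1 c <> run r c].

(** [P] selects the run ends treated so far; [x] is any row from which the run continues unchanged
    down to row [a]. *)
Definition covered (P : nat -> nat -> bool) s0 s1 s2 := forall a c x y,
  0 < a <= n -> 0 < c <= n -> P a c -> emits a c -> 0 < x <= a ->
  (forall z, x <= z <= a -> run z c = run a c) -> c <= y <= run a c ->
  reach s0 s1 s2 (H + x) y.

Definition before i j a c := (a <= i) || (a == i.+1) && (c <= j).

Definition emitted i j :=
  \sum_(1 <= a < i.+1) \sum_(1 <= c < n.+1) emits a c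
  + \sum_(1 <= c < j.+1) emits i.+1 c.

(** The cells are counted exactly by the rectangles emitted, for the running time, and bounded by
    the matrix positions visited, so that node numbers stay within [4 * n ^ 2] whatever the width
    is. *)
Definition rect_inv i j m :=
  [/\ graph_ok n L H adj (var m 15) (arr m 5) (arr m 6) (arr m 7),
      var m 15 = 2 * H + 2 * emitted i j, var m 15 <= 2 * H + 2 * (i * n + j),
      covered (before i j) (arr m 5) (arr m 6) (arr m 7)
    & forall c, 0 < c <= n -> top_ok (arr m 4 c) c (if c <= j then i.+1 else i)].

Lemma emittedS i j : emitted i j.+1 = emitted i j + emits i.+1 j.+1.
Proof. by rewrite /emitted [X in _ + X]big_nat_recr //= addnA. Qed.

Lemma coveredS i j s0 s1 s2 s0' s1' s2' : covered (before i j) s0 s1 s2 ->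
  (forall x y, x <= n -> reach s0 s1 s2 (H + x) y -> reach s0' s1' s2' (H + x) y) ->
  (emits i.+1 j.+1 -> forall x y, 0 < x <= i.+1 ->
     (forall z, x <= z <= i.+1 -> run z j.+1 = run i.+1 j.+1) ->
     j.+1 <= y <= run i.+1 j.+1 -> reach s0' s1' s2' (H + x) y) ->
  covered (before i j.+1) s0' s1' s2'.
Proof.
move=> cov mono new a c x y ha hc bef em hx hz hy.
have [[ea ec]|ne] : (a = i.+1 /\ c = j.+1) \/ ~ (a = i.+1 /\ c = j.+1) by lia.
  by rewrite ea ec in em hx hz hy; apply: new.
apply: mono; first by lia.
by apply: (cov a c) => //; move: bef; rewrite /before; lia.
Qed.

Lemma top_okS i j m4 : (forall c, 0 < c <= n -> top_ok (m4 c) c (if c <= j then i.+1 else i)) ->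
  j < n -> forall c, 0 < c <= n ->
  top_ok ((if run i.+1 j.+1 == run i j.+1 then m4 else update m4 j.+1 i.+1) c) c
    (if c <= j.+1 then i.+1 else i).
Proof.
move=> tok jn c hc; have [->|ne] := eqVneq c j.+1; last first.
  have -> : (c <= j.+1) = (c <= j) by lia.
  by case: ifP => _; rewrite ?/update ?(negbTE ne); apply: tok.
have [|t1 t2 t3] := tok j.+1; first by lia.
rewrite ltnn in t1 t2 t3; rewrite leqnn; case: eqP => e.
  split; [lia | | by rewrite e].
  move=> z hz; have [->//|nz] := eqVneq z i.+1.
  by rewrite e; apply: t2; lia.
rewrite /update eqxx; split=> //; last by right => /= /esym.
by move=> z hz; have -> : z = i.+1 by lia.
Qed.

Lemma rect_triple m i j : i < n -> j < n -> sizes n m -> var m 4 = i -> var m 5 = j ->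
  var m 14 = H -> runs_ok n root u v g m -> logs_ok n L m -> rect_inv i j m ->
  triple base B rect_body m (rect_inv i j.+1) (max_time rect_body).
Proof.
move=> im jm sz hi hj hH R lg [G cE cB cov tok].
apply: triple_then (scan_triple im jm sz hi hj R) _.
move=> m1 fr [h9 h10 h16 h18 h4].
have h14 : var m1 14 = H by rewrite fr.1.
have h15 : var m1 15 = var m 15 by rewrite fr.1.
have h5 : arr m1 5 = arr m 5 by rewrite fr.2.
have h6 : arr m1 6 = arr m 6 by rewrite fr.2.
have h7 : arr m1 7 = arr m 7 by rewrite fr.2.
have {}lg : logs_ok n L m1 by rewrite /logs_ok !fr.2.
have tok' := top_okS tok jm; rewrite -h4 in tok'.
have inn : i * n + j < n * n by nia.
set r := run i.+1 j.+1 in h16 *; set cl := var m 15 in G cE cB h15 *.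
have skip : ~~ emits i.+1 j.+1 -> rect_inv i j.+1 m1.
  move=> ne; rewrite /rect_inv h15 -/cl h5 h6 h7; split=> //.
  - by rewrite emittedS (negbTE ne) addn0.
  - by lia.
  - by apply: coveredS cov _ _ => // em; rewrite em in ne.
apply: triple_cond => /=; rewrite ?h16 ?h18; first by split_vc.
  move=> /eqP; rewrite eqb0 negbK => /eqP r0; apply: vc_triple.
  by apply: skip; rewrite /emits -/r r0.
move=> /eqP; rewrite eqb0 => r0; apply: triple_cond => /=; rewrite ?h16 ?h18; first by split_vc.
  move=> /eqP; rewrite eqb0 negbK => /eqP er; apply: vc_triple.
  by apply: skip; rewrite /emits -/r er eqxx andbF.
move=> /eqP; rewrite eqb0 => ner.
have em : emits i.+1 j.+1 by rewrite /emits r0 eq_sym.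
have rpos : 0 < r by lia.
have [hr ones _ _] := (runP CS g i.+1 j.+1 rpos).1 erefl.
have [|t1 t2 t3] := tok' j.+1; first by lia.
rewrite leqnn in t1 t2 t3; set t := arr m1 4 j.+1 in t1 t2 t3.
(* Row 0 lies outside the matrix and has no run, so the stretch cannot include it. *)
have tpos : 0 < t.
  rewrite lt0n; apply/eqP => t0; have := t2 0; rewrite run_out //.
  by rewrite t0 -/r => /(_ ltac:(lia)); lia.
have [|jr [hjr lr e8 e9]] := lg (i.+1 + 1 - t); first by lia.
have [|jc [hjc lc e8' e9']] := lg (r + 1 - j.+1); first by lia.
have adjs x y : t <= x <= i.+1 -> j.+1 <= y <= r -> adj x y.
  move=> hx hy; have ex := t2 x hx.
  by have [_ h _ _] := (runP CS g x j.+1 rpos).1 ex; apply: h.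
have [] := push_rectangle n_gt0 HE G (t := t) (a := i.+1) (c := j.+1) (e := r)
  (jr := jr) (jc := jc) ltac:(lia) ltac:(lia) ltac:(lia) ltac:(lia) hjr hjc lr lc adjs.
move=> G' mono new.
have jrn : jr * n + n <= H by rewrite HE -mulSnr leq_mul2r ltnS hjr orbT.
have jcn : jc * n + n <= H by rewrite HE -mulSnr leq_mul2r ltnS hjc orbT.
have pr : 2 ^ jr <= n := exp_log_le L_log hjr.
have pc : 2 ^ jc <= n := exp_log_le L_log hjc.
have clH : 2 * H <= cl by case: G => _ [lo [hi' C]]; apply: cell_base C.
set U := H + jr * n + t in G' mono new.
set V := H + jr * n + i.+1 + 1 - 2 ^ jr in G' mono new.
set D1 := jc * n + j.+1 in G' mono new.
set D2 := jc * n + r + 1 - 2 ^ jc in G' mono new.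
apply: (@triple_then _ _ _ _ _ (fun m2 =>
  [/\ var m2 7 = U, var m2 8 = V, var m2 20 = D1 & var m2 21 = D2])).
  apply: vc_triple.
  apply: (vc_upd (x := t)); [by rewrite /= ?h10; split_vc | by rewrite /= ?h10 |].
  apply: (vc_upd (x := i.+1 + 1 - t)); [by rewrite /= ?h9; split_vc | by rewrite /= ?h9 |].
  apply: (vc_upd (x := H + jr * n)); [by rewrite /= ?h14 ?e9; split_vc | by rewrite /= ?h14 ?e9 |].
  apply: (vc_upd (x := U)); [by rewrite /=; split_vc | by rewrite /= |].
  apply: (vc_upd (x := V)); [by rewrite /= ?h9 ?e8; split_vc | by rewrite /= ?h9 ?e8 |].
  apply: (vc_upd (x := r + 1 - j.+1)); [by rewrite /= ?h16 ?h10; split_vc | by rewrite /= ?h16 ?h10 |].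
  apply: (vc_upd (x := jc * n)); [by rewrite /= ?e9'; split_vc | by rewrite /= ?e9' |].
  apply: (vc_upd (x := D1)); [by rewrite /= ?h10; split_vc | by rewrite /= ?h10 |].
  by rewrite /= ?h16 ?e8'; split_vc.
move=> m2 fr2 [k7 k8 k20 k21].
have k15 : var m2 15 = cl by rewrite fr2.1.
have k4 : arr m2 4 = arr m1 4 by rewrite fr2.2.
have k5 : arr m2 5 = arr m 5 by rewrite fr2.2.
have k6 : arr m2 6 = arr m 6 by rewrite fr2.2.
have k77 : arr m2 7 = arr m 7 by rewrite fr2.2.
have UB : U <= 3 * (n * n) by rewrite /U; lia.
have VB : V <= 3 * (n * n) by rewrite /V; lia.
apply: vc_triple; rewrite /= k7 k8 k15 k20 k21 ?k5 ?k6 ?k77.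
split_vc.
rewrite /rect_inv /= (addn1 cl) (addn1 cl.+1) k4 k5 k6 k77; split.
- exact: G'.
- by rewrite emittedS em; lia.
- by lia.
- apply: coveredS cov _ _.
    by move=> x y xn; apply: mono; have := n_le_H n_gt0 HE; lia.
  move=> _ x y hx hz hy; apply: new => //.
  case: t3 => [|t3]; first by lia.
  suff : ~ x < t by lia.
  by move=> lt; apply: t3; apply: hz; lia.
- exact: tok'.
Qed.

Lemma rects_triple m : sizes n m -> var m 14 = H ->
  runs_ok n root u v g m -> logs_ok n L m ->
  tables n L H (arr m 5) (arr m 6) -> (forall x, arr m 4 x = 0) ->
  (forall x, arr m 7 x = 0) ->
  triple base B find_rects m (fun m' =>
    [/\ graph_ok n L H adj (var m' 15) (arr m' 5) (arr m' 6) (arr m' 7),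
        var m' 15 = 2 * H + 2 * num_emits n root u v g,
        var m' 15 <= 4 * (n * n)
      & covered (fun _ _ => true) (arr m' 5) (arr m' 6) (arr m' 7)])
    (max_time (rC <- H_ + H_) + (6 + n * (6 + n * (max_time rect_body + 8) + 8))).
Proof.
move=> sz hH R lg tab z4 z7.
apply: (@triple_then _ _ _ _ _ (fun m1 => var m1 15 = 2 * H)).
  by apply: vc_triple; rewrite /= hH; split_vc.
move=> m0 fr0 h15.
have {}sz : sizes n m0 by apply: sizes_frame fr0 sz.
have {}hH : var m0 14 = H by rewrite fr0.1.
have {}R : runs_ok n root u v g m0 by rewrite /runs_ok fr0.2.
have {}lg : logs_ok n L m0 by rewrite /logs_ok !fr0.2.
have {}tab : tables n L H (arr m0 5) (arr m0 6) by rewrite !fr0.2.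
have {}z4 x : arr m0 4 x = 0 by rewrite fr0.2.
have {}z7 x : arr m0 7 x = 0 by rewrite fr0.2.
have hN : var m0 1 = n by case: sz.
have nextrow i m1 : rect_inv i n m1 -> rect_inv i.+1 0 m1.
  case=> G cE cB cov tok; split=> //.
  - suff -> : emitted i.+1 0 = emitted i n by [].
    by rewrite /emitted [X in X + _]big_nat_recr //= [X in _ + X]big_geq // addn0.
  - by lia.
  - move=> a c x y ha hc bef em hx hz hy; apply: (cov a c) => //.
    by move: bef; rewrite /before; lia.
  - move=> c hc; have := tok c hc; rewrite (proj2 (andP hc)) leqn0.
    by have -> : (c == 0) = false by lia.
apply: triple_weaken (leqnn _).
  apply: (@triple_for base B 4 1 _ m0 (fun i m' => rect_inv i 0 m')) => //; first by lia.
    split=> /=; rewrite ?h15.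
    + split=> //; exists (fun=> 0), (fun=> 0); split=> //; try by move=> *; lia.
      by move=> j i _ _; left.
    + suff -> : emitted 0 0 = 0 by rewrite muln0 addn0.
      by rewrite /emitted [X in X + _]big_geq // [X in _ + X]big_geq.
    + by lia.
    + by move=> a c x y ha hc; rewrite /before; lia.
    + move=> c hc; rewrite z4; have -> : (c <= 0) = false by lia.
      by split=> //; [move=> z hz; have -> : z = 0 by lia | left].
  move=> i m1 im fr hi Q.
  have {}sz : sizes n m1 by apply: sizes_frame fr sz.
  have {}hH : var m1 14 = H by rewrite fr.1.
  have {}R : runs_ok n root u v g m1 by rewrite /runs_ok fr.2.
  have {}lg : logs_ok n L m1 by rewrite /logs_ok !fr.2.
  have {}hN : var m1 1 = n by case: sz.
  apply: triple_weaken (leqnn _).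
    apply: (@triple_for base B 5 1 _ m1 (fun j m' => rect_inv i j m')) => //; first by lia.
    move=> j m2 jm fr2 hj Q2; apply: rect_triple => //.
    + by apply: sizes_frame fr2 sz.
    + by rewrite fr2.1.
    + by rewrite fr2.1.
    + by rewrite /runs_ok fr2.2.
    + by rewrite /logs_ok !fr2.2.
  by move=> m2 _ /nextrow.
move=> m' _ [G cE cB cov _]; split=> //.
- suff -> : num_emits n root u v g = emitted n 0 by [].
  by rewrite /emitted [X in _ = _ + X]big_geq // addn0.
- by move: HN cB; rewrite addn0; lia.
- move=> a c x y ha hc _; apply: cov => //; rewrite /before; lia.
Qed.

(** The maximal run through [b] in row [a] persists to some last row [k], as row [n.+1] has no runs;
    there the rectangle that contains the entry is emitted. *)
Lemma covered_adj s0 s1 s2 a b : covered (fun _ _ => true) s0 s1 s2 ->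
  adj a b -> reach s0 s1 s2 (H + a) b.
Proof.
move=> cov ab; have /and3P[aok bok _] := ab.
have [c [hc hr]] : exists c, 0 < c <= b /\ b <= run a c.
  elim: b {bok} ab => [|b IH] ab; first by case/and3P: ab.
  have [ab'|nab'] := boolP (adj a b).
    have [c [hc hr]] := IH ab'; exists c; split; first by lia.
    have rpos : 0 < run a c by lia.
    have [h1 h2 h3 h4] := (runP CS g a c rpos).1 erefl.
    have [//|lt] := leqP b.+1 (run a c).
    by case/negP: h4; have -> : run a c = b by lia.
  exists b.+1; split; first by lia.
  have [h1 h2 h3] := run_endP CS ab.
  by rewrite /run /= (run_end_eq0 CS) nab' muln1; lia.
have rpos : 0 < run a c by lia.
have [rc _ _ _] := (runP CS g a c rpos).1 erefl.
have an : 0 < a <= n by [].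
have ex : exists k, (a <= k) && (run k.+1 c != run a c).
  by exists n; rewrite run_out /pos_ok; lia.
case: (ex_minnP ex) => k /andP[ak nek] kmin.
have same z : a <= z <= k -> run z c = run a c.
  move=> hz; have [->//|ne] := eqVneq z a; apply/eqP; apply/negPn/negP => nz.
  by have := kmin z.-1; rewrite prednK ?nz; lia.
have kn : k <= n by apply: kmin; rewrite run_out /pos_ok; lia.
apply: (cov k c) => //; try lia.
- by rewrite /emits same; lia.
- by move=> z hz; rewrite !same //; lia.
- by rewrite same; lia.
Qed.

End Phases.

(** * The program: breadth-first searches *)

Notation rS := 22 (only parsing).
Notation S_ := (Var 22) (only parsing).
Notation rHd := 23 (only parsing).
Notation Hd_ := (Var 23) (only parsing).
Notation rTl := 24 (only parsing).
Notation Tl_ := (Var 24) (only parsing).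
Notation rSp := 25 (only parsing).
Notation Sp_ := (Var 25) (only parsing).
Notation rR := 26 (only parsing).
Notation R_ := (Var 26) (only parsing).
Notation rY := 27 (only parsing).
Notation Y_ := (Var 27) (only parsing).
Notation rLim := 28 (only parsing).

(** A mark is the number of the source whose search set it last, so the marks need no clearing
    between searches. Node 0 is marked at the start of each search and thus never pushed. *)
Definition push_cmd : acmd :=
  If Get 10 Y_ == S_ do Pass
  else (Put 10 Y_ S_ ;; Put 11 Sp_ Y_ ;; rSp <- Sp_ + 1).

Definition pop_cmd : acmd := rSp <- Sp_ - 1 ;; rX <- Get 11 Sp_.

Definition discover_cmd : acmd :=
  If N_ < X_ do Pass
  else (If Get 13 (S_ * W_ + X_) do Pass
        else (Put 13 (S_ * W_ + X_) (R_ + 1) ;; Put 12 Tl_ X_ ;; rTl <- Tl_ + 1)).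

Definition expand_cmd : acmd :=
  pop_cmd ;; discover_cmd ;;
  rY <- Get 5 X_ ;; push_cmd ;; rY <- Get 6 X_ ;; push_cmd ;;
  rY <- Get 7 X_ ;; push_cmd.

Definition dequeue_cmd : acmd :=
  rY <- Get 12 Hd_ ;; rHd <- Hd_ + 1 ;; rR <- Get 13 (S_ * W_ + Y_) ;;
  rY <- H_ + Y_.

Definition bfs_body : acmd :=
  If 0 < Sp_ do expand_cmd
  else (If Hd_ < Tl_ do (dequeue_cmd ;; push_cmd) else Pass).

Definition bfs_start : acmd :=
  rS <- I_ + 1 ;; Put 10 0 S_ ;; Put 13 (S_ * W_ + S_) 1 ;; Put 12 0 S_ ;;
  rHd <- 0 ;; rTl <- 1 ;; rSp <- 0 ;; rR <- 0.

Definition all_bfs : acmd :=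
  rLim <- C_ + N_ ;; For rI rN (bfs_start ;; For rJ rLim bfs_body).

(** A coarse bound on labels by the number of steps, enough to keep them within the word size. *)
Lemma bfs_step_label n H s0 s1 s2 b M :
  (forall q, label b q <= M) -> current b <= M ->
  (forall q, label (bfs_step n H s0 s1 s2 b) q <= M.+1) /\
  current (bfs_step n H s0 s1 s2 b) <= M.+1.
Proof.
have pl x c : label (push x c) = label c /\ current (push x c) = current c.
  by rewrite /push; case: ifP.
move=> hl hc; rewrite /bfs_step; case: (stack b) => [|h t].
  case: ifP => _; last by split=> [q|]; apply: leqW.
  by have [-> ->] := pl (H + nth 0 (queue b) (head b)) (dequeue b); split=> [q|] /=; apply: leqW.
have [-> ->] := pl (s2 h) (push (s1 h) (push (s0 h) (discover n h (pop t b)))).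
have [-> ->] := pl (s1 h) (push (s0 h) (discover n h (pop t b))).
have [-> ->] := pl (s0 h) (discover n h (pop t b)).
rewrite /discover; case: ifP => _ /=; split=> [q|]; try exact: leqW.
by rewrite /update; case: eqP => // _; apply: leqW.
Qed.

Section Bfs.
Variables (n base B H NN s : nat) (s0 s1 s2 D0 : nat -> nat) (adj : rel nat).
Hypothesis n_gt0 : 0 < n.
Hypothesis baseE : base = 2 * (n * n) + 2.
Hypothesis BE : B = 100 * (n * n).
Hypothesis NN_le : NN <= 4 * (n * n).
Hypothesis s_pos : 0 < s <= n.
Hypothesis n_le_H : n <= H.
Hypothesis H_le : H + n <= NN.
Hypothesis succ_le : forall x, x <= NN -> [/\ s0 x <= NN, s1 x <= NN & s2 x <= NN].

Let nn : n <= n * n. Proof. by nia. Qed.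

(** [D0] is the label array before the search; only the row of [s] may differ from it. The bottom of
    the stack is at index 0, hence the [rev]. By [rel_mark_le] all marks are stale for the next
    source. *)
Record bfs_rel (m : astate) (b : bfs_state) : Prop := BfsRel {
  rel_s : var m 22 = s;
  rel_head : var m 23 = head b;
  rel_tail : var m 24 = size (queue b);
  rel_sp : var m 25 = size (stack b);
  rel_cur : var m 26 = current b;
  rel_label : forall q, 0 < q <= n -> arr m 13 (s * (n + 2) + q) = label b q;
  rel_rest : forall t, (forall q, 0 < q <= n -> t <> s * (n + 2) + q) -> arr m 13 t = D0 t;
  rel_queue : forall k, k < size (queue b) -> arr m 12 k = nth 0 (queue b) k;
  rel_stack : forall k, k < size (stack b) -> arr m 11 k = nth 0 (rev (stack b)) k;
  rel_mark : forall x, x <= NN -> (arr m 10 x == s) = (x \in 0 :: marked b);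
  rel_mark_le : forall x, arr m 10 x <= s }.

Definition static m := [/\ sizes n m, var m 14 = H, arr m 5 = s0, arr m 6 = s1 & arr m 7 = s2].

Lemma static_frame c m m1 :
  [&& 1 \notin var_mod c, 2 \notin var_mod c, 3 \notin var_mod c, 14 \notin var_mod c,
      5 \notin arr_mod c, 6 \notin arr_mod c & 7 \notin arr_mod c] ->
  frame c m m1 -> static m -> static m1.
Proof.
case/and5P=> h1 h2 h3 h4 /and3P[h5 h6 h7] fr [sz e1 e2 e3 e4].
split; rewrite ?fr.1 ?fr.2 //; apply: sizes_frame fr sz.
by rewrite h1 h2 h3.
Qed.

Lemma push_triple m b x : bfs_rel m b -> var m 27 = x -> x <= NN ->
  size (stack b) < B ->
  triple base B push_cmd m (fun m' => bfs_rel m' (push x b)) (max_time push_cmd).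
Proof.
move=> R hx xN sB; apply: vc_triple; have mk := rel_mark R xN.
rewrite /= hx (rel_s R) mk /push; case: ifP => xm.
  by split_vc.
have hsp := rel_sp R.
split; [by split_vc | by [] | move=> _; split_vc].
split=> //=; rewrite ?(rel_s R) ?(rel_sp R) ?addn1 //.
- exact: rel_head R.
- exact: rel_tail R.
- exact: rel_cur R.
- exact: rel_label R.
- exact: rel_rest R.
- exact: rel_queue R.
- move=> k hk; rewrite rev_cons nth_rcons size_rev /update.
  case: eqP => [->|ne]; first by rewrite ltnn.
  have lt : k < size (stack b) by lia.
  by rewrite lt; apply: (rel_stack R).
- move=> y yN; rewrite /update !in_cons.
  have [->|ne] := eqVneq y x; first by rewrite eqxx orbT.
  by rewrite (rel_mark R yN) in_cons.
- by move=> y; rewrite /update; case: eqP => // _; apply: rel_mark_le R y.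
Qed.

Lemma pop_triple m b h t : bfs_rel m b -> stack b = h :: t -> size t < B ->
  triple base B pop_cmd m (fun m' => bfs_rel m' (pop t b) /\ var m' 6 = h)
    (max_time pop_cmd).
Proof.
move=> R sE tB; apply: vc_triple; rewrite /= (rel_sp R) sE /=.
have top : arr m 11 (size t) = h.
  by rewrite (rel_stack R) sE //= rev_cons nth_rcons size_rev ltnn eqxx.
rewrite subn1 /= top; split_vc.
split=> //=; [exact: rel_s R | exact: rel_head R | exact: rel_tail R
  | exact: rel_cur R | exact: rel_label R | exact: rel_rest R | exact: rel_queue R |
  | exact: rel_mark R | exact: rel_mark_le R].
move=> k kt; rewrite (rel_stack R) sE /=; last by lia.
by rewrite rev_cons nth_rcons size_rev kt.
Qed.

Lemma discover_triple m b h : static m -> bfs_rel m b -> var m 6 = h -> 0 < h <= NN ->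
  current b < B -> size (queue b) < B ->
  triple base B discover_cmd m (fun m' => bfs_rel m' (discover n h b))
    (max_time discover_cmd).
Proof.
move=> [[hN hW hM] hH _ _ _] R hX hpos cB qB; apply: vc_triple.
rewrite /= hX hN hW (rel_s R) (rel_cur R) (rel_tail R) /discover.
have [hn|nh] /= := leqP h n; last by split_vc.
have hlab : arr m 13 (s * (n + 2) + h) = label b h by apply: (rel_label R); lia.
have cb := @entry_bound n s h n_gt0 ltac:(lia) ltac:(lia).
rewrite hlab; split; [by split_vc | by [] | move=> _].
split; [by split_vc | by case: eqP | ].
- move=> ->; rewrite eqxx; split_vc.
  split=> //=; rewrite ?size_rcons ?addn1 ?(rel_s R) //.
  + exact: rel_head R.
  + exact: rel_sp R.
  + exact: rel_cur R.
  + move=> q hq; rewrite /update eqn_add2l; case: eqP => // _; exact: rel_label R _ hq.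
  + move=> y hy; rewrite /update; case: eqP => [e|_]; last exact: rel_rest R _ hy.
    by case: (hy h) => //; lia.
  + move=> k hk; rewrite nth_rcons /update.
    case: eqP => [->|ne]; first by rewrite ltnn.
    have lt : k < size (queue b) by lia.
    by rewrite lt; apply: (rel_queue R).
  + exact: rel_stack R.
  + exact: rel_mark R.
  + exact: rel_mark_le R.
Qed.

Lemma rel_frame c m m1 b : frame c m m1 ->
  [&& 22 \notin var_mod c, 23 \notin var_mod c, 24 \notin var_mod c,
      25 \notin var_mod c, 26 \notin var_mod c, 10 \notin arr_mod c,
      11 \notin arr_mod c, 12 \notin arr_mod c & 13 \notin arr_mod c] ->
  bfs_rel m b -> bfs_rel m1 b.
Proof.
case=> fv fa /and5P[h1 h2 h3 h4 /and5P[h5 h6 h7 h8 h9]] [r1 r2 r3 r4 r5 r6 r7 r8 r9 r10 r11].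
by split; rewrite ?fv ?fa.
Qed.

Lemma expand_triple m b h t : static m -> bfs_rel m b -> stack b = h :: t ->
  0 < h <= NN -> current b < B -> size (queue b) < B -> size t + 2 < B ->
  triple base B expand_cmd m
    (fun m' => bfs_rel m' (push (s2 h) (push (s1 h) (push (s0 h) (discover n h (pop t b))))))
    (max_time expand_cmd).
Proof.
move=> st R sE hpos cB qB tB.
have /andP[_ /succ_le[l0 l1 l2]] := hpos.
have szd c : stack (discover n h c) = stack c by rewrite /discover; case: ifP.
have szp x c : size (stack (push x c)) <= (size (stack c)).+1.
  by rewrite /push; case: ifP => // _; apply: leqnSn.
have sb0 : size (stack (discover n h (pop t b))) = size t by rewrite szd.
have := szp (s0 h) (discover n h (pop t b)); rewrite sb0 => sb1.
have := szp (s1 h) (push (s0 h) (discover n h (pop t b))) => sb2.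
have hB : h <= B by lia.
apply: triple_then (pop_triple R sE _) _; first by lia.
move=> m1 fr1 [R1 x1]; have {st fr1}st1 : static m1 by apply: static_frame fr1 st.
apply: triple_then (discover_triple st1 R1 x1 hpos _ _) _ => //.
move=> m2 fr2 R2; have x2 : var m2 6 = h by rewrite fr2.1.
have {st1 fr2}st2 : static m2 by apply: static_frame fr2 st1.
have [_ _ e5 e6 e7] := st2.
apply: (@triple_then _ _ _ _ _ (fun m' => var m' 27 = s0 h)).
  by apply: vc_triple; rewrite /= x2 e5; split_vc.
move=> m3 fr3 y3; have x3 : var m3 6 = h by rewrite fr3.1.
have R3 := rel_frame fr3 isT R2.
have {e5 e6 e7 fr3}[e6 e7] : arr m3 6 = s1 /\ arr m3 7 = s2 by rewrite !fr3.2.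
apply: triple_then (push_triple R3 y3 l0 _) _; first by lia.
move=> m4 fr4 R4; have x4 : var m4 6 = h by rewrite fr4.1.
have {e6 e7 fr4}[e6 e7] : arr m4 6 = s1 /\ arr m4 7 = s2 by rewrite !fr4.2.
apply: (@triple_then _ _ _ _ _ (fun m' => var m' 27 = s1 h)).
  by apply: vc_triple; rewrite /= x4 e6; split_vc.
move=> m5 fr5 y5; have x5 : var m5 6 = h by rewrite fr5.1.
have R5 := rel_frame fr5 isT R4.
have {}e7 : arr m5 7 = s2 by rewrite !fr5.2.
apply: triple_then (push_triple R5 y5 l1 _) _; first by lia.
move=> m6 fr6 R6; have x6 : var m6 6 = h by rewrite fr6.1.
have {}e7 : arr m6 7 = s2 by rewrite !fr6.2.
apply: (@triple_then _ _ _ _ _ (fun m' => var m' 27 = s2 h)).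
  by apply: vc_triple; rewrite /= x6 e7; split_vc.
move=> m7 fr7 y7; have R7 := rel_frame fr7 isT R6.
by apply: push_triple R7 y7 l2 _; lia.
Qed.

Lemma dequeue_triple m b : static m -> bfs_rel m b -> stack b = [::] ->
  head b < size (queue b) -> size (queue b) <= n ->
  0 < nth 0 (queue b) (head b) <= n ->
  triple base B (dequeue_cmd ;; push_cmd) m
    (fun m' => bfs_rel m' (push (H + nth 0 (queue b) (head b)) (dequeue b)))
    (max_time (dequeue_cmd ;; push_cmd)).
Proof.
move=> [[hN hW hM] hH _ _ _] R sE hq qn apos; set a := nth 0 (queue b) (head b).
apply: (@triple_then _ _ _ _ _ (fun m' => bfs_rel m' (dequeue b) /\ var m' 27 = H + a)).
  have cb := @entry_bound n s a n_gt0 ltac:(lia) ltac:(lia).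
  apply: vc_triple; rewrite /= (rel_head R) (rel_queue R) // -/a (rel_s R) hW hH.
  rewrite (rel_label R) //; split_vc.
  split=> //=; rewrite ?addn1 //; [exact: rel_s R | exact: rel_tail R
  | exact: rel_sp R | exact: rel_label R | exact: rel_rest R | exact: rel_queue R
  | exact: rel_stack R | exact: rel_mark R | exact: rel_mark_le R].
by move=> m1 fr1 [R1 y1]; apply: push_triple R1 y1 _ _; rewrite /= ?sE /=; lia.
Qed.

Lemma bfs_body_triple m b it : static m -> bfs_rel m b ->
  bfs_inv n H NN s s0 s1 s2 adj b -> bfs_count it b -> it <= NN + n ->
  (forall q, label b q <= it.+1) -> current b <= it.+1 ->
  triple base B bfs_body m (fun m' => bfs_rel m' (bfs_step n H s0 s1 s2 b))
    (max_time bfs_body).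
Proof.
move=> st R I cnt itN hl hc.
have qn := bfs_queue_size I; have mn := bfs_marked_size I; have hq := head_le I.
have stk : size (stack b) <= NN + n.
  case: cnt => [/andP[/eqP-> _] //|e]; lia.
rewrite /bfs_step; case sE: (stack b) => [|h t].
  apply: triple_cond; [by rewrite /=; split_vc | by rewrite /= (rel_sp R) sE | move=> _].
  apply: triple_cond; first by rewrite /=; split_vc.
    rewrite /= (rel_head R) (rel_tail R); case: ltnP => // lt _.
    by apply: dequeue_triple => //; apply: (queue_pos I); rewrite mem_nth.
  rewrite /= (rel_head R) (rel_tail R); case: ltnP => // _ _.
apply: triple_cond; [by rewrite /=; split_vc | move=> _ | by rewrite /= (rel_sp R) sE].
rewrite sE /= in stk; apply: expand_triple => //; try lia.
by apply: (marked_pos I); apply: (stack_marked I); rewrite sE mem_head.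
Qed.

Lemma start_triple m : sizes n m -> var m 4 = s.-1 ->
  (forall q, 0 < q <= n -> arr m 13 (s * (n + 2) + q) = 0) ->
  (forall t, arr m 13 t = D0 t) -> (forall x, arr m 10 x < s) ->
  triple base B bfs_start m (fun m' => bfs_rel m' (bfs_init s)) (max_time bfs_start).
Proof.
move=> [hN hW hM] hI z13 d13 m10.
have cb := @entry_bound n s s n_gt0 ltac:(lia) ltac:(lia).
have es : s.-1 + 1 = s by lia.
apply: vc_triple; rewrite /= hI hW es; split_vc.
split=> //=.
- by move=> q hq; rewrite /update eqn_add2l; case: eqP => // _; apply: z13.
- move=> t ht; rewrite /update; case: eqP => [e|//].
  by case: (ht s).
- by move=> [|k].
- move=> x xN; rewrite /update inE; case: (x =P 0) => _; first by rewrite eqxx.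
  by apply/eqP; have := m10 x; lia.
- by move=> x; rewrite /update; case: eqP => // _; apply: ltnW.
Qed.

End Bfs.

(** The last two clauses make [f] the distance from [s] plus one, and 0 where there is no path; [M]
    bounds the values that the output phase handles. *)
Definition dist_ok n (adj : rel nat) M s (f : nat -> nat) :=
  [/\ forall q, 0 < q <= n -> f q <= M,
      forall q, 0 < q <= n -> f q != 0 ->
        exists p, [/\ path adj s p, last s p = q & f q = (size p).+1]
    & forall p, path adj s p -> f (last s p) != 0 /\ f (last s p) <= (size p).+1].

Lemma last_pos n (adj : rel nat) s p : (forall a b, adj a b -> 0 < b <= n) ->
  0 < s <= n -> path adj s p -> 0 < last s p <= n.
Proof. by move=> pos; elim: p s => //= x p IH s hs /andP[/pos hx]; apply: IH. Qed.

Lemma dist_ok_ext n (adj : rel nat) M s f f' : (forall a b, adj a b -> 0 < b <= n) ->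
  0 < s <= n -> (forall q, 0 < q <= n -> f' q = f q) ->
  dist_ok n adj M s f -> dist_ok n adj M s f'.
Proof.
move=> pos hs e [h1 h2 h3]; split.
- by move=> q hq; rewrite e //; apply: h1.
- by move=> q hq; rewrite e //; apply: h2.
- by move=> p hp; rewrite e; [apply: h3 | apply: last_pos hp].
Qed.

(** * Searches from all sources *)

Section AllBfs.
Variables (n base B H NN : nat) (s0 s1 s2 : nat -> nat) (adj : rel nat).
Hypothesis n_gt0 : 0 < n.
Hypothesis baseE : base = 2 * (n * n) + 2.
Hypothesis BE : B = 100 * (n * n).
Hypothesis NN_le : NN <= 4 * (n * n).
Hypothesis n_le_H : n <= H.
Hypothesis H_le : H + n <= NN.
Hypothesis succ_le : forall x, x <= NN -> [/\ s0 x <= NN, s1 x <= NN & s2 x <= NN].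
Hypothesis succ0 : [/\ s0 0 = 0, s1 0 = 0 & s2 0 = 0].
Hypothesis reachP : forall a b, 0 < a <= n -> 0 < b <= n ->
  reach s0 s1 s2 (H + a) b <-> adj a b.
Hypothesis adj_pos : forall a b, adj a b -> 0 < b <= n.

Let nn : n <= n * n. Proof. by nia. Qed.

Lemma source_triple m i D0 : i < n -> static n H s0 s1 s2 m -> var m 4 = i ->
  var m 28 = NN + n ->
  (forall q, 0 < q <= n -> arr m 13 (i.+1 * (n + 2) + q) = 0) ->
  (forall t, arr m 13 t = D0 t) -> (forall x, arr m 10 x <= i) ->
  triple base B (bfs_start ;; For rJ rLim bfs_body) m (fun m' =>
    [/\ dist_ok n adj (NN + n).+1 i.+1 (fun q => arr m' 13 (i.+1 * (n + 2) + q)),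
        forall t, (forall q, 0 < q <= n -> t <> i.+1 * (n + 2) + q) ->
          arr m' 13 t = D0 t
      & forall x, arr m' 10 x <= i.+1])
    (max_time bfs_start + (6 + (NN + n) * (max_time bfs_body + 8))).
Proof.
move=> im st hi hlim z13 d13 m10.
have s_pos : 0 < i.+1 <= n by lia.
have [sz _ _ _ _] := st.
apply: triple_then.
  by apply: (start_triple n_gt0 baseE BE NN_le s_pos n_le_H H_le sz hi z13 d13).
move=> m0 fr0 R0.
have st0 : static n H s0 s1 s2 m0 by apply: static_frame fr0 st.
have hlim0 : var m0 28 = NN + n by rewrite fr0.1.
pose Q it m' := exists b,
  [/\ bfs_rel n NN i.+1 D0 m' b, bfs_inv n H NN i.+1 s0 s1 s2 adj b, bfs_count it b,
      forall q, label b q <= it.+1 & current b <= it.+1].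
apply: triple_weaken (leqnn _).
  apply: (@triple_for base B 5 28 bfs_body m0 Q) => //; first by lia.
    exists (bfs_init i.+1); split=> //.
    - exact: (rel_frame (frame_arun (Upd 5 (Num 0)) m0) isT R0).
    - exact: bfs_init_inv.
    - by right.
    - by move=> q /=; rewrite /update; case: eqP.
  move=> it m1 hit fr1 hj [b [R I cnt hl hc]].
  have st1 : static n H s0 s1 s2 m1 by apply: static_frame fr1 st0.
  have T := bfs_body_triple n_gt0 baseE BE NN_le s_pos n_le_H H_le succ_le st1 R I cnt
    (ltnW hit) hl hc.
  apply: triple_weaken T _ (leqnn _) => m2 _ R2.
  exists (bfs_step n H s0 s1 s2 b).
  have [I' cnt'] := bfs_step_inv H_le succ_le succ0 reachP adj_pos I cnt.
  have [hl' hc'] := bfs_step_label n H s0 s1 s2 hl hc.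
  split=> //; exact: (rel_frame (frame_arun (Upd 5 (Num it.+1)) m2) isT R2).
move=> m' _ [b [R I cnt hl _]]; have dn := bfs_end s_pos n_le_H H_le I cnt.
split.
- apply: (@dist_ok_ext _ _ _ _ (label b)) => //; first exact: rel_label R.
  split=> //.
  + by move=> q _ l0; apply: bfs_sound I l0.
  + by move=> p hp; apply: (bfs_complete succ0 reachP adj_pos I dn hp).
- exact: rel_rest R.
- exact: rel_mark_le R.
Qed.

Lemma all_bfs_triple m : sizes n m -> var m 14 = H -> var m 15 = NN ->
  arr m 5 = s0 -> arr m 6 = s1 -> arr m 7 = s2 ->
  (forall x, arr m 13 x = 0) -> (forall x, arr m 10 x = 0) ->
  triple base B all_bfs m (fun m' => forall s, 0 < s <= n ->
      dist_ok n adj (NN + n).+1 s (fun q => arr m' 13 (s * (n + 2) + q)))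
    (max_time (rLim <- C_ + N_) +
     (6 + n * (max_time bfs_start + (6 + (NN + n) * (max_time bfs_body + 8)) + 8))).
Proof.
move=> sz hH hC e5 e6 e7 z13 z10; have [hN _ _] := sz.
apply: (@triple_then _ _ _ _ _ (fun m1 => var m1 28 = NN + n)).
  by apply: vc_triple; rewrite /= hC hN; split_vc.
move=> m0 fr0 hlim.
have st : static n H s0 s1 s2 m0 by apply: static_frame fr0 _.
have {}z13 x : arr m0 13 x = 0 by rewrite fr0.2.
have {}z10 x : arr m0 10 x = 0 by rewrite fr0.2.
have {}hN : var m0 1 = n by rewrite fr0.1.
apply: triple_weaken (leqnn _).
  apply: (@triple_for base B 4 1 _ m0 (fun i m' =>
    [/\ forall s, 0 < s <= i ->
          dist_ok n adj (NN + n).+1 s (fun q => arr m' 13 (s * (n + 2) + q)),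
        forall t, (forall s q, 0 < s <= i -> 0 < q <= n -> t <> s * (n + 2) + q) ->
          arr m' 13 t = 0
      & forall x, arr m' 10 x <= i])) => //; first by lia.
    split=> /= [s|t _|x]; [lia | exact: z13 | by rewrite z10].
  move=> i m1 im fr hi [q1 q2 q3].
  have st1 : static n H s0 s1 s2 m1 by apply: static_frame fr st.
  have hlim1 : var m1 28 = NN + n by rewrite fr.1.
  have T := source_triple im st1 hi hlim1 _ (fun t => erefl (arr m1 13 t)) q3.
  apply: triple_weaken (T _) _ (leqnn _).
    move=> q hq; apply: q2 => s q' hs hq' e.
    have [es _] := @entry_inj n i.+1 q s q' ltac:(lia) ltac:(lia) e; lia.
  move=> m2 _ [d1 d2 d3]; split=> //=.
  - move=> s hs; have [es|ne] := eqVneq s i.+1; first by rewrite es.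
    apply: (@dist_ok_ext _ _ _ _ (fun q => arr m1 13 (s * (n + 2) + q))) => //; [lia | | apply: q1; lia].
    move=> q hq; apply: d2 => q' hq' e.
    have [es _] := @entry_inj n s q i.+1 q' ltac:(lia) ltac:(lia) e; lia.
  - move=> t ht; rewrite d2; last by move=> q hq; apply: ht => //; lia.
    by apply: q2 => s q hs hq; apply: ht => //; lia.
by move=> m' _ [].
Qed.

End AllBfs.

(** * Writing the distance matrix *)

Definition output_body : acmd :=
  rX <- Get 13 ((I_ + 1) * W_ + (J_ + 1)) ;;
  rY <- Get 2 (I_ + 1) * N_ + Get 2 (J_ + 1) ;;
  If X_ do Put 0 Y_ (X_ - 1) else Put 0 Y_ N_.

Definition output : acmd := For rI rN (For rJ rN output_body).

Section Output.
Variables (n root : nat) (u v : nat -> nat) (base B : nat).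
Hypothesis CS : contraction_seq n root u v.
Hypothesis baseE : base = 2 * (n * n) + 2.
Hypothesis BE : B = 100 * (n * n).

Let n_gt0 : 0 < n := contraction_gt0 CS.
Let nn : n <= n * n. Proof. by nia. Qed.

Local Notation vert := (vert n root u v).

Lemma vert_inj p q : 0 < p <= n -> 0 < q <= n -> vert p = vert q -> p = q.
Proof.
move=> hp hq /eqP; rewrite /vert nth_uniq ?(size_order0 CS) ?(order0_uniq CS) //; lia.
Qed.

(** What is still needed of the input is kept in registers and other arrays, so array 0 may be
    overwritten; [vert] translates positions back to vertices, injectively, so no entry is written
    twice. *)
Lemma output_triple m M : sizes n m -> order_ok n root u v m -> M <= B ->
  (forall p q, 0 < p <= n -> 0 < q <= n -> arr m 13 (p * (n + 2) + q) <= M) ->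
  triple base B output m (fun m' => forall p q, 0 < p <= n -> 0 < q <= n ->
    arr m' 0 (vert p * n + vert q) =
      let x := arr m 13 (p * (n + 2) + q) in if x == 0 then n else x.-1)
    (6 + n * (6 + n * (max_time output_body + 8) + 8)).
Proof.
move=> sz ord MB bnd; have [hN hW _] := sz.
pose Q i j m' := forall p q, 0 < p <= n -> 0 < q <= n -> before i j p q ->
    arr m' 0 (vert p * n + vert q) =
      let x := arr m 13 (p * (n + 2) + q) in if x == 0 then n else x.-1.
apply: triple_weaken (leqnn _).
  apply: (@triple_for base B 4 1 _ m (fun i m' => Q i 0 m')) => //; first by lia.
    by move=> p q hp hq; rewrite /before; lia.
  move=> i m1 im fr hi Q1.
  have {}sz : sizes n m1 by apply: sizes_frame fr sz.
  have {}ord : order_ok n root u v m1 by rewrite /order_ok fr.2.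
  have e13 : arr m1 13 = arr m 13 by rewrite fr.2.
  have {hN hW}[hN hW _] := sz.
  apply: triple_weaken (leqnn _).
    apply: (@triple_for base B 5 1 _ m1 (fun j m' => Q i j m')) => //; first by lia.
    move=> j m2 jm fr2 hj Q2; apply: vc_triple.
    have {}ord : order_ok n root u v m2 by rewrite /order_ok fr2.2.
    have {}e13 : arr m2 13 = arr m 13 by rewrite fr2.2.
    have {hN hW hi}[hN hW hi] : [/\ var m2 1 = n, var m2 2 = n + 2 & var m2 4 = i] by rewrite !fr2.1.
    rewrite /= hi hj hN hW !addn1.
    have hp : 0 < i.+1 <= n by lia.
    have hq : 0 < j.+1 <= n by lia.
    have vp := vert_lt CS hp; have vq := vert_lt CS hq.
    rewrite (ord _ hp) (ord _ hq) e13.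
    have cb := @entry_bound n i.+1 j.+1 n_gt0 ltac:(lia) ltac:(lia).
    have vb : vert i.+1 * n + vert j.+1 < n * n by nia.
    have := bnd _ _ hp hq; set x := arr m 13 _ => xM.
    have key y : y = (if x == 0 then n else x.-1) -> forall p q, 0 < p <= n -> 0 < q <= n ->
      before i j.+1 p q -> update (arr m2 0) (vert i.+1 * n + vert j.+1) y (vert p * n + vert q) =
      let x := arr m 13 (p * (n + 2) + q) in if x == 0 then n else x.-1.
      move=> -> p q hp' hq' bef; rewrite /update; case: eqP => [e|ne].
        have vp' := vert_lt CS hp'; have vq' := vert_lt CS hq'.
        have [ep eq] : vert p = vert i.+1 /\ vert q = vert j.+1.
          by have [lt|lt|ej] := ltngtP (vert p) (vert i.+1); nia.
        by rewrite /x (vert_inj hp' hp ep) (vert_inj hq' hq eq).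
      apply: Q2 => //; move: bef; rewrite /before.
      have [[ep eq]|ne'] : (p = i.+1 /\ q = j.+1) \/ ~ (p = i.+1 /\ q = j.+1) by lia.
        by case: ne; rewrite ep eq.
      by lia.
    split_vc.
    - by move=> x0; split_vc; apply: key; rewrite subn1; case: eqP.
    - by move=> x0; split_vc; apply: key; rewrite x0.
  move=> m2 _ Q2 p q hp hq bef; apply: Q2 => //; move: bef; rewrite /before; lia.
by move=> m' _ Q' p q hp hq; apply: Q' => //; rewrite /before; lia.
Qed.

End Output.

(** * The whole program *)

Definition apsp : acmd :=
  prologue ;; link_order ;; walk_order ;; find_runs ;; find_logs ;;
  fill_tables ;; find_rects ;; all_bfs ;; output.

Definition apsp_time n L NN :=
  max_time prologue + (6 + n.-1 * (max_time link_body + 8) +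
  (max_time (rX <- Get 0 (N_ * N_ + 2 * N_ - 2)) + (6 + n * (max_time walk_body + 8)) +
  (6 + n * (6 + n * (max_time runs_body + 8) + 8) +
  (max_time logs_init + (6 + n * (max_time logs_body + 8) + max_time (rH <- O_ + N_)) +
  (max_time tables_init +
    (6 + L * (6 + n * (max_time tables_body + 8) + max_time tables_next + 8)) +
  (max_time (rC <- H_ + H_) + (6 + n * (6 + n * (max_time rect_body + 8) + 8)) +
  (max_time (rLim <- C_ + N_) +
     (6 + n * (max_time bfs_start + (6 + (NN + n) * (max_time bfs_body + 8)) + 8)) +
  (6 + n * (6 + n * (max_time output_body + 8) + 8))))))))).

Definition zeros (ks : seq nat) (m : astate) := forall k, k \in ks -> forall x, arr m k x = 0.

Lemma zeros_frame c ks ks' m m1 : frame c m m1 -> zeros ks m ->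
  all (fun k => (k \in ks) && (k \notin arr_mod c)) ks' -> zeros ks' m1.
Proof. by move=> [_ fa] z /allP h k /h /andP[kks kc] x; rewrite fa // z. Qed.

Section Program.
Variables (n root : nat) (u v : nat -> nat) (g : rel nat) (base B : nat).
Hypothesis CS : contraction_seq n root u v.
Hypothesis baseE : base = 2 * (n * n) + 2.
Hypothesis BE : B = 100 * (n * n).

Let n_gt0 : 0 < n := contraction_gt0 CS.
Let nn : n <= n * n. Proof. by nia. Qed.

Local Notation adj := (adj n root u v g).
Local Notation vert := (vert n root u v).

Definition num_nodes :=
  2 * ((trunc_log 2 n).+1 * n) + 2 * num_emits n root u v g.

Definition apsp_post (m : astate) := exists (D : nat -> nat -> nat) M,
  (forall s, 0 < s <= n -> dist_ok n adj M s (D s)) /\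
  forall p q, 0 < p <= n -> 0 < q <= n ->
    arr m 0 (vert p * n + vert q) = if D p q == 0 then n else (D p q).-1.

Lemma apsp_triple m : input_ok n root u v g (arr m 0) ->
  zeros [:: 3; 4; 5; 6; 7; 10; 13] m ->
  triple base B apsp m apsp_post (apsp_time n (trunc_log 2 n) num_nodes).
Proof.
move=> inp z.
apply: triple_then (prologue_triple CS baseE BE inp) _.
move=> m1 fr1 sz; rewrite -(fr1.2 0) // in inp.
have {}z := zeros_frame (ks' := [:: 3; 4; 5; 6; 7; 10; 13]) fr1 z isT.
apply: triple_then (link_triple CS baseE BE inp sz) _.
move=> m2 fr2 srt; rewrite -(fr2.2 0) // in inp.
have {}sz : sizes n m2 by apply: sizes_frame fr2 sz.
have {}z := zeros_frame (ks' := [:: 3; 4; 5; 6; 7; 10; 13]) fr2 z isT.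
apply: triple_then (walk_triple CS baseE BE inp sz srt) _.
move=> m3 fr3 ord; rewrite -(fr3.2 0) // in inp.
have {}sz : sizes n m3 by apply: sizes_frame fr3 sz.
have {}z := zeros_frame (ks' := [:: 3; 4; 5; 6; 7; 10; 13]) fr3 z isT.
apply: triple_then (runs_triple CS baseE BE inp sz ord (z 3 isT)) _.
move=> m4 fr4 R; have {}ord : order_ok n root u v m4 by rewrite /order_ok fr4.2.
have {}sz : sizes n m4 by apply: sizes_frame fr4 sz.
have {}z := zeros_frame (ks' := [:: 4; 5; 6; 7; 10; 13]) fr4 z isT.
have hN : var m4 1 = n by case: sz.
apply: triple_then (logs_triple n_gt0 baseE BE hN) _.
move=> m5 fr5 [L [hL hH L_log lg]].
have {}ord : order_ok n root u v m5 by rewrite /order_ok fr5.2.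
have {}R : runs_ok n root u v g m5 by rewrite /runs_ok fr5.2.
have {}sz : sizes n m5 by apply: sizes_frame fr5 sz.
have {}z := zeros_frame (ks' := [:: 4; 5; 6; 7; 10; 13]) fr5 z isT.
have eL : trunc_log 2 n = L by apply: trunc_log_eq.
rewrite /num_nodes eL; set H := L.+1 * n in hH *; have HE : H = L.+1 * n by [].
have HN : H <= n * n by apply: mul_log_le.
have nH : n <= H by rewrite HE; nia.
have {}hN : var m5 1 = n by case: sz.
apply: triple_then (tables_triple n_gt0 baseE BE HE L_log hN hL hH (z 5 isT) (z 6 isT)) _.
move=> m6 fr6 tab.
have {}ord : order_ok n root u v m6 by rewrite /order_ok fr6.2.
have {}R : runs_ok n root u v g m6 by rewrite /runs_ok fr6.2.
have {}lg : logs_ok n L m6 by rewrite /logs_ok !fr6.2.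
have {}hH : var m6 14 = H by rewrite fr6.1.
have {}sz : sizes n m6 by apply: sizes_frame fr6 sz.
have {}z := zeros_frame (ks' := [:: 4; 7; 10; 13]) fr6 z isT.
apply: triple_then (rects_triple CS baseE BE HE L_log sz hH R lg tab (z 4 isT) (z 7 isT)) _.
move=> m7 fr7 [G cE cB cov].
have {}ord : order_ok n root u v m7 by rewrite /order_ok fr7.2.
have {}hH : var m7 14 = H by rewrite fr7.1.
have {}sz : sizes n m7 by apply: sizes_frame fr7 sz.
have {}z := zeros_frame (ks' := [:: 10; 13]) fr7 z isT.
rewrite -cE; set NN := var m7 15 in G cE cB *.
have clH : 2 * H <= NN by case: G => _ [lo [hi C]]; apply: cell_base C.
have H_le : H + n <= NN by lia.
have succ0 : [/\ arr m7 5 0 = 0, arr m7 6 0 = 0 & arr m7 7 0 = 0].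
  have [tab7 [lo [hi C]]] := G; have [-> ->] := tab_leaf tab7 (leq0n n).
  by rewrite (cell_col C).
have reachP a b : 0 < a <= n -> 0 < b <= n ->
    reach (arr m7 5) (arr m7 6) (arr m7 7) (H + a) b <-> adj a b.
  move=> ha hb; split; first exact: (graph_sound n_gt0 HE G).
  exact: (covered_adj CS).
have adj_p a b : adj a b -> 0 < b <= n by apply: adj_pos.
have T := all_bfs_triple n_gt0 baseE BE cB nH H_le
  (fun x => @graph_succ_le n L H _ n_gt0 HE NN _ _ _ x G) succ0 reachP adj_p sz hH erefl
  erefl erefl erefl (z 13 isT) (z 10 isT).
apply: triple_then T _ => m8 fr8 dst.
have {}ord : order_ok n root u v m8 by rewrite /order_ok fr8.2.
have {}sz : sizes n m8 by apply: sizes_frame fr8 sz.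
have MB : (NN + n).+1 <= B by lia.
apply: triple_weaken (output_triple CS baseE BE sz ord MB _) _ (leqnn _).
  by move=> p q hp hq; have [h _ _] := dst p hp; apply: h.
move=> m9 _ out; exists (fun p q => arr m8 13 (p * (n + 2) + q)), (NN + n).+1; split.
  exact: dst.
exact: out.
Qed.

End Program.

(** * Bounds on running time and word size *)

Definition apsp_const :=
  max_time prologue + max_time link_body +
  max_time (rX <- Get 0 (N_ * N_ + 2 * N_ - 2)) + max_time walk_body +
  max_time runs_body + max_time logs_init + max_time logs_body +
  max_time (rH <- O_ + N_) + max_time tables_init + max_time tables_body +
  max_time tables_next + max_time (rC <- H_ + H_) + max_time rect_body +
  max_time (rLim <- C_ + N_) + max_time bfs_start + 37 * max_time bfs_body +
  max_time output_body + 1000.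

(** Each phase is linear in the costs of its code, with a factor at most [X], or [37 * X] for the
    steps of the searches; the summand 1000 of [apsp_const] absorbs the loop overheads. *)
Lemma apsp_time_le n L NN D l :
  0 < n -> L <= l -> 0 < l -> 0 < D -> NN <= (4 * l + 32 * D) * n ->
  apsp_time n L NN <= apsp_const * (D * n ^ 2 * l).
Proof.
move=> n0 Ll l0 D0 hNN.
set X := D * n ^ 2 * l.
have xn2 : n * n <= X by rewrite /X -mulnn mulnAC leq_pmull // muln_gt0 D0.
have xn : n <= X by apply: leq_trans xn2; rewrite leq_pmull.
have x1 : 1 <= X by apply: leq_trans xn.
have xln : l * n <= X.
  by rewrite /X mulnC leq_mul // -mulnn mulnA leq_pmull // muln_gt0 D0.
have xLn : L * n <= X by apply: leq_trans xln; rewrite leq_mul.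
have xL : L <= X by apply: leq_trans xLn; rewrite leq_pmulr.
(* 37 = 4 + 32 + 1, from the coefficients in the bound on [NN] and the extra [n]. *)
have xNN : n * (NN + n) <= 37 * X.
  have h1 : l * (n * n) <= X by rewrite /X -mulnn mulnC leq_mul // leq_pmull.
  have h2 : D * (n * n) <= X by rewrite /X -mulnn leq_pmulr.
  apply: (@leq_trans (n * ((4 * l + 32 * D) * n + n))); first by rewrite leq_mul2l leq_add2r hNN orbT.
  have -> : n * ((4 * l + 32 * D) * n + n) = 4 * (l * (n * n)) + 32 * (D * (n * n)) + n * n by lia.
  by lia.
have lin y c : y <= X -> y * c <= X * c by move=> h; rewrite leq_mul2r h orbT.
have one c : c <= X * c by rewrite leq_pmull.
have loop c : n * (c + 8) <= X * (c + 8) by apply: lin.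
have loop1 c : n.-1 * (c + 8) <= X * (c + 8).
  by apply: lin; apply: leq_trans (leq_pred n) xn.
have loop2 c : n * (6 + n * (c + 8) + 8) <= X * (c + 22).
  have := lin _ (c + 8) xn2.
  have -> : n * (6 + n * (c + 8) + 8) = 14 * n + n * n * (c + 8) by lia.
  by lia.
have loop3 c c' : L * (6 + n * (c + 8) + c' + 8) <= X * (c + c' + 22).
  have := lin _ (c + 8) xLn; have := lin _ (c' + 14) xL.
  have -> : L * (6 + n * (c + 8) + c' + 8) = L * (c' + 14) + L * n * (c + 8) by lia.
  by lia.
have loop4 c c' : n * (c + (6 + (NN + n) * (c' + 8)) + 8) <= X * (c + 37 * c' + 310).
  have := lin _ (c + 14) xn.
  have : n * (NN + n) * (c' + 8) <= 37 * X * (c' + 8) by rewrite leq_mul2r xNN orbT.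
  have -> : n * (c + (6 + (NN + n) * (c' + 8)) + 8) =
    n * (c + 14) + n * (NN + n) * (c' + 8) by lia.
  by lia.
rewrite /apsp_time /apsp_const.
move: (max_time prologue) (max_time link_body)
  (max_time (rX <- Get 0 (N_ * N_ + 2 * N_ - 2))) (max_time walk_body)
  (max_time runs_body) (max_time logs_init) (max_time logs_body)
  (max_time (rH <- O_ + N_)) (max_time tables_init) (max_time tables_body)
  (max_time tables_next) (max_time (rC <- H_ + H_)) (max_time rect_body)
  (max_time (rLim <- C_ + N_)) (max_time bfs_start) (max_time bfs_body)
  (max_time output_body) => c0 c1 c2 c3 c4 c5 c6 c7 c8 c9 c10 c11 c12 c13 c14 c15 c16.
have i0 := one c0; have i1 := loop1 c1; have i2 := one c2; have i3 := loop c3.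
have i4 := loop2 c4; have i5 := one c5; have i6 := loop c6; have i7 := one c7.
have i8 := one c8; have i9 := loop3 c9 c10; have i11 := one c11.
have i12 := loop2 c12; have i13 := one c13; have i14 := loop4 c14 c15.
have i16 := loop2 c16; clear one loop loop1 loop2 loop3 loop4 lin.
by lia.
Qed.

(** From [n < 2 ^ (2 * lg n)] one gets [2048 * n ^ 2 <= 2 ^ ((11 + 2 + 2) * lg n)], and 2048 exceeds
    the total coefficient 1602 with room for the constants. *)
Lemma word_size_bound n w : 0 < n -> 15 * lg n <= w ->
  2 * (n * n) + 2 + 100 * (n * n) * 16 + 16 < 2 ^ w.
Proof.
move=> n0 hw; have l1 : 0 < lg n by rewrite /lg leq_max.
have nl : n < 2 ^ (2 * lg n).
  apply: leq_trans (trunc_log_ltn n (isT : 1 < 2)) _.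
  have : trunc_log 2 n <= lg n by rewrite leq_maxr.
  by rewrite leq_exp2l //; lia.
have e : 2 ^ (15 * lg n) = 2 ^ (11 * lg n) * (2 ^ (2 * lg n) * 2 ^ (2 * lg n)).
  by rewrite -!expnD; congr (_ ^ _); lia.
have h11 : 2 ^ 11 <= 2 ^ (11 * lg n) by rewrite leq_exp2l // leq_pmulr.
apply: leq_trans (_ : 2 ^ (15 * lg n) <= _); last by rewrite leq_exp2l.
rewrite e; move: (2 ^ (2 * lg n)) nl => K nK.
apply: leq_trans (leq_mul h11 (leq_mul nK nK)).
have -> : 2 ^ 11 = 2048 by [].
by nia.
Qed.

(** * Encoding of the input and correctness of the output *)

Lemma nth_flatten_const (T : Type) (x0 : T) n (ss : seq (seq T)) x y :
  (forall k, k < size ss -> size (nth [::] ss k) = n) -> x < size ss -> y < n ->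
  nth x0 (flatten ss) (x * n + y) = nth x0 (nth [::] ss x) y.
Proof.
elim: ss x => //= s ss IH x sz xs yn; have s0 := sz 0 isT; rewrite /= in s0.
rewrite nth_cat s0; case: x xs => [|x] xs; first by rewrite mul0n add0n yn.
rewrite ifF; last by lia.
have -> : x.+1 * n + y - n = x * n + y by lia.
by apply: IH => // k ks; apply: (sz k.+1).
Qed.

Section Encoding.
Variables (n : nat) (e : rel 'I_n) (s : (n.-1).-tuple ('I_n * 'I_n)).
Hypothesis n_gt0 : 0 < n.
Hypothesis e_sym : symmetric e.
Hypothesis e_irr : irreflexive e.
Hypothesis s_ok : sd_degeneracy_seq s.

Definition edge : rel nat := fun a b =>
  if (insub a : option 'I_n, insub b : option 'I_n) is (Some x, Some y) then e x y
  else false.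

Lemma edgeE (x y : 'I_n) : edge x y = e x y.
Proof. by rewrite /edge !valK. Qed.

Lemma edge_sym : symmetric edge.
Proof. by move=> a b; rewrite /edge; do 2 case: insub => //. Qed.

Lemma edge_irr : irreflexive edge.
Proof. by move=> a; rewrite /edge; case: insub. Qed.

Definition useq i := nth 0 [seq val p.1 | p <- s] i.
Definition vseq i := nth 0 [seq val p.2 | p <- s] i.

Lemma useqE (i : 'I_n.-1) : useq i = (tnth s i).1.
Proof.
have x0 : 'I_n * 'I_n := (Ordinal n_gt0, Ordinal n_gt0).
by rewrite /useq (nth_map x0) ?size_tuple // (tnth_nth x0).
Qed.

Lemma vseqE (i : 'I_n.-1) : vseq i = (tnth s i).2.
Proof.
have x0 : 'I_n * 'I_n := (Ordinal n_gt0, Ordinal n_gt0).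
by rewrite /vseq (nth_map x0) ?size_tuple // (tnth_nth x0).
Qed.

(* For [n = 1] the sequence is empty and the default value 0 of [nth] is the
   only vertex. *)
Definition last_vertex := vseq n.-2.

(** The root is the second vertex of the last pair: it differs from the last [u] by [u <> v] and
    from the earlier ones by degeneracy. *)
Lemma contraction_of_seq : contraction_seq n last_vertex useq vseq.
Proof.
have [uv cover uneq] := s_ok.
have u1 i (im : i < n.-1) : useq i = (tnth s (Ordinal im)).1 := useqE (Ordinal im).
have v1 i (im : i < n.-1) : vseq i = (tnth s (Ordinal im)).2 := vseqE (Ordinal im).
have n1 : ~ 1 < n -> n = 1 by lia.
have h1 i : i < n.-1 -> useq i < n by move=> im; rewrite (u1 _ im).
have h2 i : i < n.-1 -> vseq i < n by move=> im; rewrite (v1 _ im).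
have h3 i : i < n.-1 -> useq i <> vseq i.
  by move=> im; rewrite (u1 _ im) (v1 _ im) => /val_inj; apply: uv.
have h5 i j : i < j -> j < n.-1 -> useq i <> vseq j.
  move=> ij jm; have im := ltn_trans ij jm; rewrite (u1 _ im) (v1 _ jm) => /val_inj.
  by have [] := uneq (Ordinal im) (Ordinal jm) ij.
split=> //.
- have [n2|/negP/n1 en] := boolP (1 < n); first by apply: h2; lia.
  by rewrite /last_vertex /vseq nth_default ?size_map ?size_tuple //; lia.
- move=> i im; rewrite /last_vertex; have [->|ne] := eqVneq i n.-2.
    by apply: h3; lia.
  by apply: h5; lia.
- move=> i j ij jm; have im := ltn_trans ij jm; rewrite (u1 _ im) (u1 _ jm) => /val_inj.
  by have [] := uneq (Ordinal im) (Ordinal jm) ij.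
- move=> x xn; have [n2|/negP/n1 en] := boolP (1 < n); last first.
    left; rewrite /last_vertex /vseq nth_default ?size_map ?size_tuple; lia.
  have im : n.-2 < n.-1 by lia.
  have := cover (Ordinal im); rewrite /= prednK; last by lia.
  move=> /(_ erefl)/setP/(_ (Ordinal xn)); rewrite !inE => /esym/orP[/eqP ex|].
    by left; rewrite /last_vertex (v1 _ im) -ex.
  case/imsetP=> j _ ex; right; exists j => //.
  by rewrite useqE -ex.
Qed.

Let CS := contraction_of_seq.

Lemma input_of_seq : input_ok n last_vertex useq vseq edge (nth 0 (apsp_input e s)).
Proof.
set rows := [seq [seq nat_of_bool (e x y) | y <- enum 'I_n] | x <- enum 'I_n].
have rowsE : [seq nat_of_bool (e x y) | x <- enum 'I_n, y <- enum 'I_n] = flatten rows by [].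
have szr : size rows = n by rewrite size_map size_enum_ord.
have szk k : k < size rows -> size (nth [::] rows k) = n.
  rewrite szr => kn; rewrite (nth_map (Ordinal n_gt0)) ?size_enum_ord //.
  by rewrite size_map size_enum_ord.
have szf : size (flatten rows) = n * n.
  by rewrite -rowsE size_allpairs size_enum_ord.
set prs := [seq [:: val p.1; val p.2] | p <- s].
have szp k : k < size prs -> size (nth [::] prs k) = 2.
  rewrite size_map => ks; by rewrite (nth_map (Ordinal n_gt0, Ordinal n_gt0)).
have adjE x y : x < n -> y < n -> nth 0 (apsp_input e s) (1 + x * n + y) = edge x y.
  move=> xn yn; rewrite /apsp_input rowsE -addnA /= nth_cat szf.
  rewrite ifT; last by nia.
  rewrite add0n (nth_flatten_const 0 szk) ?szr // /rows (nth_map (Ordinal n_gt0)) ?size_enum_ord //.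
  rewrite (nth_map (Ordinal n_gt0)) ?size_enum_ord //.
  have -> : nth (Ordinal n_gt0) (enum 'I_n) x = Ordinal xn by apply: val_inj; rewrite /= nth_enum_ord.
  have -> : nth (Ordinal n_gt0) (enum 'I_n) y = Ordinal yn by apply: val_inj; rewrite /= nth_enum_ord.
  by rewrite -edgeE.
have prE i b : i < n.-1 -> b < 2 ->
    nth 0 (apsp_input e s) (1 + n * n + (i * 2 + b)) = nth 0 (nth [::] prs i) b.
  move=> im hb; rewrite /apsp_input rowsE -addnA /= nth_cat szf.
  rewrite ifF; last by lia.
  by rewrite add0n addKn (nth_flatten_const 0 szp) // size_map size_tuple.
have prN i : i < n.-1 -> nth [::] prs i = [:: useq i; vseq i].
  move=> im; rewrite /useq /vseq !(nth_map (Ordinal n_gt0, Ordinal n_gt0)) ?size_tuple //.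
split=> //.
- move=> i im; have -> : 1 + n * n + 2 * i = 1 + n * n + (i * 2 + 0) by lia.
  by rewrite prE // prN.
- move=> i im; have -> : 2 + n * n + 2 * i = 1 + n * n + (i * 2 + 1) by lia.
  by rewrite prE // prN.
- have [n2|n1] := ltnP 1 n.
    have -> : n * n + 2 * n - 2 = 1 + n * n + (n.-2 * 2 + 1) by nia.
    by rewrite prE ?prN //; lia.
  (* The address is then 1, that of the only matrix entry; its value 0 happens to be the only
     vertex. *)
  have en : n = 1 by lia.
  have -> : n * n + 2 * n - 2 = 1 + 0 * n + 0 by rewrite en.
  rewrite adjE // edge_irr /last_vertex /vseq nth_default // size_map size_tuple; lia.
Qed.

(** Thus the arrays stored from [base] on lie behind the input, where the memory is 0. *)
Lemma size_input : size (apsp_input e s) <= 2 * (n * n) + 2.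
Proof.
rewrite /apsp_input /= size_cat size_allpairs size_enum_ord.
have -> : size (flatten [seq [:: val p.1; val p.2] | p <- s]) = 2 * n.-1.
  rewrite size_flatten /shape -map_comp -[in RHS](size_tuple s).
  by elim: (tval s) => //= p t ->; lia.
by nia.
Qed.

(** The vertices of [order j] are none of the earlier [u i], so every listed vertex lies in the
    remaining graph and hence in the symmetric difference. *)
Lemma sd_list_le j : j < n.-1 ->
  size (sd_list n last_vertex useq vseq edge j) <= sd_width e s.
Proof.
move=> jm; pose j' := Ordinal jm.
set A := ~: [set (tnth s i).1 | i : 'I_n.-1 & i < j'].
apply: leq_trans (leq_bigmax j'); rewrite -/A.
pose S := symdiff (nbhd e A (tnth s j').1 :\ (tnth s j').2) (nbhd e A (tnth s j').2 :\ (tnth s j').1).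
have -> : sd e A (tnth s j').1 (tnth s j').2 = size [seq val x | x <- enum S].
  by rewrite size_map -cardE.
have [mem uniq_o _] := order_spec CS (ltnW jm).
apply: uniq_leq_size; first by rewrite filter_uniq.
move=> y; rewrite mem_filter => /andP[/and3P[yu yv ne] yo].
have yn : y < n.
  have /mem[->|[i /andP[_ im] ->]] := yo; first exact: contraction_root CS.
  exact: (contraction_u CS im).
apply/mapP; exists (Ordinal yn) => //; rewrite mem_enum /S.
have eu : (Ordinal yn == (tnth s j').1) = false.
  by apply/eqP => ey; move: yu; rewrite [useq j](useqE j') -ey eqxx.
have ev : (Ordinal yn == (tnth s j').2) = false.
  by apply/eqP => ey; move: yv; rewrite [vseq j](vseqE j') -ey eqxx.
have yA : Ordinal yn \in A.
  rewrite inE; apply/imsetP => -[i]; rewrite inE => ij ey.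
  have {}ey : y = useq i by rewrite useqE -ey.
  have /mem[er|[k /andP[jk km] ek]] := yo.
    by apply: (contraction_u_root CS (ltn_trans ij jm)); rewrite -ey.
  by apply: (@contraction_u_neq _ _ _ _ CS i k) => //; [apply: leq_trans jk | rewrite -ey].
have memS (A' : {set 'I_n}) a b z : (z == a) = false -> (z == b) = false -> z \in A' ->
    (z \in symdiff (nbhd e A' a :\ b) (nbhd e A' b :\ a)) = (e a z != e b z).
  by move=> za zb zA; rewrite !inE za zb zA /=; do 2 case: (e _ z).
rewrite memS // -!edgeE -useqE -vseqE.
exact: ne.
Qed.

Definition pos (x : 'I_n) := (index (val x) (order n last_vertex useq vseq 0)).+1.

Lemma pos_range x : 0 < pos x <= n.
Proof.
have : val x \in order n last_vertex useq vseq 0 by rewrite (mem_order0 CS); apply: ltn_ord.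
by rewrite -index_mem (size_order0 CS).
Qed.

Lemma vert_pos x : vert n last_vertex useq vseq (pos x) = val x.
Proof. by rewrite /vert /= nth_index // (mem_order0 CS); apply: ltn_ord. Qed.

Lemma adj_pos_edge x y : adj n last_vertex useq vseq edge (pos x) (pos y) = e x y.
Proof. by rewrite /adj /pos_ok !pos_range !vert_pos edgeE. Qed.

Lemma pos_surj p : 0 < p <= n -> exists x, pos x = p.
Proof.
move=> hp; exists (Ordinal (vert_lt CS hp)); rewrite /pos /= /vert index_uniq.
- by lia.
- by rewrite (size_order0 CS); lia.
- exact: order0_uniq CS.
Qed.

Lemma path_pos x p : path e x p ->
  path (adj n last_vertex useq vseq edge) (pos x) (map pos p) /\
  last (pos x) (map pos p) = pos (last x p).
Proof.
by elim: p x => //= y p IH x /andP[exy /IH[h1 h2]]; rewrite adj_pos_edge exy.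
Qed.

Lemma path_unpos x p : path (adj n last_vertex useq vseq edge) (pos x) p ->
  exists2 p', path e x p' & p = map pos p'.
Proof.
elim: p x => [|q p IH] x /=; first by exists [::].
case/andP=> xq; have /and3P[_ qok _] := xq.
have [y ey] := pos_surj qok; rewrite -{}ey {q qok} adj_pos_edge in xq *.
by case/IH => p' hp' ->; exists (y :: p') => //=; rewrite xq.
Qed.

Lemma post_output m mem : apsp_post n last_vertex useq vseq edge m ->
  (forall i, i < n * n -> mem i = arr m 0 i) -> apsp_output e mem.
Proof.
move=> [D [M [dst out]]] memE x y.
have bnd : x * n + y < n * n by have := ltn_ord x; have := ltn_ord y; nia.
have := out _ _ (pos_range x) (pos_range y); rewrite !vert_pos -memE //.
move=> ->; have [_ snd cmp] := dst _ (pos_range x).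
have cmp' p : path e x p -> D (pos x) (pos (last x p)) != 0 /\
    D (pos x) (pos (last x p)) <= (size p).+1.
  by move=> /path_pos[h1 h2]; have := cmp _ h1; rewrite h2 size_map.
have pos_inj : injective pos by move=> a b eab; apply: val_inj; rewrite -!vert_pos eab.
have snd' : D (pos x) (pos y) != 0 ->
    exists p, [/\ path e x p, last x p = y & D (pos x) (pos y) = (size p).+1].
  case/(snd _ (pos_range y)) => p [hp hl hD]; have [p' hp' ep] := path_unpos hp.
  exists p'; rewrite hD ep size_map; split=> //; apply: pos_inj.
  by rewrite -hl ep; have [_ ->] := path_pos hp'.
case: ifP => [/connectP[p hp ey]|/negP nc].
  have [D0 _] := cmp' p hp; rewrite -ey in D0; rewrite (negbTE D0).
  have [p' [hp' hl' hD]] := snd' D0; split.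
    by exists p'; split=> //; rewrite hD.
  by move=> q hq hlq; have [_] := cmp' q hq; rewrite hlq; lia.
case: eqP => // /eqP/snd'[p [hp hl _]]; case: nc; apply/connectP.
by exists p.
Qed.

End Encoding.

Definition base_exp : expr :=
  Add (Mul (Const 2) (Mul (Read (Const 0)) (Read (Const 0)))) (Const 2).

Definition apsp_program : cmd := Seq (Assign 0 base_exp) (compile apsp).

Theorem corollary2p7 :
  exists (P : cmd) (k C : nat),
    forall (n : nat) (e : rel 'I_n) (s : (n.-1).-tuple ('I_n * 'I_n))
           (d w : nat),
      0 < n -> symmetric e -> irreflexive e ->
      sd_degeneracy_seq s -> sd_width e s = d ->
      k * lg n <= w ->
      exists (t : nat) (st : state),
        [/\ exec w P (init_state (apsp_input e s)) t st,
            t <= C * (maxn 1 d * n ^ 2 * lg n)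
          & apsp_output e (memory st)].
Proof.
(* 15 comes from [word_size_bound]; the first summand of the constant pays for loading [base] into
   register 0. *)
exists apsp_program, 15, ((cost base_exp).+1 + apsp_const).
move=> n e s d w n0 e_sym e_irr s_ok sd_d hw.
have big := word_size_bound n0 hw.
have CS : contraction_seq n (last_vertex s) (useq s) (vseq s) by apply: contraction_of_seq.
have inp : input_ok n (last_vertex s) (useq s) (vseq s) (edge e) (nth 0 (apsp_input e s)).
  exact: input_of_seq.
set base := 2 * (n * n) + 2; set B := 100 * (n * n).
pose m0 := AState (fun=> 0)
  (fun k => if k == 0 then nth 0 (apsp_input e s) else fun=> 0).
have z0 : zeros [:: 3; 4; 5; 6; 7; 10; 13] m0.
  by move=> k hk x; rewrite /=; case: eqP hk => // ->.
have [sf post tm] := apsp_triple CS (erefl base) (erefl B) (m := m0) inp z0.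
pose st0 := init_state (apsp_input e s).
pose st1 := State (update (regs st0) 0 (eval w st0 base_exp)) (memory st0).
have base_eval : eval w st0 base_exp = base.
  have n1 : n <= n * n by rewrite leq_pmulr.
  rewrite /= !mod0n [2 %% _]modn_small; last by lia.
  by rewrite (modn_small (m := n * n)) ?modn_small //; lia.
have rep1 : represents base m0 st1.
  rewrite /st1 base_eval; split=> //=.
  - by move=> r r0; rewrite /update (negbTE r0).
  - move=> k i hk; rewrite nth_default; first by case: eqP hk => // ->.
    by apply: leq_trans (size_input e s n0) _; rewrite /base; lia.
have [st' X R] := compile_correct big (isT : wf_cmd apsp) rep1 sf.
exists ((cost base_exp).+1 + atime apsp m0), st'; split.
- by apply: ExecSeq X; apply: ExecAssign.
- have dD : num_emits n (last_vertex s) (useq s) (vseq s) (edge e) <= 8 * d.+1 * n.-1.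
    apply: num_emits_bound => //; [exact: edge_sym | exact: edge_irr |].
    by move=> j jm; rewrite -sd_d; apply: sd_list_le.
  have l1 : 0 < lg n by rewrite /lg leq_max.
  have ll : trunc_log 2 n <= lg n by rewrite leq_maxr.
  (* Both bounds below enter twice: 4 = 2 * 2 for row and column nodes, 32 = 2 * 16 for the two
     cells per rectangle. *)
  have NN : num_nodes n (last_vertex s) (useq s) (vseq s) (edge e) <=
      (4 * lg n + 32 * maxn 1 d) * n.
    have h1 : 8 * d.+1 * n.-1 <= 16 * maxn 1 d * n by apply: leq_mul; lia.
    have h2 : (trunc_log 2 n).+1 * n <= 2 * lg n * n by apply: leq_mul; lia.
    by rewrite /num_nodes; lia.
  have := apsp_time_le n0 ll l1 (leq_maxl 1 d) NN.
  rewrite mulnDl => le; apply: leq_add (leq_trans tm le).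
  by rewrite leq_pmulr // !muln_gt0 leq_max n0 l1.
- apply: post_output post _ => // i hi; have [_ _ -> //] := R.
  by rewrite /base; lia.
Qed.
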